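(* Let $r$ be an analytic non-degenerate tensor field of type $(0,2)$ such that its matrix is diagonal in an analytic coordinate system $(x^1,x^2)$ on a neighborhood of $0\in\mathbb{R}^2$. Then the set of all analytic metric tensor fields whose Ricci tensors equal $r$ depends bijectively on arbitrarily chosen pairs $(\varphi,\psi)$ of analytic functions of one variable with $\varphi(0)\neq0$.
   Context: Tensor fields and functions in a neighborhood of $0$ are understood as their germs at $0$. Metric tensor fields are not necessarily positive definite. The matrix of $r$ is $(r(\partial_i,\partial_j))$. The Ricci tensor of a metric tensor field $g$ is the Ricci tensor of its Levi-Civita connection; in dimension $2$ it equals $fg$, where $f$ is the sectional curvature of $g$. *)

(* Defs.v *)
From HB Require Import structures.
From mathcomp Require Import all_boot all_order all_algebra.
From mathcomp Require Import all_classical all_reals all_analysis.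

Set Implicit Arguments.
Unset Strict Implicit.
Unset Printing Implicit Defensive.

Import Order.TTheory GRing.Theory Num.Theory.
Import numFieldNormedType.Exports.

Local Open Scope classical_set_scope.
Local Open Scope ring_scope.

Definition germ (T : topologicalType) (U : Type) (p : T) (f : T -> U) :
  set (T -> U) := [set g | \forall x \near p, g x = f x].

(* Analyticity is meant at 0, i.e. for germs at 0. *)
Definition analytic1 (R : realType) (f : R -> R) : Prop :=
  exists a : nat -> R, \forall t \near (0 : R), pseries a t @ \oo --> f t.

Definition monom2 (R : realType) (a : nat -> nat -> R) (x : 'rV[R]_2)
  (i j : nat) : R := a i j * x 0 0 ^+ i * x 0 1 ^+ j.

(* Absolutely convergent double power series, summed by total degree. *)
Definition analytic2 (R : realType) (f : 'rV[R]_2 -> R) : Prop :=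
  exists a : nat -> nat -> R, \forall x \near (0 : 'rV[R]_2),
    cvgn (series (fun n => \sum_(i < n.+1) `|monom2 a x i (n - i)%N|)) /\
    series (fun n => \sum_(i < n.+1) monom2 a x i (n - i)%N) @ \oo --> f x.

Section LeviCivita.
Variables (R : realType) (n : nat).
Implicit Type g : 'rV[R]_n -> 'M[R]_n.

Definition partial (i : 'I_n) (f : 'rV[R]_n -> R) (x : 'rV[R]_n) : R :=
  'D_(delta_mx 0 i) f x.

(* christoffel g k i j x is the coefficient of ∂_k in ∇_(∂_i) ∂_j. *)
Definition christoffel g (k i j : 'I_n) (x : 'rV[R]_n) : R :=
  2^-1 * \sum_l invmx (g x) k l *
    (partial i (fun y => g y j l) x + partial j (fun y => g y i l) x
     - partial l (fun y => g y i j) x).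

(* riemann g l i j k x is the coefficient of ∂_l in R(∂_i, ∂_j) ∂_k, where
   R(X, Y) Z = ∇_X ∇_Y Z - ∇_Y ∇_X Z - ∇_[X, Y] Z. *)
Definition riemann g (l i j k : 'I_n) (x : 'rV[R]_n) : R :=
  partial i (christoffel g l j k) x - partial j (christoffel g l i k) x
  + \sum_p (christoffel g l i p x * christoffel g p j k x
            - christoffel g l j p x * christoffel g p i k x).

(* Ric(Y, Z) = tr (X |-> R(X, Y) Z), so that round spheres have Ric > 0. *)
Definition ricci g (x : 'rV[R]_n) : 'M[R]_n :=
  \matrix_(j, k) \sum_i riemann g i i j k x.

End LeviCivita.

Definition analytic_tensor (R : realType) (s : 'rV[R]_2 -> 'M[R]_2) : Prop :=
  forall i j, analytic2 (fun x => s x i j).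

Definition nondegenerate_tensor (R : realType) (s : 'rV[R]_2 -> 'M[R]_2) :
    Prop :=
  \forall x \near (0 : 'rV[R]_2), s x \in unitmx.

Definition analytic_metric (R : realType) (g : 'rV[R]_2 -> 'M[R]_2) : Prop :=
  [/\ analytic_tensor g, \forall x \near (0 : 'rV[R]_2), (g x)^T = g x
    & nondegenerate_tensor g].

(* u = (x^1, x^2), centered at 0; v is the inverse of u. *)
Definition analytic_chart (R : realType) (u v : 'rV[R]_2 -> 'rV[R]_2) : Prop :=
  [/\ u 0 = 0,
      forall i, analytic2 (fun p => u p 0 i),
      forall i, analytic2 (fun y => v y 0 i),
      \forall p \near (0 : 'rV[R]_2), v (u p) = p
    & \forall y \near (0 : 'rV[R]_2), u (v y) = y].

(* The matrix (s(∂/∂x^i, ∂/∂x^j)) at the point with coordinates y; row i of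
   'J v y consists of the components of ∂/∂x^i. *)
Definition matrix_in_chart (R : realType) (v : 'rV[R]_2 -> 'rV[R]_2)
    (s : 'rV[R]_2 -> 'M[R]_2) (y : 'rV[R]_2) : 'M[R]_2 :=
  'J v y *m s (v y) *m ('J v y)^T.

Definition metrics_with_ricci (R : realType) (r : 'rV[R]_2 -> 'M[R]_2) :
    set (set ('rV[R]_2 -> 'M[R]_2)) :=
  [set germ (0 : 'rV[R]_2) g | g in [set g | analytic_metric g /\
     \forall x \near (0 : 'rV[R]_2), ricci g x = r x]].

Definition function_pairs (R : realType) : set (set (R -> R) * set (R -> R)) :=
  [set (germ (0 : R) h.1, germ (0 : R) h.2) | h in
     [set h : (R -> R) * (R -> R) |
       [/\ analytic1 h.1, analytic1 h.2 & h.1 0 != 0]]].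
Arguments function_pairs : clear implicits.

(* f(0, x^2) = phi(x^2) and (∂f/∂x^1)(0, x^2) = psi(x^2) *)
Definition cauchy_data (R : realType) (v : 'rV[R]_2 -> 'rV[R]_2)
    (f : 'rV[R]_2 -> R) (phi psi : R -> R) : Prop :=
  \forall t \near (0 : R), let y : 'rV[R]_2 := t *: delta_mx 0 1 in
    f (v y) = phi t /\ partial 0 (f \o v) y = psi t.

(* Since r = Ric g = f g in dimension 2, f is the sectional curvature of g. *)
Definition curvature_data (R : realType) (r : 'rV[R]_2 -> 'M[R]_2)
    (v : 'rV[R]_2 -> 'rV[R]_2) (g : 'rV[R]_2 -> 'M[R]_2) (phi psi : R -> R) :
    Prop :=
  exists f : 'rV[R]_2 -> R,
    [/\ analytic2 f, \forall x \near (0 : 'rV[R]_2), r x = f x *: g x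
      & cauchy_data v f phi psi].

(* Main.v *)
Require Import Defs.
From HB Require Import structures.
From mathcomp Require Import all_boot all_order all_algebra.
From mathcomp Require Import all_classical all_reals all_analysis.
From mathcomp Require Import ring lra.

Set Implicit Arguments.
Unset Strict Implicit.
Unset Printing Implicit Defensive.

Import Order.TTheory GRing.Theory Num.Theory.
Import numFieldNormedType.Exports.

Local Open Scope classical_set_scope.
Local Open Scope ring_scope.

(* In dimension 2 a metric g with Ric g = r is g = r / f with f its curvature.
   Writing f = c exp w, the conformal change of the Ricci tensor is
   Ric (exp (- w) r) = (K_r + (1/2) Lap_r w) r, K_r being the curvature of r, so
   that Ric g = r is the linear equation Lap_r w = 2 (1 - K_r).  In coordinates
   diagonalizing r the coefficient of the second derivative of w with respect
   to x^1 does not vanish, and the Cauchy-Kovalevskaya theorem solves the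
   equation uniquely for each choice of w and of its x^1-derivative on the line
   x^1 = 0; these data amount to phi = c exp w and psi = phi (dw/dx^1).
   The equation is never rewritten as a tensor equation in the chart: only the
   scalar unknown is composed with the chart. *)

(** * Numerical series *)

(** No exponential enters the curvature computation. A conformal factor [h] with dh = - h dw cancels
    from the Christoffel symbols of the metric [h r], so its Ricci tensor is a rational function of
    the 2-jets of [r] and [w], and the conformal change formula is an identity that [field] decides.
    Diagonality of [r] is used twice: it makes [r] symmetric, which is not assumed, and together
    with nondegeneracy it makes d/dx^2 a non-null vector, so that the line x^1 = 0 is
    noncharacteristic. On the analytic side, a function is handled through coefficients with a
    geometric bound. Near 0 the sequence of its homogeneous parts then has a bounded l1 norm with
    weights 2^m. These weights force partial sums to converge at rate 2^-n, so that products and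
    compositions reduce to estimates on finite sums. The constant c is phi(0): once it is split off,
    only the logarithm near 1 is needed, and phi may be negative. *)

Section NumericSeries.
Variable R : realType.
Implicit Types (c d p q : nat -> R) (C D K x y : R).

(** The weights 2^m give an explicit rate of convergence ([l1w_rate]), and the weighted norm is
    submultiplicative for Cauchy products ([l1w_cprod]). *)
Definition l1w c C := forall n, \sum_(m < n) 2 ^+ m * `|c m| <= C.

Definition cprod c d (m : nat) : R := \sum_(k < m.+1) c k * d (m - k)%N.

Lemma seriesE c n : series c n = \sum_(m < n) c m.
Proof. by rewrite /series /= big_mkord. Qed.

Lemma l1w_ge0 c C : l1w c C -> 0 <= C.
Proof. by move/(_ 0%N); rewrite big_ord0. Qed.

Lemma cvg_geometric_bound (u : nat -> R) C l :
  (forall n, `|u n - l| <= C * 2^-1 ^+ n) -> u @ \oo --> l.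
Proof.
move=> h; apply/cvgrPdistC_le => e e0.
have : (fun n => C * 2^-1 ^+ n) @ \oo --> (0 : R).
  rewrite -(mulr0 C); apply: cvgM; first exact: cvg_cst.
  apply: cvg_expr.
  by rewrite ger0_norm ?invr_ge0 // invf_lt1 // ltr1n.
move/cvgr_dist_le => /(_ _ e0); apply: filterS => n.
rewrite sub0r normrN => hn; apply: le_trans (h n) _.
by apply: le_trans (ler_norm _) hn.
Qed.

Lemma l1w_cvg c C : l1w c C -> cvgn (series c).
Proof.
move=> h; apply: normed_cvg; apply: nondecreasing_is_cvgn.
  by move=> m n mn; rewrite /series /=; exact: (@nondecreasing_series _ (fun k => `|c k|) predT 0%N).
exists C => _ [n _ <-]; apply: le_trans (h n).
change (series (fun k => `|c k|) n <= \sum_(m < n) 2 ^+ m * `|c m|).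
rewrite seriesE; apply: ler_sum => i _ /=.
by rewrite ler_peMl // exprn_ege1 // ler1n.
Qed.

(** Every term beyond n carries a weight of at least 2^n, so a finite tail is at most 2^-n times the
    weighted norm; the upper end of the tail then tends to infinity. *)
Lemma l1w_rate c C (l : R) n : l1w c C -> series c @ \oo --> l ->
  `|series c n - l| <= C * 2^-1 ^+ n.
Proof.
move=> h cl.
have hd : (fun k => `|series c n - series c k|) @ \oo --> `|series c n - l|.
  by apply: cvg_norm; apply: cvgB => //; exact: cvg_cst.
apply: (ler_cvg_to hd (cvg_cst _)).
near=> k.
have nk : (n <= k)%N by near: k; exact: nbhs_infty_ge.
rewrite distrC sub_series nk; apply: le_trans (ler_norm_sum _ _ _) _.
have e0 : (0 : R) < 2^-1 ^+ n by rewrite exprn_gt0 // invr_gt0.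
rewrite -ler_pdivrMr // -exprVn invrK.
apply: le_trans (h k).
rewrite -(big_mkord predT (fun m => 2 ^+ m * `|c m|)) /=.
rewrite [leRHS](big_cat_nat (n := n)) //= mulr_suml.
rewrite -[leLHS]add0r; apply: lerD; first by rewrite sumr_ge0 // => i _; rewrite mulr_ge0 // exprn_ge0.
rewrite !big_nat; apply: ler_sum => i /andP[ni _].
by rewrite mulrC ler_wpM2r // ler_weXn2l // ler1n.
Unshelve. all: by end_near. Qed.

(** Regroups the triangle k + l < n from diagonals into rows; partial sums of Cauchy products are
    estimated on this finite triangle. *)
Lemma triangle_sum (F : nat -> nat -> R) n :
  \sum_(m < n) \sum_(k < m.+1) F k (m - k)%N =
  \sum_(k < n) \sum_(l < n - k) F k l.
Proof.
elim: n => [|n IH]; first by rewrite !big_ord0.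
rewrite big_ord_recr /= IH [in RHS]big_ord_recr /= subSnn.
rewrite big_ord1.
under [in RHS]eq_bigr => k _ do rewrite subSn ?big_ord_recr ?(ltnW (ltn_ord k)) //=.
rewrite big_split /= -addrA; congr (_ + _).
by rewrite big_ord_recr /= subnn.
Qed.

Lemma l1w_cprod c d C D : l1w c C -> l1w d D -> l1w (cprod c d) (C * D).
Proof.
move=> hc hd n; have D0 := l1w_ge0 hd.
apply: le_trans (_ : \sum_(m < n) \sum_(k < m.+1)
   (2 ^+ k * `|c k|) * (2 ^+ (m - k) * `|d (m - k)%N|) <= _).
  apply: ler_sum => m _; rewrite -[leLHS]mulr1 -mulrA mulr1.
  apply: le_trans (_ : 2 ^+ m * \sum_(k < m.+1) `|c k * d (m - k)%N| <= _).
    by rewrite ler_wpM2l ?exprn_ge0 // ler_norm_sum.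
  rewrite mulr_sumr; apply: ler_sum => k _.
  by rewrite normrM mulrACA -exprD subnKC // -ltnS ltn_ord.
rewrite (triangle_sum (fun k l => (2 ^+ k * `|c k|) * (2 ^+ l * `|d l|))).
apply: le_trans (ler_wpM2r D0 (hc n)).
rewrite mulr_suml; apply: ler_sum => k _.
rewrite -mulr_sumr; apply: ler_wpM2l; last exact: hd.
by rewrite mulr_ge0 // exprn_ge0.
Qed.

(** On the triangle, [c k] multiplies the partial sum of [d] of length n - k, which misses [y] by at
    most D 2^-(n-k). Summed against the weights of [c], the errors amount to C D 2^-n. *)
Lemma cvg_cprod c d C D x y : l1w c C -> l1w d D ->
  series c @ \oo --> x -> series d @ \oo --> y ->
  series (cprod c d) @ \oo --> x * y.
Proof.
move=> hc hd cx dy.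
have -> : series (cprod c d) =
    (fun n => series c n * y) \+ (fun n => series (cprod c d) n - series c n * y).
  by apply/funext => n /=; rewrite addrC subrK.
rewrite -[x * y]addr0; apply: cvgD; first by apply: cvgM => //; exact: cvg_cst.
apply: (@cvg_geometric_bound _ (C * D)) => n; rewrite subr0.
rewrite !seriesE /cprod (triangle_sum (fun k l => c k * d l)) mulr_suml -sumrB.
apply: le_trans (ler_norm_sum _ _ _) _.
rewrite -mulrA mulrC.
have D0 := l1w_ge0 hd.
apply: le_trans (_ : (D * 2^-1 ^+ n) * \sum_(k < n) 2 ^+ k * `|c k| <= _); last first.
  by apply: ler_wpM2l (hc n); rewrite mulr_ge0 // exprn_ge0 // invr_ge0.
rewrite mulr_sumr; apply: ler_sum => k _.
rewrite -mulr_sumr -mulrBr normrM -seriesE.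
have kn : (k <= n)%N by rewrite ltnW.
rewrite mulrC mulrA ler_wpM2r //.
apply: le_trans (l1w_rate _ hd dy) _.
by rewrite -mulrA ler_wpM2l // expfB_cond ?invr_eq0 ?pnatr_eq0 // [2^-1 ^+ k]exprVn invrK.
Qed.

Fixpoint cpow p (i : nat) : nat -> R :=
  if i is i'.+1 then cprod p (cpow p i') else fun m => (m == 0%N)%:R.

(** If [p] and [q] list the homogeneous parts of functions X and Y, this lists those of X^i Y^j. *)
Definition cmono p q (i j : nat) := cprod (cpow p i) (cpow q j).

Lemma l1w_one : l1w (fun m => (m == 0%N)%:R) 1.
Proof.
case=> [|n]; first by rewrite big_ord0.
by rewrite big_ord_recl /= big1 ?addr0 ?expr0 ?normr1 ?mulr1 // => i _; rewrite normr0 mulr0.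
Qed.

Lemma series_one : series (fun m => (m == 0%N)%:R : R) @ \oo --> (1 : R).
Proof.
apply/cvgrPdist_le => e e0; near=> n.
have n0 : (0 < n)%N by near: n; exact: nbhs_infty_gt.
rewrite -(prednK n0) seriesE big_ord_recl big1 //= addr0 subrr normr0.
exact: ltW.
Unshelve. all: by end_near. Qed.

Lemma l1w_cpow p C i : l1w p C -> l1w (cpow p i) (C ^+ i).
Proof.
move=> h; elim: i => [|i IH] /=; first exact: l1w_one.
by rewrite exprS; exact: l1w_cprod.
Qed.

Lemma cvg_cpow p C x i : l1w p C -> series p @ \oo --> x ->
  series (cpow p i) @ \oo --> x ^+ i.
Proof.
move=> h px; elim: i => [|i IH] /=; first exact: series_one.
by rewrite exprS; apply: cvg_cprod h (l1w_cpow i h) px IH.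
Qed.

Lemma cprod_low c d i j : (forall m, (m < i)%N -> c m = 0) ->
  (forall m, (m < j)%N -> d m = 0) ->
  forall m, (m < i + j)%N -> cprod c d m = 0.
Proof.
move=> hc hd m mij; apply: big1 => k _.
have [ki|ik] := ltnP k i; first by rewrite hc ?mul0r.
have km : (k <= m)%N by rewrite -ltnS.
rewrite hd ?mulr0 // ltn_subLR //.
by apply: leq_trans mij _; rewrite leq_add2r.
Qed.

Lemma cpow_low p i m : p 0%N = 0 -> (m < i)%N -> cpow p i m = 0.
Proof.
move=> p0; elim: i m => // i IH m mi /=.
apply: (@cprod_low p (cpow p i) 1 i) => // k.
by rewrite ltnS leqn0 => /eqP ->.
Qed.

Lemma cmono_low p q i j m : p 0%N = 0 -> q 0%N = 0 -> (m < i + j)%N ->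
  cmono p q i j m = 0.
Proof. by move=> p0 q0; apply: cprod_low => k; apply: cpow_low. Qed.

Lemma l1w_cmono p q C i j : l1w p C -> l1w q C ->
  l1w (cmono p q i j) (C ^+ (i + j)).
Proof. by move=> hp hq; rewrite exprD; apply: l1w_cprod; apply: l1w_cpow. Qed.

Lemma cvg_cmono p q C x y i j : l1w p C -> l1w q C ->
  series p @ \oo --> x -> series q @ \oo --> y ->
  series (cmono p q i j) @ \oo --> x ^+ i * y ^+ j.
Proof.
move=> hp hq px qy; apply: cvg_cprod (l1w_cpow i hp) (l1w_cpow j hq) _ _;
  by apply: cvg_cpow; eassumption.
Qed.

(** Part of degree m of the double series [a] with [p] and [q] substituted. Stopping at n = m is
    exact when [p] and [q] start in degree 1, since X^i Y^j then has no part of degree below i +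
    j. *)
Definition ccomp (a : nat -> nat -> R) p q (m : nat) : R :=
  \sum_(n < m.+1) \sum_(i < n.+1) a i (n - i)%N * cmono p q i (n - i)%N m.

Lemma ccomp_widen a p q m N : p 0%N = 0 -> q 0%N = 0 -> (m < N)%N ->
  ccomp a p q m =
  \sum_(n < N) \sum_(i < n.+1) a i (n - i)%N * cmono p q i (n - i)%N m.
Proof.
move=> p0 q0 mN; rewrite /ccomp.
rewrite -!(big_mkord predT (fun n => \sum_(i < n.+1) a i (n - i)%N * cmono p q i (n - i)%N m)).
rewrite [in RHS](big_cat_nat (n := m.+1)) //= [X in _ + X]big1_seq ?addr0 // => n.
move=> /andP[_]; rewrite mem_index_iota => /andP[mn _]; apply: big1 => i _.
have ni : (i <= n)%N by rewrite -ltnS.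
by rewrite cmono_low ?mulr0 // subnKC.
Qed.

(** * Substitution of two sequences in a double series *)

Section Composition.
Variables (a : nat -> nat -> R) (p q : nat -> R) (s K : R).
Hypotheses (p0 : p 0%N = 0) (q0 : q 0%N = 0) (hp : l1w p s) (hq : l1w q s).
Hypothesis aK : forall N, \sum_(n < N) (\sum_(i < n.+1) `|a i (n - i)%N|) * s ^+ n <= K.

Lemma l1w_ccomp : l1w (ccomp a p q) K.
Proof.
move=> N; apply: le_trans (aK N).
apply: le_trans (_ : \sum_(m < N) \sum_(n < N) \sum_(i < n.+1)
  `|a i (n - i)%N| * (2 ^+ m * `|cmono p q i (n - i)%N m|) <= _).
  apply: ler_sum => m _; rewrite (ccomp_widen a p0 q0 (ltn_ord m)).
  apply: le_trans (_ : 2 ^+ m * (\sum_(n < N) \sum_(i < n.+1)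
     `|a i (n - i)%N| * `|cmono p q i (n - i)%N m|) <= _).
    rewrite ler_wpM2l ?exprn_ge0 //; apply: le_trans (ler_norm_sum _ _ _) _.
    apply: ler_sum => n _; apply: le_trans (ler_norm_sum _ _ _) _.
    by apply: ler_sum => i _; rewrite normrM.
  rewrite mulr_sumr; apply: ler_sum => n _; rewrite mulr_sumr; apply: ler_sum => i _.
  by rewrite mulrCA.
rewrite exchange_big /=; apply: ler_sum => n _.
rewrite exchange_big /= mulr_suml; apply: ler_sum => i _.
rewrite -mulr_sumr ler_wpM2l //.
by have := @l1w_cmono p q s i (n - i) hp hq N; rewrite subnKC // -ltnS ltn_ord.
Qed.

(** Both partial sums run over the same monomials of degree n < N. The weighted norm of such a
    monomial is at most s^n, so its truncation errs by at most s^n 2^-N, and [aK] sums the errors to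
    K 2^-N. *)
Lemma cvg_ccomp (x y l : R) : series p @ \oo --> x -> series q @ \oo --> y ->
  series (fun n => \sum_(i < n.+1) a i (n - i)%N * x ^+ i * y ^+ (n - i)) @ \oo --> l ->
  series (ccomp a p q) @ \oo --> l.
Proof.
move=> px qy; set t := series _ => tl.
have -> : series (ccomp a p q) = t \+ (fun n => series (ccomp a p q) n - t n).
  by apply/funext => n /=; rewrite addrC subrK.
rewrite -[l]addr0; apply: cvgD => //.
apply: (@cvg_geometric_bound _ K) => N; rewrite subr0 /t !seriesE.
have -> : \sum_(m < N) ccomp a p q m =
   \sum_(n < N) \sum_(i < n.+1) a i (n - i)%N * series (cmono p q i (n - i)%N) N.
  under eq_bigr => m _ do rewrite (ccomp_widen a p0 q0 (ltn_ord m)).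
  rewrite exchange_big /=; apply: eq_bigr => n _.
  rewrite exchange_big /=; apply: eq_bigr => i _.
  by rewrite seriesE mulr_sumr.
rewrite -sumrB; apply: le_trans (ler_norm_sum _ _ _) _.
apply: le_trans (ler_wpM2r _ (aK N)); last by rewrite exprn_ge0 // invr_ge0.
rewrite mulr_suml; apply: ler_sum => n _.
rewrite -sumrB -mulrA mulr_suml; apply: le_trans (ler_norm_sum _ _ _) _.
apply: ler_sum => i _; rewrite -mulrA -mulrBr normrM ler_wpM2l //.
have := l1w_rate N (@l1w_cmono p q s i (n - i) hp hq)
  (@cvg_cmono p q s x y i (n - i) hp hq px qy).
by rewrite subnKC // -ltnS ltn_ord.
Qed.
End Composition.

End NumericSeries.

(** * Power series in two variables *)

Section PowerSeries.
Variable R : realType.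
Local Notation T := 'rV[R]_2.
Local Notation coefs := (nat -> nat -> R).
Implicit Types (a b U V : coefs) (f g : T -> R) (x : T) (r s M : R).

Lemma near0P (P : set T) : (\forall x \near (0 : T), P x) <->
  exists2 e, 0 < e & forall x, (forall i, `|x 0 i| <= e) -> P x.
Proof.
split.
  move=> /nbhs_ballP[e /= e0 eP]; exists (e / 2); first by rewrite divr_gt0.
  move=> x xe; apply: eP; split => // i j; rewrite [i]ord1 mxE /ball /= sub0r normrN.
  by apply: le_lt_trans (xe j) _; rewrite gtr_pMr // invf_lt1 // ltr1n.
move=> [e e0 eP]; apply/nbhs_ballP; exists e => //= x [_ xe]; apply: eP => i.
by have := xe 0 i; rewrite mxE /ball /= sub0r normrN => /ltW.
Qed.

Lemma near0W (P : set T) : (forall x, P x) -> \forall x \near (0 : T), P x.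
Proof. by move=> h; apply/near0P; exists 1. Qed.

Definition homp a x n := \sum_(i < n.+1) monom2 a x i (n - i)%N.

(** One constant is both factor and ratio, and it is at least 1: the bound is then monotone in [M],
    and bounds of several series merge by taking a maximum. *)
Definition gb a M := 1 <= M /\ forall i j, `|a i j| <= M ^+ (i + j).+1.
Definition gbd a := exists M, gb a M.
Definition is_ps a f := gbd a /\ \forall x \near (0 : T), series (homp a x) @ \oo --> f x.

Lemma gb_ge0 a M : gb a M -> 0 <= M.
Proof. by case=> M1 _; apply: le_trans M1. Qed.

Lemma gb_mono a M N : M <= N -> gb a M -> gb a N.
Proof.
move=> MN [M1 h]; split; first exact: le_trans MN.
move=> i j; apply: le_trans (h i j) _; rewrite lerXn2r ?nnegrE //.
  by apply: le_trans M1.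
by apply: le_trans MN; apply: le_trans M1.
Qed.

Lemma gb_common a b : gbd a -> gbd b -> exists M, gb a M /\ gb b M.
Proof.
move=> [M hM] [N hN]; exists (Num.max M N).
by split; [apply: gb_mono hM|apply: gb_mono hN]; rewrite le_max lexx ?orbT.
Qed.

Lemma gbdI a C K : (forall i j, `|a i j| <= C * K ^+ (i + j)) -> gbd a.
Proof.
(* This constant dominates 1, the factor and the ratio at once. *)
move=> h; exists (1 + `|C| + `|K|).
have M1 : 1 <= 1 + `|C| + `|K| by rewrite -addrA ler_wpDr // addr_ge0.
split => // i j; apply: le_trans (h i j) _; apply: le_trans (ler_norm _) _.
rewrite normrM normrX exprS ler_pM //.
  by rewrite -addrA addrCA ler_wpDr // addr_ge0.
have M0 := le_trans ler01 M1.
by rewrite lerXn2r ?nnegrE // ler_wpDl // addr_ge0.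
Qed.

Definition tot a n := \sum_(i < n.+1) `|a i (n - i)%N|.

(** Degree n has n + 1 monomials, and n + 1 <= 2^n. *)
Lemma tot_le a M n : gb a M -> tot a n <= M * (2 * M) ^+ n.
Proof.
move=> h; have M0 := gb_ge0 h; case: h => M1 h.
apply: le_trans (_ : \sum_(i < n.+1) M ^+ n.+1 <= _).
  apply: ler_sum => i _; apply: le_trans (h _ _) _.
  by rewrite subnKC // -ltnS.
rewrite sumr_const card_ord -[leLHS]mulr_natl exprS mulrCA exprMn ler_wpM2l //.
rewrite ler_wpM2r ?exprn_ge0 // -natrX ler_nat.
by elim: n => // n IH; rewrite expnS mul2n -addnn -addn1 leq_add // expn_gt0.
Qed.

Lemma homp_le_tot a x r n : (forall i, `|x 0 i| <= r) -> `|homp a x n| <= tot a n * r ^+ n.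
Proof.
move=> xr; rewrite /homp /tot; apply: le_trans (ler_norm_sum _ _ _) _.
rewrite mulr_suml; apply: ler_sum => i _.
rewrite /monom2 -mulrA normrM ler_wpM2l // normrM !normrX.
have i_n : (i <= n)%N by rewrite -ltnS.
have r0 := le_trans (normr_ge0 _) (xr 0).
rewrite (_ : r ^+ n = r ^+ i * r ^+ (n - i)); last by rewrite -exprD subnKC.
by rewrite ler_pM ?exprn_ge0 // lerXn2r.
Qed.

Lemma half_sum n : \sum_(m < n) 2^-1 ^+ m <= 2 :> R.
Proof.
suff -> : \sum_(m < n) 2^-1 ^+ m = 2 - 2 * 2^-1 ^+ n :> R.
  by rewrite gerBl mulr_ge0 // exprn_ge0 // invr_ge0.
elim: n => [|n IH]; first by rewrite big_ord0 expr0 mulr1 subrr.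
by rewrite big_ord_recr /= IH exprS; field.
Qed.

(** The weight 2^m, the bound M (2 M)^m in degree m and the radius r combine into M (4 M r)^m; the
    condition 8 M r <= 1 makes this a geometric series of ratio 1/2. *)
Lemma l1w_hom a M r x : gb a M -> 8 * M * r <= 1 -> (forall i, `|x 0 i| <= r) ->
  l1w (homp a x) (2 * M).
Proof.
move=> h Mr xr n; have M0 := gb_ge0 h.
have r0 : 0 <= r by apply: le_trans (normr_ge0 _) (xr 0).
apply: le_trans (_ : \sum_(m < n) M * 2^-1 ^+ m <= _); last first.
  by rewrite -mulr_sumr mulrC ler_wpM2r // half_sum.
apply: ler_sum => m _.
apply: le_trans (ler_wpM2l _ (homp_le_tot _ _ xr)) _; first by rewrite exprn_ge0.
apply: le_trans (ler_wpM2l _ (ler_wpM2r _ (tot_le _ h))) _; rewrite ?exprn_ge0 //.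
rewrite -mulrA mulrCA ler_wpM2l // -!exprMn lerXn2r ?nnegrE //.
- by rewrite !mulr_ge0.
- by move: Mr; lra.
Qed.

(** Without constant term the norm is proportional to r, so an inner function becomes as small as a
    composition requires when the radius shrinks. *)
Lemma l1w_hom0 a M r x : gb a M -> 8 * M * r <= 1 -> (forall i, `|x 0 i| <= r) ->
  a 0%N 0%N = 0 -> l1w (homp a x) (8 * M * M * r).
Proof.
move=> h Mr xr a0 n; have M0 := gb_ge0 h.
have r0 : 0 <= r by apply: le_trans (normr_ge0 _) (xr 0).
have C0 : 0 <= 8 * M * M * r by rewrite !mulr_ge0.
case: n => [|n]; first by rewrite big_ord0.
rewrite big_ord_recl /= {1}/homp big_ord1 /monom2 /= a0 !mul0r normr0 mulr0 add0r.
apply: le_trans (_ : \sum_(m < n) (4 * M * M * r) * 2^-1 ^+ m <= _); last first.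
  rewrite -mulr_sumr; apply: le_trans (ler_wpM2l _ (half_sum n)) _; first by rewrite !mulr_ge0.
  by rewrite le_eqVlt; apply/orP; left; apply/eqP; ring.
apply: ler_sum => m _; rewrite /bump /= add1n.
apply: le_trans (ler_wpM2l _ (homp_le_tot _ _ xr)) _; first by rewrite exprn_ge0.
apply: le_trans (ler_wpM2l _ (ler_wpM2r _ (tot_le _ h))) _; rewrite ?exprn_ge0 //.
rewrite [leLHS](_ : _ = (4 * M * M * r) * (2 * (2 * M * r)) ^+ m); last by rewrite !exprS !exprMn; ring.
rewrite ler_wpM2l ?mulr_ge0 // lerXn2r ?nnegrE //.
- by rewrite !mulr_ge0.
- by move: Mr; lra.
Qed.

Lemma radius M : 1 <= M -> 0 < (8 * M)^-1 /\ 8 * M * (8 * M)^-1 <= 1.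
Proof.
move=> M1; have M0 : 0 < M by apply: lt_le_trans M1.
by rewrite invr_gt0 mulr_gt0 // mulfV // mulf_neq0 // gt_eqF.
Qed.

Lemma is_psP a f : is_ps a f -> exists M r, [/\ gb a M, 0 < r, 8 * M * r <= 1 &
  forall x, (forall i, `|x 0 i| <= r) -> series (homp a x) @ \oo --> f x].
Proof.
move=> [[M hM] /near0P[e e0 h]].
have M0 := gb_ge0 hM; have [r0 rM] := radius (proj1 hM).
exists M, (Num.min e (8 * M)^-1); split => //.
- by rewrite lt_min e0.
- by apply: le_trans rM; rewrite ler_wpM2l ?mulr_ge0 // ge_min lexx orbT.
- by move=> x xe; apply: h => i; apply: le_trans (xe i) _; rewrite ge_min lexx.
Qed.

Lemma near0_le r : 0 < r -> \forall x \near (0 : T), forall i, `|(x : T) 0 i| <= r.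
Proof. by move=> r0; apply/near0P; exists r. Qed.

(** At the point (e, e) the sums of absolute values in each degree form a convergent series, hence
    are bounded, and each dominates a single |a i j| e^(i+j). This gives a geometric bound of ratio
    1/e. *)
Lemma analytic2_ps f : analytic2 f -> exists a, is_ps a f.
Proof.
move=> [a /near0P[e e0 h]]; exists a; split; last first.
  by apply/near0P; exists e => // x /h[].
have [] := h (const_mx e); first by move=> i; rewrite mxE gtr0_norm.
move=> /cvg_series_cvg_0 c0 _.
have /cvg_seq_bounded : cvgn (fun n => \sum_(i < n.+1) `|monom2 a (const_mx e) i (n - i)|).
  by apply/cvg_ex; exists 0.
move=> [C [Cr hC]].
have {}hC n : \sum_(i < n.+1) `|monom2 a (const_mx e) i (n - i)| <= C + 1.
  by apply: le_trans (ler_norm _) _; apply: hC => //; rewrite ltrDl.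
apply: (@gbdI _ (C + 1) e^-1) => i j.
rewrite exprVn ler_pdivlMr ?exprn_gt0 //; apply: le_trans (hC (i + j)%N).
have ij : (i < (i + j).+1)%N by rewrite ltnS leq_addr.
rewrite (bigD1 (Ordinal ij)) //= ler_wpDr ?sumr_ge0 //.
by rewrite /monom2 !mxE addKn -mulrA -exprD normrM (ger0_norm (exprn_ge0 _ (ltW e0))).
Qed.

Lemma ps_analytic2 a f : is_ps a f -> analytic2 f.
Proof.
move=> /is_psP[M [r [hM r0 Mr h]]]; exists a; apply/near0P; exists r => // x xr.
split; last exact: h.
have M0 := gb_ge0 hM.
apply: (@l1w_cvg _ _ (2 * M)).
have h2 : gb (fun i j => `|a i j|) M by case: hM => M1 hM; split => // i j; rewrite normr_id.
(* The series of absolute values is the series with coefficients |a i j| at the point with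
   coordinates |x 0 i|, so the same norm estimate covers it. *)
suff -> : (fun n => \sum_(i < n.+1) `|monom2 a x i (n - i)|) =
    homp (fun i j => `|a i j|) (\row_i `|x 0 i|).
  by apply: (l1w_hom h2 Mr) => i; rewrite mxE normr_id.
apply/funext => n; apply: eq_bigr => i _.
by rewrite /monom2 !mxE !normrM !normrX.
Qed.

Lemma ps_ext a f g : is_ps a f -> (\forall x \near (0 : T), f x = g x) -> is_ps a g.
Proof.
move=> [ga h] fg; split => //; apply: filterS2 h fg => x hx fgx.
by rewrite -fgx.
Qed.

Lemma ps_fun_unique a f g : is_ps a f -> is_ps a g -> \forall x \near (0 : T), f x = g x.
Proof. by move=> [_ h] [_ h']; apply: filterS2 h h' => x; exact: cvg_unique. Qed.

Lemma ps_exists a : gbd a -> exists f, is_ps a f.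
Proof.
move=> [M hM]; exists (fun x => limn (series (homp a x))); split; first by exists M.
have [r0 rM] := radius (proj1 hM).
apply/near0P; exists (8 * M)^-1 => // x xr; exact: l1w_cvg (l1w_hom hM rM xr).
Qed.

Lemma ps_add a b f g : is_ps a f -> is_ps b g ->
  is_ps (fun i j => a i j + b i j) (fun x => f x + g x).
Proof.
move=> [ga ha] [gb_ hb]; split.
  have [M [[M1 hM] [_ hN]]] := gb_common ga gb_.
  apply: (@gbdI _ (2 * M) M) => i j; apply: le_trans (ler_normD _ _) _.
  by rewrite -mulrA -exprS mulrC mulr_natr mulr2n lerD.
apply: filterS2 ha hb => x hx hy.
suff -> : series (homp (fun i j => a i j + b i j) x) = series (homp a x) \+ series (homp b x).
  exact: cvgD.
apply/funext => n /=; rewrite !seriesE -big_split; apply: eq_bigr => m _ /=.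
rewrite -big_split; apply: eq_bigr => i _ /=.
by rewrite /monom2 !mulrDl.
Qed.

Lemma ps_scale (k : R) a f : is_ps a f ->
  is_ps (fun i j => k * a i j) (fun x => k * f x).
Proof.
move=> [[M [M1 hM]] ha]; split.
  apply: (@gbdI _ (`|k| * M) M) => i j; rewrite normrM -mulrA -exprS.
  by rewrite ler_wpM2l.
apply: filterS ha => x hx.
suff -> : series (homp (fun i j => k * a i j) x) = (fun n => k * series (homp a x) n).
  by apply: cvgM => //; exact: cvg_cst.
apply/funext => n /=; rewrite !seriesE mulr_sumr; apply: eq_bigr => m _ /=.
rewrite mulr_sumr; apply: eq_bigr => i _ /=.
by rewrite /monom2 !mulrA.
Qed.

Definition cst_coefs (k : R) : coefs := fun i j => if (i == 0%N) && (j == 0%N) then k else 0.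

Lemma homp_cst k x n : homp (cst_coefs k) x n = if n == 0%N then k else 0.
Proof.
rewrite /homp; case: n => [|n].
  by rewrite big_ord1 /monom2 /= /cst_coefs /= !mulr1.
apply: big1 => i _; rewrite /monom2 /cst_coefs.
case: eqP => [->|_]; last by rewrite !mul0r.
by rewrite subn0 /= !mul0r.
Qed.

Lemma gbd_cst k : gbd (cst_coefs k).
Proof.
apply: (@gbdI _ `|k| 1) => i j; rewrite /cst_coefs expr1n mulr1.
by case: ifP => _; rewrite ?normr0.
Qed.

Lemma ps_cst k : is_ps (cst_coefs k) (fun=> k).
Proof.
split; first exact: gbd_cst.
apply/near0P; exists 1 => // x _; rewrite -[X in _ --> X](mul1r k).
suff -> : series (homp (cst_coefs k) x) = (fun n => series (fun m => (m == 0%N)%:R) n * k).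
  by apply: cvgM; [exact: series_one|exact: cvg_cst].
apply/funext => n; rewrite !seriesE mulr_suml; apply: eq_bigr => m _.
by rewrite homp_cst; case: eqP => _; rewrite ?mul1r ?mul0r.
Qed.

Definition conv2 a b : coefs := fun m n =>
  \sum_(i < m.+1) \sum_(j < n.+1) a i j * b (m - i)%N (n - j)%N.

Lemma triangle_exchange (F : nat -> nat -> R) n :
  \sum_(k < n) \sum_(l < n - k) F k l = \sum_(l < n) \sum_(k < n - l) F k l.
Proof.
rewrite -triangle_sum -(triangle_sum (fun l k => F k l)).
apply: eq_bigr => m _; rewrite (reindex_inj rev_ord_inj) /=.
apply: eq_bigr => k _; rewrite subSS subKn // -ltnS; exact: ltn_ord.
Qed.

(** Both sides sum [a i j * b i' j'] times its monomial over i + j + i' + j' = n; they differ in the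
    order in which i' and j are summed, which [F] and [H] record. *)
Lemma homp_conv a b x : homp (conv2 a b) x = cprod (homp a x) (homp b x).
Proof.
apply/funext => n.
pose G i j i' j' := monom2 a x i j * monom2 b x i' j'.
pose F i i' := \sum_(j < (n - i - i').+1) G i j i' (n - i - i' - j)%N.
transitivity (\sum_(m < n.+1) \sum_(i < m.+1) F i (m - i)%N).
  apply: eq_bigr => m _; rewrite /monom2 /conv2.
  have mn : (m <= n)%N by rewrite -ltnS.
  rewrite !mulr_suml; apply: eq_bigr => i _ /=.
  have im : (i <= m)%N by rewrite -ltnS.
  rewrite /F; have -> : (n - i - (m - i) = n - m)%N by rewrite -subnDA subnKC.
  rewrite !mulr_suml; apply: eq_bigr => j _; rewrite /G /monom2.
  have jn : (j <= n - m)%N by rewrite -ltnS.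
  have -> : x 0 0 ^+ m = x 0 0 ^+ i * x 0 0 ^+ (m - i) by rewrite -exprD subnKC.
  have -> : x 0 1 ^+ (n - m) = x 0 1 ^+ j * x 0 1 ^+ (n - m - j) by rewrite -exprD subnKC.
  by ring.
rewrite triangle_sum.
pose H i j := \sum_(i' < (n - i - j).+1) G i j i' (n - i - j - i')%N.
transitivity (\sum_(k < n.+1) \sum_(i < k.+1) H i (k - i)%N); last first.
  apply: eq_bigr => k _; rewrite mulr_suml; apply: eq_bigr => i _ /=.
  have ik : (i <= k)%N by rewrite -ltnS.
  rewrite /H; have -> : (n - i - (k - i) = n - k)%N by rewrite -subnDA subnKC.
  by rewrite mulr_sumr.
rewrite triangle_sum; apply: eq_bigr => i _.
have i_n : (i <= n)%N by rewrite -ltnS.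
rewrite /F /H subSn //.
have h (F' : nat -> nat -> nat -> R) : \sum_(l < (n - i).+1) \sum_(j < (n - i - l).+1) F' l j (n - i - l - j)%N
   = \sum_(l < (n - i).+1) \sum_(j < (n - i).+1 - l) F' l j (n - i - l - j)%N.
  by apply: eq_bigr => l _; rewrite subSn // -ltnS.
rewrite (h (fun i' j j' => G i j i' j')) (h (fun j i' j' => G i j i' j')).
rewrite (triangle_exchange (fun i' j => G i j i' (n - i - i' - j)%N)).
apply: eq_bigr => j _; apply: eq_bigr => i' _.
by rewrite subnAC.
Qed.

Lemma gbd_conv a b : gbd a -> gbd b -> gbd (conv2 a b).
Proof.
move=> ga gb_; have [M [hM hN]] := gb_common ga gb_.
have M0 := gb_ge0 hM; case: hM hN => M1 hM [_ hN].
apply: (@gbdI _ (M * M) (2 * M)) => k l.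
apply: le_trans (_ : \sum_(i < k.+1) \sum_(j < l.+1) M * M * M ^+ (k + l) <= _).
  apply: le_trans (ler_norm_sum _ _ _) _; apply: ler_sum => i _.
  apply: le_trans (ler_norm_sum _ _ _) _; apply: ler_sum => j _.
  rewrite normrM; apply: le_trans (ler_pM _ _ (hM i j) (hN _ _)) _ => //.
  have ik : (i <= k)%N by rewrite -ltnS.
  have jl : (j <= l)%N by rewrite -ltnS.
  rewrite -exprD -expr2 -exprD.
  suff -> : ((i + j).+1 + (k - i + (l - j)).+1 = 2 + (k + l))%N by [].
  by rewrite addSn addnS addnACA !subnKC.
rewrite !sumr_const !card_ord -mulrnA -[leLHS]mulr_natl mulrCA ler_wpM2l ?mulr_ge0 //.
rewrite exprMn ler_wpM2r ?exprn_ge0 // -natrX ler_nat addnC expnD.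
have h n : (n.+1 <= 2 ^ n)%N.
  by elim: n => // n IH; rewrite expnS mul2n -addnn -addn1 leq_add // expn_gt0.
by rewrite leq_mul.
Qed.

Lemma ps_mul a b f g : is_ps a f -> is_ps b g -> is_ps (conv2 a b) (fun x => f x * g x).
Proof.
move=> hf hg; split; first by apply: gbd_conv; [case: hf|case: hg].
have [M [r [hM r0 Mr h]]] := is_psP hf.
have [N [s [hN s0 Ns k]]] := is_psP hg.
apply: filterS2 (near0_le r0) (near0_le s0) => x xr xs.
rewrite homp_conv.
exact: cvg_cprod (l1w_hom hM Mr xr) (l1w_hom hN Ns xs) (h _ xr) (k _ xs).
Qed.

Fixpoint conv_pow a (n : nat) : coefs := if n is n'.+1 then conv2 a (conv_pow a n') else cst_coefs 1.

Lemma homp_conv_pow a x n : homp (conv_pow a n) x = cpow (homp a x) n.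
Proof.
elim: n => [|n IH] /=; last by rewrite homp_conv IH.
by apply/funext => m; rewrite homp_cst; case: eqP.
Qed.

Definition comp_coefs a U V : coefs := fun i j =>
  \sum_(n < (i + j).+1) \sum_(k < n.+1)
    a k (n - k)%N * conv2 (conv_pow U k) (conv_pow V (n - k)) i j.

Lemma homp_comp a U V x : homp (comp_coefs a U V) x = ccomp a (homp U x) (homp V x).
Proof.
apply/funext => m; rewrite /homp /ccomp /comp_coefs.
under eq_bigr => i _.
  have im : (i <= m)%N by rewrite -ltnS.
  rewrite /monom2 subnKC // !mulr_suml.
  over.
rewrite exchange_big /=; apply: eq_bigr => n _.
under eq_bigr => i _ do rewrite !mulr_suml.
rewrite exchange_big /=; apply: eq_bigr => k _.
rewrite /cmono -!homp_conv_pow -homp_conv /homp mulr_sumr; apply: eq_bigr => i _.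
by rewrite /monom2 !mulrA.
Qed.

Lemma conv_abs a b a' b' : (forall i j, `|a i j| <= a' i j) -> (forall i j, `|b i j| <= b' i j) ->
  forall i j, `|conv2 a b i j| <= conv2 a' b' i j.
Proof.
move=> ha hb k l; apply: le_trans (ler_norm_sum _ _ _) _; apply: ler_sum => i _.
apply: le_trans (ler_norm_sum _ _ _) _; apply: ler_sum => j _.
by rewrite normrM ler_pM.
Qed.

Lemma conv_pow_abs a a' n : (forall i j, `|a i j| <= a' i j) ->
  forall i j, `|conv_pow a n i j| <= conv_pow a' n i j.
Proof.
move=> h; elim: n => [|n IH] /=; last exact: conv_abs.
by move=> i j; rewrite /cst_coefs; case: ifP => _; rewrite ?normr1 ?normr0.
Qed.

Lemma comp_abs a U V i j : `|comp_coefs a U V i j| <=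
  comp_coefs (fun i j => `|a i j|) (fun i j => `|U i j|) (fun i j => `|V i j|) i j.
Proof.
apply: le_trans (ler_norm_sum _ _ _) _; apply: ler_sum => n _.
apply: le_trans (ler_norm_sum _ _ _) _; apply: ler_sum => k _.
by rewrite normrM ler_wpM2l //; apply: conv_abs => i' j'; apply: conv_pow_abs.
Qed.

Lemma tot_sum_le a M s N : gb a M -> 0 <= s -> 4 * M * s <= 1 ->
  \sum_(n < N) tot a n * s ^+ n <= 2 * M.
Proof.
move=> hM s0 Ms; have M0 := gb_ge0 hM.
apply: le_trans (_ : \sum_(m < N) M * 2^-1 ^+ m <= _); last first.
  by rewrite -mulr_sumr mulrC ler_wpM2r // half_sum.
apply: ler_sum => m _; apply: le_trans (ler_wpM2r _ (tot_le _ hM)) _; rewrite ?exprn_ge0 //.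
rewrite -mulrA ler_wpM2l // -exprMn lerXn2r ?nnegrE ?mulr_ge0 ?invr_ge0 //.
by move: Ms; lra.
Qed.

(** The radius r is so small that the inner functions stay below s = 8 N N r ([l1w_hom0]), with s
    inside the square where the series of [f] converges and small enough for its coefficients to be
    summable against s^n. *)
Lemma ps_comp a f U V (u : T -> T) : is_ps a f ->
  is_ps U (fun x => u x 0 0) -> is_ps V (fun x => u x 0 1) ->
  U 0%N 0%N = 0 -> V 0%N 0%N = 0 -> is_ps (comp_coefs a U V) (fun x => f (u x)).
Proof.
move=> hf hU hV U0 V0.
have [M [e [hM e0 Me h]]] := is_psP hf.
have [N1 [r1 [hN1 r10 Nr1 hu]]] := is_psP hU.
have [N2 [r2 [hN2 r20 Nr2 hv]]] := is_psP hV.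
pose N := Num.max N1 N2.
have {}hN1 : gb U N by apply: gb_mono hN1; rewrite le_max lexx.
have {}hN2 : gb V N by apply: gb_mono hN2; rewrite le_max lexx orbT.
have N1_ : 1 <= N by case: hN1.
have N0 : 0 < N by apply: lt_le_trans N1_.
have [q0 Nq] := radius N1_.
pose r := Num.min (Num.min r1 r2) (Num.min (8 * N)^-1 (e / (8 * N * N))).
have rr1 : r <= r1 by rewrite /r !ge_min lexx.
have rr2 : r <= r2 by rewrite /r !ge_min lexx orbT.
have r0 : 0 < r by rewrite /r !lt_min r10 r20 q0 divr_gt0 // !mulr_gt0.
have Nr : 8 * N * r <= 1.
  by apply: le_trans Nq; rewrite ler_wpM2l ?mulr_ge0 ?(ltW N0) // /r !ge_min lexx !orbT.
have se : 8 * N * N * r <= e.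
  rewrite mulrC -ler_pdivlMr ?mulr_gt0 // /r !ge_min; by rewrite lexx !orbT.
set s := 8 * N * N * r in se.
have s0 : 0 <= s by rewrite /s !mulr_ge0 // ltW.
have M0 := gb_ge0 hM.
have Ms : 4 * M * s <= 1.
  by have : M * s <= M * e by [rewrite ler_wpM2l]; have := mulr_ge0 M0 (ltW e0); move: Me; lra.
have tb n := tot_sum_le n hM s0 Ms.
split; last first.
  apply: filterS (near0_le r0) => x xr; rewrite homp_comp.
  have lU := l1w_hom0 hN1 Nr xr U0.
  have lV := l1w_hom0 hN2 Nr xr V0.
  have cU : series (homp U x) @ \oo --> u x 0 0 by apply: hu => i; apply: le_trans rr1.
  have cV : series (homp V x) @ \oo --> u x 0 1 by apply: hv => i; apply: le_trans rr2.
  apply: (@cvg_ccomp _ a (homp U x) (homp V x) s (2 * M) _ _ lU lV tb (u x 0 0) (u x 0 1)) => //.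
  - by rewrite /homp big_ord1 /monom2 U0 !mul0r.
  - by rewrite /homp big_ord1 /monom2 V0 !mul0r.
  - apply: h => i; apply: le_trans se.
    have [->|->] : i = 0 \/ i = 1.
      by case: i => [[|[|//]]] hi; [left|right]; apply/val_inj.
    + by have := l1w_rate 0 lU cU; rewrite seriesE big_ord0 sub0r normrN mulr1.
    + by have := l1w_rate 0 lV cV; rewrite seriesE big_ord0 sub0r normrN mulr1.
(* The geometric bound on the composed coefficients: they are majorized by the composition of the
   series of absolute values, and at the point (r, r) one nonnegative term is at most its whole
   homogeneous part. *)
have hA : gb (fun i j => `|a i j|) M by case: hM => ? hM; split => // i j; rewrite normr_id.
have hU' : gb (fun i j => `|U i j|) N by case: hN1 => ? k; split => // i j; rewrite normr_id.
have hV' : gb (fun i j => `|V i j|) N by case: hN2 => ? k; split => // i j; rewrite normr_id.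
have xr i : `|(const_mx r : T) 0 i| <= r by rewrite mxE gtr0_norm.
have lU := l1w_hom0 hU' Nr xr (etrans (congr1 _ U0) (normr0 _)).
have lV := l1w_hom0 hV' Nr xr (etrans (congr1 _ V0) (normr0 _)).
have tA n := tot_sum_le n hA s0 Ms.
have lc := @l1w_ccomp _ (fun i j => `|a i j|) _ _ s (2 * M) _ _ lU lV tA.
apply: (@gbdI _ (2 * M) r^-1) => i j.
apply: le_trans (comp_abs _ _ _ _ _) _.
rewrite exprVn ler_pdivlMr ?exprn_gt0 //.
set A := comp_coefs _ _ _.
have A0 i' j' : 0 <= A i' j' by apply: le_trans (comp_abs _ _ _ _ _).
apply: le_trans (_ : homp A (const_mx r) (i + j) <= _).
  have ij : (i < (i + j).+1)%N by rewrite ltnS leq_addr.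
  rewrite /homp (bigD1 (Ordinal ij)) //= addKn /monom2 !mxE -mulrA -exprD lerDl.
  by apply: sumr_ge0 => k _; rewrite !mulr_ge0 ?exprn_ge0 // ltW.
rewrite /A homp_comp; apply: le_trans (ler_norm _) _.
apply: le_trans (lc _ _ (i + j).+1).
- rewrite big_ord_recr /= -[leLHS]add0r lerD ?sumr_ge0 //.
  by rewrite ler_peMl // exprn_ege1 // ler1n.
- by rewrite /homp big_ord1 /monom2 U0 normr0 !mul0r.
- by rewrite /homp big_ord1 /monom2 V0 normr0 !mul0r.
Qed.

End PowerSeries.

(** * Derivatives of power series *)

Section Derivatives.
Variable R : realType.
Local Notation T := 'rV[R]_2.
Local Notation coefs := (nat -> nat -> R).
Implicit Types (a b U V : coefs) (f g : T -> R) (x y : T) (r s M : R).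
Local Notation e_ i := (delta_mx 0 i : T).

Definition d0 a : coefs := fun i j => i.+1%:R * a i.+1 j.
(** Serves to deduce statements about the second variable from those about the first. *)
Definition swap_coefs a : coefs := fun i j => a j i.
Definition d1 a : coefs := fun i j => j.+1%:R * a i j.+1.
Definition swap x : T := \row_i x 0 (rev_ord i).

Lemma ord2P (i : 'I_2) : i = 0 \/ i = 1.
Proof. by case: i => [[|[|//]]] hi; [left|right]; apply/val_inj. Qed.

Lemma rev_ord20 : rev_ord (0 : 'I_2) = 1. Proof. exact/val_inj. Qed.
Lemma rev_ord21 : rev_ord (1 : 'I_2) = 0. Proof. exact/val_inj. Qed.

Lemma row2P x y : x 0 0 = y 0 0 -> x 0 1 = y 0 1 -> x = y.
Proof. by move=> h0 h1; apply/rowP => i; case: (ord2P i) => ->. Qed.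

Lemma swapK : involutive swap.
Proof. by move=> x; apply/rowP => i; rewrite !mxE rev_ordK. Qed.

Lemma homp_swap a x : homp (swap_coefs a) (swap x) = homp a x.
Proof.
apply/funext => n; rewrite /homp (reindex_inj rev_ord_inj) /=; apply: eq_bigr => i _.
rewrite /monom2 /swap_coefs !mxE rev_ord20 rev_ord21 subSS subKn; last by rewrite -ltnS.
by rewrite mulrAC.
Qed.

Lemma gbd_swap a : gbd a -> gbd (swap_coefs a).
Proof. by move=> [M [M1 h]]; exists M; split => // i j; rewrite addnC; apply: h. Qed.

Lemma ps_swap a f : is_ps a f -> is_ps (swap_coefs a) (f \o swap).
Proof.
move=> [ga /near0P[e e0 h]]; split; first exact: gbd_swap.
apply/near0P; exists e => // x xe; rewrite -{1}(swapK x) homp_swap; apply: h => i.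
by rewrite mxE.
Qed.

Lemma gbd_d0 a : gbd a -> gbd (d0 a).
Proof.
move=> [M hM]; have M0 := gb_ge0 hM; case: hM => M1 h.
apply: (@gbdI _ _ (M * M) (2 * M)) => i j.
rewrite /d0 normrM normr_nat.
apply: le_trans (ler_wpM2l _ (h _ _)) _; first exact: ler0n.
rewrite [leLHS](_ : _ = (M * M) * (i.+1%:R * M ^+ (i + j))); last by rewrite addSn !exprS; ring.
rewrite ler_wpM2l ?mulr_ge0 // exprMn ler_wpM2r ?exprn_ge0 // -natrX ler_nat.
apply: leq_trans (_ : 2 ^ i <= _)%N; last by rewrite leq_exp2l // leq_addr.
by elim: i => // i IH; rewrite expnS mul2n -addnn -addn1 leq_add // expn_gt0.
Qed.

Lemma gbd_d1 a : gbd a -> gbd (d1 a).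
Proof. by move=> ga; apply: (gbd_swap (gbd_d0 (gbd_swap ga))). Qed.

(** The remainder for i + 1 is (s + h) times the remainder for i plus h^2 i s^(i-1). Each summand is
    at most half of the bound for i + 1, whence the ratio 2 r. *)
Lemma pow_taylor (s h r : R) i : 0 < r -> `|s| <= r -> `|s + h| <= r ->
  `|(s + h) ^+ i - s ^+ i - h * (i%:R * s ^+ i.-1)| <= h ^+ 2 * (r ^- 2 * (2 * r) ^+ i).
Proof.
move=> r0 sr shr; elim: i => [|i IH].
  by rewrite !expr0 mul0r mulr0 subrr subr0 normr0 mulr1 mulr_ge0 ?sqr_ge0 // invr_ge0 sqr_ge0.
have -> : (s + h) ^+ i.+1 - s ^+ i.+1 - h * (i.+1%:R * s ^+ i.+1.-1) =
   (s + h) * ((s + h) ^+ i - s ^+ i - h * (i%:R * s ^+ i.-1)) + h ^+ 2 * (i%:R * s ^+ i.-1).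
  rewrite !exprS /= -natr1; case: i {IH} => [|i] /=; first by rewrite !expr0; ring.
  by rewrite !exprS; ring.
apply: le_trans (ler_normD _ _) _.
have h1 : `|(s + h) * ((s + h) ^+ i - s ^+ i - h * (i%:R * s ^+ i.-1))| <=
    r * (h ^+ 2 * (r ^- 2 * (2 * r) ^+ i)) by rewrite normrM; apply: ler_pM.
have h2 : `|h ^+ 2 * (i%:R * s ^+ i.-1)| <= r * (h ^+ 2 * (r ^- 2 * (2 * r) ^+ i)).
  rewrite normrM (ger0_norm (sqr_ge0 _)) normrM normr_nat normrX [leRHS]mulrCA ler_wpM2l ?sqr_ge0 //.
  case: i {IH h1} => [|i]; first by rewrite mul0r !mulr_ge0 ?invr_ge0 ?sqr_ge0 ?ltW //.
  have -> : r * (r ^- 2 * (2 * r) ^+ i.+1) = 2 ^+ i.+1 * r ^+ i.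
    by rewrite exprMn !exprS; field; rewrite gt_eqF.
  rewrite ler_pM // ?exprn_ge0 //; last by rewrite lerXn2r ?nnegrE // ltW.
  rewrite -natrX ler_nat.
  by elim: i => // i IH; rewrite expnS mul2n -addnn -addn1 leq_add // expn_gt0.
apply: le_trans (lerD h1 h2) _; rewrite [(2 * r) ^+ i.+1]exprS le_eqVlt; apply/orP; left; apply/eqP.
by ring.
Qed.

(** Differentiation lowers the degree by one, hence the lengths n + 1 and n: with this shift the
    remainder is a finite sum of remainders of powers. *)
Lemma taylor0_sum a M r x h n : gb a M -> 0 < r -> 8 * M * r <= 1 ->
  (forall i, `|x 0 i| <= r) -> `|x 0 0 + h| <= r ->
  `|series (homp a (x + h *: e_ 0)) n.+1 - series (homp a x) n.+1
    - h * series (homp (d0 a) x) n| <= 2 * M * r ^- 2 * h ^+ 2.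
Proof.
move=> hM r0 Mr xr xhr; have M0 := gb_ge0 hM.
have -> : series (homp (d0 a) x) n = \sum_(m < n.+1) \sum_(i < m.+1)
   a i (m - i)%N * (i%:R * x 0 0 ^+ i.-1) * x 0 1 ^+ (m - i).
  rewrite seriesE big_ord_recl big_ord1 /= !mul0r mulr0 mul0r add0r.
  apply: eq_bigr => m _; rewrite /bump /= add1n [RHS]big_ord_recl /= !mul0r mulr0 mul0r add0r.
  apply: eq_bigr => i _; rewrite /monom2 /d0 /bump /= add1n subSS /=; ring.
rewrite !seriesE mulr_sumr -!sumrB.
apply: le_trans (_ : \sum_(m < n.+1) tot a m * (2 * r) ^+ m * (h ^+ 2 * r ^- 2) <= _); last first.
  rewrite -mulr_suml mulrC [leRHS]mulrC [leRHS]mulrA -mulrA [leLHS]mulrC mulrC.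
  rewrite [leRHS](_ : _ = (h ^+ 2 * r ^- 2) * (2 * M)); last by ring.
  apply: ler_wpM2l; first exact: divr_ge0 (sqr_ge0 _) (sqr_ge0 _).
  apply: tot_sum_le => //; first by rewrite mulr_ge0 // ltW.
  by move: Mr; lra.
apply: le_trans (ler_norm_sum _ _ _) _; apply: ler_sum => m _.
rewrite mulr_sumr -!sumrB /tot !mulr_suml.
apply: le_trans (ler_norm_sum _ _ _) _; apply: ler_sum => i _.
have im : (i <= m)%N by rewrite -ltnS.
rewrite /monom2 !mxE /= mulr1 mulr0 addr0.
rewrite [X in `|X|](_ : _ = a i (m - i)%N * (((x 0 0 + h) ^+ i - x 0 0 ^+ i
    - h * (i%:R * x 0 0 ^+ i.-1)) * x 0 1 ^+ (m - i))); last by ring.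
rewrite normrM -!mulrA ler_wpM2l // normrM normrX.
rewrite (_ : (2 * r) ^+ m = (2 * r) ^+ i * (2 * r) ^+ (m - i)); last by rewrite -exprD subnKC.
rewrite [leRHS](_ : _ = (h ^+ 2 * (r ^- 2 * (2 * r) ^+ i)) * (2 * r) ^+ (m - i)); last by ring.
apply: ler_pM => //.
  exact: pow_taylor.
have r2 : 0 <= 2 * r by rewrite mulr_ge0 // ltW.
rewrite lerXn2r ?nnegrE //; apply: le_trans (xr 1) _.
by rewrite ler_peMl ?ler1n // ltW.
Qed.

Lemma ps_taylor0 a f f0 : is_ps a f -> is_ps (d0 a) f0 -> exists r K, [/\ 0 < r, 0 <= K &
  forall x h, (forall i, `|x 0 i| <= r) -> `|x 0 0 + h| <= r ->
  `|f (x + h *: e_ 0) - f x - h * f0 x| <= K * h ^+ 2].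
Proof.
move=> hf hf0; have [M [r [hM r0 Mr hx]]] := is_psP hf.
have [N [s [hN s0 Ns hx0]]] := is_psP hf0.
pose t := Num.min r s.
have t0 : 0 < t by rewrite lt_min r0.
have tr : t <= r by rewrite ge_min lexx.
have ts : t <= s by rewrite ge_min lexx orbT.
have M0 := gb_ge0 hM.
have Mt : 8 * M * t <= 1 by apply: le_trans Mr; rewrite ler_wpM2l // mulr_ge0.
exists t, (2 * M * t ^- 2); split => //.
  by rewrite !mulr_ge0 // invr_ge0 sqr_ge0.
move=> x h xt xht.
have c1 : series (homp a (x + h *: e_ 0)) @ \oo --> f (x + h *: e_ 0).
  apply: hx => i; apply: le_trans tr; rewrite !mxE.
  by case: (ord2P i) => -> /=; rewrite ?mulr1 // mulr0 addr0.
have c2 : series (homp a x) @ \oo --> f x by apply: hx => i; apply: le_trans tr.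
have c3 : series (homp (d0 a) x) @ \oo --> f0 x by apply: hx0 => i; apply: le_trans ts.
have hd : (fun n => `|series (homp a (x + h *: e_ 0)) n.+1 - series (homp a x) n.+1
    - h * series (homp (d0 a) x) n|) @ \oo --> `|f (x + h *: e_ 0) - f x - h * f0 x|.
  apply: cvg_norm; apply: cvgB; last by apply: cvgM => //; exact: cvg_cst.
  by apply: cvgB; [have := c1|have := c2]; rewrite -cvg_shiftS.
apply: (ler_cvg_to hd (cvg_cst _)); apply: nearW => n.
exact: taylor0_sum.
Qed.

Lemma ps_taylor1 a f f1 : is_ps a f -> is_ps (d1 a) f1 -> exists r K, [/\ 0 < r, 0 <= K &
  forall x h, (forall i, `|x 0 i| <= r) -> `|x 0 1 + h| <= r ->
  `|f (x + h *: e_ 1) - f x - h * f1 x| <= K * h ^+ 2].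
Proof.
move=> hf hf1; have [r [K [r0 K0 h]]] := ps_taylor0 (ps_swap hf) (ps_swap hf1).
exists r, K; split => // x k xr xkr.
have := h (swap x) k; rewrite /= !mxE rev_ord20 swapK => /(_ _ xkr).
have -> : swap (swap x + k *: e_ 0) = x + k *: e_ 1.
  by apply: row2P; rewrite !mxE /= ?rev_ord20 ?rev_ord21 ?mxE ?rev_ord20 ?rev_ord21 ?mulr1 ?mulr0.
by apply => i; rewrite mxE.
Qed.

Lemma ps_bounded a f : is_ps a f -> exists r C, [/\ 0 < r, 0 <= C &
  forall x, (forall i, `|x 0 i| <= r) -> `|f x| <= C].
Proof.
move=> /is_psP[M [r [hM r0 Mr h]]]; exists r, (2 * M); split => //.
  by rewrite mulr_ge0 // (gb_ge0 hM).
move=> x xr; have := l1w_rate 0 (l1w_hom hM Mr xr) (h _ xr).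
by rewrite seriesE big_ord0 sub0r normrN mulr1.
Qed.

(** The path from x to y turns at the corner z, changing one coordinate at a time. The second leg
    yields [f1 z] in place of [f1 x]; the difference is O(|h|) by the Taylor estimate for [f1] and
    is multiplied by k. The constants do not depend on x, so differentiability is obtained at all
    points near 0. *)
Lemma ps_frechet a f f0 f1 : is_ps a f -> is_ps (d0 a) f0 -> is_ps (d1 a) f1 ->
  exists r K, [/\ 0 < r, 0 <= K &
  forall x y, (forall i, `|x 0 i| <= r) -> (forall i, `|y 0 i| <= r) ->
  `|f y - f x - ((y - x) 0 0 * f0 x + (y - x) 0 1 * f1 x)| <= K * `|y - x| ^+ 2].
Proof.
move=> hf hf0 hf1.
have [f10 hf10] : exists g, is_ps (d0 (d1 a)) g.
  by apply: ps_exists; apply: gbd_d0; case: hf1.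
have [r1 [K1 [r10 K10 h1]]] := ps_taylor0 hf hf0.
have [r2 [K2 [r20 K20 h2]]] := ps_taylor1 hf hf1.
have [r3 [K3 [r30 K30 h3]]] := ps_taylor0 hf1 hf10.
have [r4 [C [r40 C0 h4]]] := ps_bounded hf10.
(* The bound r <= 1 gives |h| <= 2, which turns the quadratic remainder of [f1] into a multiple of
   |h|. *)
pose r := Num.min 1 (Num.min (Num.min r1 r2) (Num.min r3 r4)).
have rr0 : r <= 1 by rewrite /r !ge_min lexx ?orbT.
have rr1 : r <= r1 by rewrite /r !ge_min lexx ?orbT.
have rr2 : r <= r2 by rewrite /r !ge_min lexx ?orbT.
have rr3 : r <= r3 by rewrite /r !ge_min lexx ?orbT.
have rr4 : r <= r4 by rewrite /r !ge_min lexx ?orbT.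
exists r, (K1 + K2 + (C + 2 * K3)); split.
- by rewrite /r !lt_min ltr01 r10 r20 r30 r40.
- by rewrite !addr_ge0 // mulr_ge0.
move=> x y xr yr.
set h := (y - x) 0 0; set k := (y - x) 0 1.
pose z := x + h *: e_ 0.
have z0 : z 0 0 = y 0 0 by rewrite !mxE /= /h !mxE mulr1 addrC subrK.
have z1 : z 0 1 = x 0 1 by rewrite !mxE /= mulr0 addr0.
have yz : y = z + k *: e_ 1.
  by apply: row2P; rewrite !mxE /= /h /k !mxE mulr1 mulr0; ring.
have zr i : `|z 0 i| <= r by case: (ord2P i) => ->; rewrite ?z0 ?z1.
have hn : `|h| <= `|y - x| by rewrite [leRHS]/Num.norm /= mx_normrE; apply: le_bigmax _ _ (0, 0).
have kn : `|k| <= `|y - x| by rewrite [leRHS]/Num.norm /= mx_normrE; apply: le_bigmax _ _ (0, 1).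
have xh : x 0 0 + h = y 0 0 by rewrite /h !mxE; ring.
have zk : z 0 1 + k = y 0 1 by rewrite z1 /k !mxE; ring.
have b1 : `|f z - f x - h * f0 x| <= K1 * `|y - x| ^+ 2.
  apply: le_trans (h1 x h _ _) _; rewrite ?xh.
  - by move=> i; apply: le_trans rr1.
  - by apply: le_trans rr1.
  by rewrite ler_wpM2l // -real_normK ?num_real // lerXn2r ?nnegrE.
have b2 : `|f y - f z - k * f1 z| <= K2 * `|y - x| ^+ 2.
  rewrite [in f y]yz; apply: le_trans (h2 z k _ _) _; rewrite ?zk.
  - by move=> i; apply: le_trans rr2.
  - by apply: le_trans rr2.
  by rewrite ler_wpM2l // -real_normK ?num_real // lerXn2r ?nnegrE.
have h_2 : `|h| <= 2.
  rewrite /h !mxE; apply: le_trans (ler_normB _ _) _.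
  by have := xr 0; have := yr 0; lra.
have b3 : `|f1 z - f1 x| <= (C + 2 * K3) * `|h|.
  have -> : f1 z - f1 x = (f1 z - f1 x - h * f10 x) + h * f10 x by rewrite subrK.
  apply: le_trans (ler_normD _ _) _; rewrite addrC mulrDl lerD //.
    by rewrite normrM mulrC ler_wpM2r //; apply: h4 => i; apply: le_trans rr4.
  apply: le_trans (h3 x h _ _) _; rewrite ?xh.
  - by move=> i; apply: le_trans rr3.
  - by apply: le_trans rr3.
  rewrite -real_normK ?num_real // expr2 [2 * _]mulrC -mulrA.
  by rewrite ler_wpM2l // ler_wpM2r.
have b4 : `|k * (f1 z - f1 x)| <= (C + 2 * K3) * `|y - x| ^+ 2.
  rewrite normrM expr2 mulrCA; apply: ler_pM => //.
  apply: le_trans b3 _; apply: ler_wpM2l => //; by rewrite addr_ge0 // mulr_ge0.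
rewrite [X in `|X|](_ : _ = (f z - f x - h * f0 x) + (f y - f z - k * f1 z)
   + k * (f1 z - f1 x)); last by ring.
rewrite [leRHS]mulrDl; apply: le_trans (ler_normD _ _) _; apply: lerD => //.
by rewrite mulrDl; apply: le_trans (ler_normD _ _) _; apply: lerD.
Qed.

Lemma quadratic_is_diff f x (df : {linear T -> R}) (r K : R) : continuous df -> 0 < r -> 0 <= K ->
  (forall y, `|y - x| <= r -> `|f y - f x - df (y - x)| <= K * `|y - x| ^+ 2) ->
  is_diff x f df.
Proof.
move=> dfc r0 K0 h.
have E : f \o shift x = cst (f x) + df +o_ (0 : T) id.
  apply/eqaddoP => e e0.
  have q0 : 0 < e / (K + 1) by rewrite divr_gt0 // ltr_wpDl.
  apply: filterS2 (nbhs0_le r0) (nbhs0_le q0) => y yr yq /=.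
  have ye : (K + 1) * `|y| <= e.
    by rewrite mulrC -ler_pdivlMr ?ltr_wpDl.
  have := h (y + x); rewrite addrK => /(_ yr) hy.
  rewrite [X in `|X|](_ : _ = f (y + x) - f x - df y); last by rewrite !fctE opprD addrA.
  apply: le_trans hy _; rewrite expr2 mulrA ler_wpM2r //.
  by apply: le_trans ye; rewrite ler_wpM2r // lerDl.
have dE := diff_unique dfc E.
apply: DiffDef => //; apply/diff_locallyP; rewrite dE; split; [exact: dfc|exact: E].
Qed.

Lemma linear2_is_linear (A B : R) : linear (fun v : T => v 0 0 * A + v 0 1 * B).
Proof. by move=> k v w; rewrite !mxE /GRing.scale /=; ring. Qed.

Lemma linear2_continuous (A B : R) : continuous (fun v : T => v 0 0 * A + v 0 1 * B).
Proof.
move=> v; have h i : (fun w : T => w 0 i) @ v --> v 0 i := @coord_continuous _ _ _ 0 i v.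
exact: (cvgD (cvgM (h 0) (cvg_cst A)) (cvgM (h 1) (cvg_cst B))).
Qed.

Lemma near0_ball r : 0 < r -> \forall x \near (0 : T),
  exists2 s, 0 < s & forall y : T, `|y - x| <= s -> forall i, `|y 0 i| <= r.
Proof.
move=> r0; have r20 : 0 < r / 2 by rewrite divr_gt0.
apply: filterS (near0_le r20) => x xr; exists (r / 2) => // y yx i.
have -> : y 0 i = (y - x) 0 i + x 0 i by rewrite !mxE subrK.
apply: le_trans (ler_normD _ _) _; rewrite (splitr r) lerD //; apply: le_trans yx.
by rewrite [leRHS]/Num.norm /= mx_normrE; apply: le_bigmax _ _ (0, i).
Qed.

Lemma ps_is_diff a f f0 f1 : is_ps a f -> is_ps (d0 a) f0 -> is_ps (d1 a) f1 ->
  \forall x \near (0 : T), is_diff x f (fun v : T => v 0 0 * f0 x + v 0 1 * f1 x).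
Proof.
move=> hf h0 h1; have [r [K [r0 K0 h]]] := ps_frechet hf h0 h1.
apply: filterS2 (near0_le r0) (near0_ball r0) => x xr [s s0 hs].
pose L := GRing.isLinear.Build _ _ _ _ _ (linear2_is_linear (f0 x) (f1 x)).
pose df : {linear T -> R} := HB.pack (fun v : T => v 0 0 * f0 x + v 0 1 * f1 x) L.
apply: (@quadratic_is_diff f x df s K) => //; first exact: linear2_continuous.
by move=> y yx; apply: h => //; apply: hs.
Qed.

Lemma ps_differentiable a f : is_ps a f -> \forall x \near (0 : T), differentiable f x.
Proof.
move=> hf; have ga : gbd a by case: hf.
have [f0 h0] := ps_exists (gbd_d0 ga); have [f1 h1] := ps_exists (gbd_d1 ga).
by apply: filterS (ps_is_diff hf h0 h1) => x [].
Qed.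

Lemma ps_partial0 a f : is_ps a f -> is_ps (d0 a) (partial 0 f).
Proof.
move=> hf; have ga : gbd a by case: hf.
have [f0 h0] := ps_exists (gbd_d0 ga); have [f1 h1] := ps_exists (gbd_d1 ga).
apply: (ps_ext h0); apply: filterS (ps_is_diff hf h0 h1) => x [df dE].
by rewrite /partial deriveE // dE !mxE /= mul1r mul0r addr0.
Qed.

Lemma ps_partial1 a f : is_ps a f -> is_ps (d1 a) (partial 1 f).
Proof.
move=> hf; have ga : gbd a by case: hf.
have [f0 h0] := ps_exists (gbd_d0 ga); have [f1 h1] := ps_exists (gbd_d1 ga).
apply: (ps_ext h1); apply: filterS (ps_is_diff hf h0 h1) => x [df dE].
by rewrite /partial deriveE // dE !mxE /= mul1r mul0r add0r.
Qed.

Lemma near0_near (P : T -> Prop) : (\forall x \near (0 : T), P x) ->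
  \forall x \near (0 : T), \forall y \near x, P y.
Proof. by move=> h; apply: near_join. Qed.

Lemma partial_near i f g : (\forall x \near (0 : T), f x = g x) ->
  \forall x \near (0 : T), partial i f x = partial i g x.
Proof. by move=> /near0_near; apply: filterS => x h; apply: near_eq_derive. Qed.

Lemma ps_at0 a f : is_ps a f -> f 0 = a 0%N 0%N.
Proof.
move=> [_ /nbhs_singleton h]; apply: (cvg_unique _ h) => //.
suff -> : homp a 0 = homp (cst_coefs (a 0%N 0%N)) 0.
  have [_ /nbhs_singleton] := ps_cst (a 0%N 0%N); exact.
apply/funext => n; rewrite homp_cst; case: n => [|n].
  by rewrite /homp big_ord1 /monom2 !mulr1.
apply: big1 => i _; rewrite /monom2 !mxE.
case: (nat_of_ord i) => [|k]; first by rewrite subn0 !expr0n mulr0.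
by rewrite expr0n /= mulr0 mul0r.
Qed.

Lemma partial_cst i (k : R) x : partial i (fun=> k) x = 0.
Proof. exact: derive_cst. Qed.

(** The value at 0 is the coefficient of index (0, 0), and the derivatives of the zero function are
    zero again, so induction on the indices reaches every coefficient. *)
Lemma ps_zero a : is_ps a (fun=> 0) -> forall i j, a i j = 0.
Proof.
move=> h i; elim: i a h => [|i IH] a h j.
  elim: j a h => [|j IH] a h; first by rewrite -(ps_at0 h).
  have /IH : is_ps (d1 a) (fun=> 0).
    by apply: (ps_ext (ps_partial1 h)); apply: near0W => x; rewrite partial_cst.
  by rewrite /d1 => /eqP; rewrite mulf_eq0 pnatr_eq0 => /eqP.
have /IH/(_ j) : is_ps (d0 a) (fun=> 0).
  by apply: (ps_ext (ps_partial0 h)); apply: near0W => x; rewrite partial_cst.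
by rewrite /d0 => /eqP; rewrite mulf_eq0 pnatr_eq0 => /eqP.
Qed.

Lemma ps_coefs_unique a b f g : is_ps a f -> is_ps b g ->
  (\forall x \near (0 : T), f x = g x) -> forall i j, a i j = b i j.
Proof.
move=> ha hb fg i j; apply/eqP; rewrite -subr_eq0 -mulN1r; apply/eqP.
apply: (@ps_zero (fun i j => a i j + -1 * b i j)).
apply: (ps_ext (ps_add ha (ps_scale (-1) hb))).
by apply: filterS fg => x ->; rewrite mulN1r subrr.
Qed.

End Derivatives.

(** * Linear Cauchy-Kovalevskaya theorem for coefficients *)

Section CauchyKovalevskaya.
Variable R : realType.
Local Notation coefs := (nat -> nat -> R).
Implicit Types (a b c Z W : coefs) (M : R).

Definition bc (i j : nat) : nat := 'C(i + j, i).
(** Taylor coefficient common to all second derivatives of 1 / (1 - x - y), up to the scaling of x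
    and y ([mu_00], [mu_11], [mu_01]); it also bounds those of the first derivatives. *)
Definition mu (i j : nat) : nat := ((i + j).+2 * ((i + j).+1 * bc i j))%N.

Lemma bcC i j : bc i j = bc j i.
Proof. by rewrite /bc -bin_sub ?leq_addr // addKn addnC. Qed.

Lemma bcS i j : (i.+1 * bc i.+1 j = (i + j).+1 * bc i j)%N.
Proof. by rewrite /bc addSn -mul_bin_diag. Qed.

Lemma bcSr i j : (j.+1 * bc i j.+1 = (i + j).+1 * bc i j)%N.
Proof. by rewrite bcC bcS bcC addnC. Qed.

Lemma leq_bcS i j : (bc i j <= bc i.+1 j)%N.
Proof. by rewrite /bc addSn binS leq_addl. Qed.

Lemma leq_bc i j p q : (i <= p)%N -> (j <= q)%N -> (bc i j <= bc p q)%N.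
Proof.
move=> /subnKC <- /subnKC <-.
elim: (p - i)%N => [|k IH].
  rewrite addn0; elim: (q - j)%N => [|k IH]; first by rewrite addn0.
  by apply: leq_trans IH _; rewrite addnS bcC [X in (_ <= X)%N]bcC leq_bcS.
by apply: leq_trans IH _; rewrite addnS leq_bcS.
Qed.

Lemma leq_mu i j p q : (i <= p)%N -> (j <= q)%N -> (mu i j <= mu p q)%N.
Proof. by move=> ip jq; rewrite /mu !leq_mul ?leq_bc // !ltnS leq_add. Qed.

Lemma bc_exp i j : (bc i j <= 2 ^ (i + j))%N.
Proof.
rewrite /bc; move: (i + j)%N => n; elim: n i => [|n IH] [|i]; rewrite ?bin0 ?expn_gt0 //.
by rewrite binS expnS mul2n -addnn leq_add.
Qed.

Lemma mu_gt0 i j : (0 < mu i j)%N.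
Proof. by rewrite /mu !muln_gt0 /= /bc bin_gt0 leq_addr. Qed.

Lemma mu_00 p q : (p.+2 * (p.+1 * bc p.+2 q) = mu p q)%N.
Proof. by rewrite mulnCA bcS mulnCA bcS /mu addSn. Qed.

Lemma mu_11 i j : (j.+1 * (j.+2 * bc i j.+2) = mu i j)%N.
Proof. by rewrite bcSr mulnCA bcSr /mu addnS. Qed.

Lemma mu_01 i j : (i.+1 * (j.+1 * bc i.+1 j.+1) = mu i j)%N.
Proof. by rewrite mulnCA bcS mulnCA bcSr /mu addnS. Qed.

Lemma mu_0 i j : (i.+1 * bc i.+1 j <= mu i j)%N.
Proof. by rewrite bcS /mu leq_pmull. Qed.

Lemma mu_1 i j : (j.+1 * bc i j.+1 <= mu i j)%N.
Proof. by rewrite bcSr /mu leq_pmull. Qed.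

(** Shifting the indices by (i, j) costs M^(i+j) and gains at least (2 M)^(i+j), because A and B are
    at least 2 M; the two geometric sums of ratio 1/2 produce the factor 4. Only rows up to p of [Z]
    occur, which is what an induction on rows can supply. *)
Lemma conv_majorant c Z (M A B Y : R) p q : gb c M -> 0 <= Y -> 2 * M <= A -> 2 * M <= B ->
  (forall i j, (i <= p)%N -> `|Z i j| <= Y * (A ^+ i * B ^+ j * (mu i j)%:R)) ->
  `|conv2 c Z p q| <= 4 * M * Y * (A ^+ p * B ^+ q * (mu p q)%:R).
Proof.
move=> hc Y0 MA MB hZ; have M0 := gb_ge0 hc; case: hc => M1 hc.
have A0 : 0 <= A by apply: le_trans MA; rewrite mulr_ge0.
have B0 : 0 <= B by apply: le_trans MB; rewrite mulr_ge0.
have geo (D : R) i k : 2 * M <= D -> (i <= k)%N -> M ^+ i * D ^+ (k - i) <= 2^-1 ^+ i * D ^+ k.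
  move=> MD ik; have D0 : 0 <= D by apply: le_trans MD; rewrite mulr_ge0.
  have -> : D ^+ k = D ^+ i * D ^+ (k - i) by rewrite -exprD subnKC.
  rewrite mulrA -exprMn ler_wpM2r ?exprn_ge0 // lerXn2r ?nnegrE ?mulr_ge0 ?invr_ge0 //.
  by move: MD; lra.
pose Q := M * Y * (A ^+ p * B ^+ q * (mu p q)%:R).
have Q0 : 0 <= Q by rewrite /Q !mulr_ge0 ?exprn_ge0.
apply: le_trans (_ : \sum_(i < p.+1) \sum_(j < q.+1) Q * (2^-1 ^+ i * 2^-1 ^+ j) <= _).
  apply: le_trans (ler_norm_sum _ _ _) _; apply: ler_sum => i _.
  apply: le_trans (ler_norm_sum _ _ _) _; apply: ler_sum => j _.
  have ip : (i <= p)%N by rewrite -ltnS.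
  have jq : (j <= q)%N by rewrite -ltnS.
  rewrite normrM; apply: le_trans (ler_pM _ _ (hc i j) (hZ _ _ (leq_subr _ _))) _ => //.
  rewrite [leLHS](_ : _ = (M * Y) * ((M ^+ i * A ^+ (p - i)) * (M ^+ j * B ^+ (q - j))
      * (mu (p - i) (q - j))%:R)); last by rewrite exprS exprD; ring.
  rewrite [leRHS](_ : _ = (M * Y) * ((2^-1 ^+ i * A ^+ p) * (2^-1 ^+ j * B ^+ q)
      * (mu p q)%:R)); last by rewrite /Q; ring.
  rewrite ler_wpM2l ?mulr_ge0 // ler_pM ?mulr_ge0 ?exprn_ge0 //.
    by rewrite ler_pM ?mulr_ge0 ?exprn_ge0 // geo.
  by rewrite ler_nat leq_mu ?leq_subr.
under eq_bigr => i _ do rewrite -mulr_sumr -mulr_sumr.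
rewrite -mulr_sumr -mulr_suml.
have h n := half_sum R n.
apply: le_trans (_ : Q * (2 * 2) <= _); last by rewrite /Q le_eqVlt; apply/orP; left; apply/eqP; ring.
rewrite ler_wpM2l // ler_pM //; apply: sumr_ge0 => i _; rewrite exprn_ge0 // invr_ge0 //.
Qed.

Section Existence.
Variables (al be ga de ka : coefs).

Definition ck_rhs W : coefs := fun i j =>
  conv2 al (d1 (d1 W)) i j + conv2 be (d0 (d1 W)) i j + conv2 ga (d0 W) i j
  + conv2 de (d1 W) i j + ka i j.

Definition ck_eq W := forall i j, d0 (d0 W) i j = ck_rhs W i j.

Lemma conv_local c Z Z' n j : (forall i k, (i <= n)%N -> Z i k = Z' i k) ->
  conv2 c Z n j = conv2 c Z' n j.
Proof. by move=> h; apply: eq_bigr => i _; apply: eq_bigr => k _; rewrite h // leq_subr. Qed.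

(** The right-hand side has at most one derivative in the first variable, so its row n reads [W] up
    to row n + 1, whereas the left-hand side of the equation reads row n + 2. The equation is
    therefore a recursion on rows. *)
Lemma ck_rhs_local W W' n j : (forall i k, (i <= n.+1)%N -> W i k = W' i k) ->
  ck_rhs W n j = ck_rhs W' n j.
Proof.
move=> h; rewrite /ck_rhs; congr (_ + _ + _ + _ + _); apply: conv_local => i k ni;
  by rewrite /d0 /d1 !h // ltnW.
Qed.

Lemma ck_unique W W' : ck_eq W -> ck_eq W' ->
  (forall j, W 0%N j = W' 0%N j) -> (forall j, W 1%N j = W' 1%N j) ->
  forall i j, W i j = W' i j.
Proof.
move=> hW hW' h0 h1 i; elim/ltn_ind: i => -[|[|i]] IH j //.
have := hW i j; rewrite (@ck_rhs_local W W'); last by move=> k l ki; apply: IH.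
rewrite -hW' /d0 => /mulfI; rewrite pnatr_eq0 => /(_ isT) /mulfI.
by rewrite pnatr_eq0; apply.
Qed.

(** Iterate n is correct on the rows up to n + 1 only; the rows above hold placeholder values that
    later iterates overwrite. The divisor is the factor that [d0 (d0 _)] puts on row n + 2. *)
Fixpoint ck_iter (p q : nat -> R) (n : nat) : coefs :=
  if n is n'.+1 then fun i j =>
    if (i <= n'.+1)%N then ck_iter p q n' i j
    else ck_rhs (ck_iter p q n') n' j / (n'.+1%:R * n'.+2%:R)
  else fun i j => if i == 0%N then p j else q j.

Definition ck_sol p q : coefs := fun i j => ck_iter p q i i j.

Lemma ck_iter_stable p q m n i j : (i <= m.+1)%N -> (m <= n)%N ->
  ck_iter p q n i j = ck_iter p q m i j.
Proof.
move=> im /subnKC <-; elim: (n - m)%N => [|k IH]; first by rewrite addn0.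
by rewrite addnS /= (leq_trans im) ?ltnS ?leq_addr.
Qed.

Lemma ck_iter_sol p q n i j : (i <= n.+1)%N -> ck_iter p q n i j = ck_sol p q i j.
Proof.
move=> i_n; rewrite /ck_sol; have [|ni] := leqP i n.
  by apply: ck_iter_stable.
have -> : i = n.+1 by apply/eqP; rewrite eqn_leq i_n.
by rewrite [RHS](@ck_iter_stable _ _ n).
Qed.

Lemma ck_sol_eq p q : ck_eq (ck_sol p q).
Proof.
move=> n j; rewrite /d0 {1}/ck_sol (@ck_iter_stable _ _ n.+1) //= ltnn.
rewrite (@ck_rhs_local _ (ck_sol p q)); last by move=> i k; apply: ck_iter_sol.
by rewrite mulrA mulrC divfK // mulf_neq0 ?pnatr_eq0.
Qed.

(* The weights A^i B^j binomial(i+j, i) are the Taylor coefficients of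
   1 / (1 - A x - B y), a class of majorants stable under the equation. *)
Lemma ck_sol_gbd p q M : gb al M -> gb be M -> gb ga M -> gb de M -> gb ka M ->
  (forall j, `|p j| <= M ^+ j.+1) -> (forall j, `|q j| <= M ^+ j.+1) ->
  gbd (ck_sol p q).
Proof.
move=> hal hbe hga hde hka hp hq; have M0 := gb_ge0 hal.
have M1 : 1 <= M by case: hal.
(* B is what [conv_majorant] asks for. The second derivative in the first variable gains A^2, the
   right-hand side at most A B: its five terms add up to at most 17 M^2 A B = 34 M^3 A, and A = 40
   M^2 puts this below M A^2. *)
pose B := 2 * M; pose A := 40 * M ^+ 2.
have B1 : 1 <= B by rewrite /B; lra.
have BA : B <= A by rewrite /B /A; nra.
have A0 : 0 <= A by apply: le_trans BA; lra.
have B0 : 0 <= B by lra.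
have Mp : 0 < M by lra.
set W := ck_sol p q.
have bound i : forall j, `|W i j| <= M * (A ^+ i * B ^+ j * (bc i j)%:R).
  elim/ltn_ind: i => -[|[|n]] IH j.
  - rewrite /W /ck_sol /=; apply: le_trans (hp j) _; rewrite /bc bin0 mulr1 expr0 mul1r exprS.
    by rewrite ler_wpM2l // lerXn2r ?nnegrE // /B; lra.
  - rewrite /W /ck_sol /=; apply: le_trans (hq j) _; rewrite exprS ler_wpM2l // expr1.
    rewrite -[leLHS]mulr1; apply: ler_pM; rewrite ?exprn_ge0 ?ler01 //; last first.
      by rewrite ler1n /bc bin_gt0 leq_addr.
    rewrite -[leLHS]mul1r ler_pM ?exprn_ge0 //; first by apply: le_trans BA.
    by rewrite lerXn2r ?nnegrE // /B; lra.
  have nd k : 0 <= k.+1%:R :> R by exact: ler0n.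
  have E := ck_sol_eq p q n j; rewrite -/W in E.
  have pw i k : 0 <= A ^+ i * B ^+ k by rewrite mulr_ge0 ?exprn_ge0.
  have h11 i k : (i <= n)%N -> `|d1 (d1 W) i k| <= (M * B ^+ 2) * (A ^+ i * B ^+ k * (mu i k)%:R).
    move=> i_n; rewrite /d1 !normrM !normr_nat -(mu_11 i k) !natrM.
    have /(_ k.+2) h := IH i (leq_trans i_n (leqnSn _)).
    have {}h := ler_wpM2l (nd k) (ler_wpM2l (nd k.+1) h).
    by apply: le_trans h _; rewrite !exprS le_eqVlt; apply/orP; left; apply/eqP; ring.
  have h01 i k : (i <= n)%N -> `|d0 (d1 W) i k| <= (M * (A * B)) * (A ^+ i * B ^+ k * (mu i k)%:R).
    move=> i_n; rewrite /d0 /d1 !normrM !normr_nat -(mu_01 i k) !natrM.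
    have /(_ k.+1) h := IH i.+1 i_n.
    have {}h := ler_wpM2l (nd i) (ler_wpM2l (nd k) h).
    by apply: le_trans h _; rewrite !exprS le_eqVlt; apply/orP; left; apply/eqP; ring.
  have h0 i k : (i <= n)%N -> `|d0 W i k| <= (M * A) * (A ^+ i * B ^+ k * (mu i k)%:R).
    move=> i_n; rewrite /d0 normrM normr_nat.
    have /(_ k) h := IH i.+1 i_n.
    have {}h := ler_wpM2l (nd i) h; apply: le_trans h _.
    rewrite [leLHS](_ : _ = (M * A) * (A ^+ i * B ^+ k * (i.+1 * bc i.+1 k)%:R)); last first.
      by rewrite natrM exprS; ring.
    by rewrite ler_wpM2l ?mulr_ge0 // ler_wpM2l // ler_nat mu_0.
  have h1 i k : (i <= n)%N -> `|d1 W i k| <= (M * B) * (A ^+ i * B ^+ k * (mu i k)%:R).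
    move=> i_n; rewrite /d1 normrM normr_nat.
    have /(_ k.+1) h := IH i (leq_trans i_n (leqnSn _)).
    have {}h := ler_wpM2l (nd k) h; apply: le_trans h _.
    rewrite [leLHS](_ : _ = (M * B) * (A ^+ i * B ^+ k * (k.+1 * bc i k.+1)%:R)); last first.
      by rewrite natrM exprS; ring.
    by rewrite ler_wpM2l ?mulr_ge0 // ler_wpM2l // ler_nat mu_1.
  have MA : 2 * M <= A by [].
  have MB : 2 * M <= B by [].
  have MBB : 0 <= M * B ^+ 2 by rewrite mulr_ge0 ?exprn_ge0.
  have MAB : 0 <= M * (A * B) by rewrite !mulr_ge0.
  have MA0 : 0 <= M * A by rewrite !mulr_ge0.
  have MB0 : 0 <= M * B by rewrite !mulr_ge0.
  have b1 := conv_majorant j hal MBB MA MB h11.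
  have b2 := conv_majorant j hbe MAB MA MB h01.
  have b3 := conv_majorant j hga MA0 MA MB h0.
  have b4 := conv_majorant j hde MB0 MA MB h1.
  pose Q := A ^+ n * B ^+ j * (mu n j)%:R.
  have Q0 : 0 <= Q by rewrite mulr_ge0.
  have b5 : `|ka n j| <= M * Q.
    case: hka => _ hka; apply: le_trans (hka _ _) _; rewrite exprS ler_wpM2l // exprD.
    rewrite -[leLHS]mulr1 /Q; apply: ler_pM; rewrite ?mulr_ge0 ?exprn_ge0 //; last first.
      by rewrite ler1n mu_gt0.
    by rewrite ler_pM ?exprn_ge0 // lerXn2r ?nnegrE //; move: MA MB; lra.
  have tot : `|ck_rhs W n j| <= (M * A ^+ 2) * Q.
    rewrite /ck_rhs.
    have : 4 * M * (M * B ^+ 2) + 4 * M * (M * (A * B)) + 4 * M * (M * A) + 4 * M * (M * B) + M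
       <= M * A ^+ 2.
      have : 4 * M * (M * B ^+ 2) <= 4 * M * (M * (A * B)) by rewrite expr2 !ler_wpM2l // ?mulr_ge0 // ler_wpM2r.
      have : 4 * M * (M * A) <= 4 * M * (M * (A * B)).
        by rewrite !ler_wpM2l // ?mulr_ge0 // ler_peMr.
      have : 4 * M * (M * B) <= 4 * M * (M * (A * B)).
        by rewrite !ler_wpM2l // ?mulr_ge0 // ler_peMl //; apply: le_trans BA.
      have : M <= M * (M * (A * B)).
        rewrite -[leLHS]mulr1 ler_wpM2l // -[leLHS]mulr1 ler_pM // -[leLHS]mulr1 ler_pM //.
        by apply: le_trans BA.
      have : 17 * (M * (M * (A * B))) <= M * A ^+ 2.
        rewrite [leLHS](_ : _ = M * (A * (34 * M ^+ 2))); last by rewrite /B; ring.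
        by rewrite expr2 !ler_wpM2l // /A; have := sqr_ge0 M; lra.
      by lra.
    move/(ler_wpM2r Q0); apply: le_trans.
    rewrite [leRHS]mulrDl; apply: le_trans (ler_normD _ _) _; apply: lerD => //.
    rewrite [leRHS]mulrDl; apply: le_trans (ler_normD _ _) _; apply: lerD => //.
    rewrite [leRHS]mulrDl; apply: le_trans (ler_normD _ _) _; apply: lerD => //.
    by rewrite [leRHS]mulrDl; apply: le_trans (ler_normD _ _) _; apply: lerD.
  rewrite -E /d0 !normrM !normr_nat in tot.
  have n0 : 0 < n.+1%:R * n.+2%:R :> R by rewrite mulr_gt0 // ltr0n.
  rewrite -(ler_pM2l n0) [leLHS](_ : _ = n.+1%:R * (n.+2%:R * `|W n.+2 j|)); last by rewrite mulrA.
  apply: le_trans tot _.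
  rewrite /Q -(mu_00 n j) !natrM !exprS le_eqVlt; apply/orP; left; apply/eqP; ring.
apply: (@gbdI _ _ M (2 * A)) => i j; apply: le_trans (bound i j) _.
rewrite ler_wpM2l // [leRHS]exprMn [leLHS]mulrC; apply: ler_pM; rewrite ?mulr_ge0 ?exprn_ge0 //.
  by rewrite -natrX ler_nat bc_exp.
by rewrite exprD ler_wpM2l ?exprn_ge0 // lerXn2r ?nnegrE.
Qed.

End Existence.
End CauchyKovalevskaya.

(** * Closure properties of analytic functions *)

Section AnalyticClosure.
Variable R : realType.
Local Notation T := 'rV[R]_2.
Local Notation coefs := (nat -> nat -> R).
Implicit Types (a b U V : coefs) (f g : T -> R) (x y : T) (u : T -> T).
Local Notation e_ i := (delta_mx 0 i : T).

(** A series in one variable, read as a series in the first coordinate, so that inverse, exponential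
    and logarithm arise by composition in two variables. *)
Definition xseries (c : nat -> R) : coefs := fun i j => if j == 0%N then c i else 0.

Lemma homp_xseries c x n : homp (xseries c) x n = c n * x 0 0 ^+ n.
Proof.
rewrite /homp big_ord_recr /= big1 ?add0r => [|i _].
  by rewrite /monom2 /xseries subnn /= mulr1.
by rewrite /monom2 /xseries subn_eq0 leqNgt ltn_ord /= !mul0r.
Qed.

Lemma gbd_xseries c : (exists C K, forall n, `|c n| <= C * K ^+ n) -> gbd (xseries c).
Proof.
move=> [C [K h]]; apply: (@gbdI _ _ `|C| `|K|) => i j; rewrite /xseries; case: eqP => [->|_].
  by rewrite addn0 -normrX -normrM; apply: le_trans (h i) (ler_norm _).
by rewrite normr0 mulr_ge0 // exprn_ge0.
Qed.

Lemma an_ext f g : analytic2 f -> (\forall x \near (0 : T), f x = g x) -> analytic2 g.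
Proof. by move=> /analytic2_ps[a ha] /(ps_ext ha) /ps_analytic2. Qed.

Lemma an_cst (k : R) : analytic2 (fun _ : T => k).
Proof. exact: ps_analytic2 (ps_cst k). Qed.

Lemma an_add f g : analytic2 f -> analytic2 g -> analytic2 (fun x => f x + g x).
Proof.
by move=> /analytic2_ps[a ha] /analytic2_ps[b hb]; apply: ps_analytic2 (ps_add ha hb).
Qed.

Lemma an_mul f g : analytic2 f -> analytic2 g -> analytic2 (fun x => f x * g x).
Proof.
by move=> /analytic2_ps[a ha] /analytic2_ps[b hb]; apply: ps_analytic2 (ps_mul ha hb).
Qed.

Lemma an_opp f : analytic2 f -> analytic2 (fun x => - f x).
Proof.
move=> /analytic2_ps[a ha]; apply: an_ext (ps_analytic2 (ps_scale (-1) ha)) _.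
by apply: near0W => x; rewrite mulN1r.
Qed.

Lemma an_sub f g : analytic2 f -> analytic2 g -> analytic2 (fun x => f x - g x).
Proof. by move=> hf hg; apply: an_add hf (an_opp hg). Qed.

Lemma an_sum n (F : 'I_n -> T -> R) : (forall i, analytic2 (F i)) ->
  analytic2 (fun x => \sum_i F i x).
Proof.
elim: n F => [|n IH] F h.
  by apply: an_ext (an_cst 0) _; apply: near0W => x; rewrite big_ord0.
apply: an_ext (an_add (h ord0) (IH (fun i => F (lift ord0 i)) (fun i => h _))) _.
by apply: near0W => x; rewrite big_ord_recl.
Qed.

Lemma an_partial i f : analytic2 f -> analytic2 (partial i f).
Proof.
move=> /analytic2_ps[a ha]; case: (ord2P i) => ->.
  exact: ps_analytic2 (ps_partial0 ha).
exact: ps_analytic2 (ps_partial1 ha).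
Qed.

Lemma an_differentiable f : analytic2 f -> \forall x \near (0 : T), differentiable f x.
Proof. by move=> /analytic2_ps[a]; apply: ps_differentiable. Qed.

Lemma ps_coord0 : is_ps (xseries (fun n => (n == 1%N)%:R)) (fun x => x 0 0).
Proof.
split.
  apply: gbd_xseries; exists 1, 1 => n; rewrite expr1n mulr1.
  by case: eqP => _; rewrite ?normr1 ?normr0.
(* The partial sums are constant from length 2 on, hence the two shifts. *)
apply: near0W => x; rewrite -(cvg_shiftS (series _)) -(cvg_shiftS (fun n => series _ n.+1)).
rewrite (_ : (fun n => _) = fun=> x 0 0); first exact: cvg_cst.
apply/funext => n; rewrite seriesE !big_ord_recl big1 /= => [|i _].
  by rewrite !homp_xseries /= mul0r add0r mul1r expr1 addr0.
by rewrite homp_xseries /bump /= mul0r.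
Qed.

Lemma an_coord i : analytic2 (fun x => x 0 i).
Proof.
case: (ord2P i) => ->; first exact: ps_analytic2 ps_coord0.
apply: an_ext (ps_analytic2 (ps_swap ps_coord0)) _.
by apply: near0W => x; rewrite /= mxE rev_ord20.
Qed.

Lemma an_comp f u : analytic2 f -> (forall i, analytic2 (fun x => u x 0 i)) -> u 0 = 0 ->
  analytic2 (fun x => f (u x)).
Proof.
move=> /analytic2_ps[a ha] hu u0.
have /analytic2_ps[U hU] := hu 0; have /analytic2_ps[V hV] := hu 1.
apply: ps_analytic2 (ps_comp ha hU hV _ _).
  by rewrite -(ps_at0 hU) u0 mxE.
by rewrite -(ps_at0 hV) u0 mxE.
Qed.

Lemma an_comp1 f g : analytic2 f -> analytic2 g -> g 0 = 0 ->
  analytic2 (fun x => f (g x *: e_ 0)).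
Proof.
move=> hf hg g0; apply: (@an_comp f (fun x => g x *: e_ 0)) => //; last by rewrite g0 scale0r.
move=> i; apply: an_ext (an_mul hg (an_cst ((e_ 0) 0 i))) _.
by apply: near0W => x; rewrite !mxE.
Qed.

Lemma ps_geometric (k : R) :
  is_ps (xseries (fun n => k ^+ n)) (fun x => (1 - k * x 0 0)^-1).
Proof.
split; first by apply: gbd_xseries; exists 1, `|k| => n; rewrite mul1r normrX.
have e0 : 0 < (1 + `|k|)^-1 / 2.
  by rewrite divr_gt0 // invr_gt0 ltr_pwDl.
apply: filterS (near0_le e0) => x /(_ 0) xe.
suff -> : series (homp (xseries (fun n => k ^+ n)) x) = series (geometric 1 (k * x 0 0)).
  rewrite -[X in _ --> X]mul1r; apply: cvg_geometric_series.
  have k1 : 0 < 1 + `|k| by rewrite ltr_pwDl.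
  rewrite normrM; apply: le_lt_trans (_ : (1 + `|k|) * ((1 + `|k|)^-1 / 2) < _).
    by apply: ler_pM => //; rewrite lerDr.
  by rewrite mulrA mulfV ?gt_eqF // mul1r invf_lt1 // ltr1n.
by congr series; apply/funext => n; rewrite homp_xseries /geometric /= exprMn mul1r.
Qed.

(** f = f(0) (1 - z) with z(0) = 0, and the geometric series is composed with z. *)
Lemma an_inv f : analytic2 f -> f 0 != 0 -> analytic2 (fun x => (f x)^-1).
Proof.
move=> hf f0; pose z x := 1 - (f 0)^-1 * f x.
have hz : analytic2 z by apply: an_sub (an_cst 1) (an_mul (an_cst _) hf).
have z0 : z 0 = 0 by rewrite /z mulVf // subrr.
have h := an_mul (an_cst (f 0)^-1) (an_comp1 (ps_analytic2 (ps_geometric 1)) hz z0).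
apply: an_ext h _; apply: near0W => x; rewrite !mxE /= mulr1 mul1r /z.
by rewrite opprB addrCA subrr addr0 invfM invrK mulrA mulVf // mul1r.
Qed.

Lemma an_div f g : analytic2 f -> analytic2 g -> g 0 != 0 -> analytic2 (fun x => f x / g x).
Proof. by move=> hf hg g0; apply: an_mul hf (an_inv hg g0). Qed.

Lemma ps_expR : is_ps (xseries (fun n => n`!%:R^-1)) (fun x => expR (x 0 0)).
Proof.
split.
  apply: gbd_xseries; exists 1, 1 => n; rewrite expr1n mulr1 normfV normr_nat.
  by rewrite invf_le1 ?ltr0n ?fact_gt0 // ler1n fact_gt0.
apply: near0W => x; have := is_cvg_series_exp_coeff (x 0 0).
rewrite (_ : homp _ x = exp_coeff (x 0 0)) //; apply/funext => n.
by rewrite homp_xseries /exp_coeff /= mulrC.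
Qed.

(** exp(f(0)) is split off because composition needs an inner function that vanishes at 0. *)
Lemma an_expR f : analytic2 f -> analytic2 (fun x => expR (f x)).
Proof.
move=> hf; have hz : analytic2 (fun x => f x - f 0) by apply: an_sub hf (an_cst _).
have h := an_mul (an_cst (expR (f 0))) (an_comp1 (ps_analytic2 ps_expR) hz (subrr _)).
apply: an_ext h _; apply: near0W => x.
by rewrite !mxE /= mulr1 -expRD addrC subrK.
Qed.

Lemma an_continuous f : analytic2 f -> \forall x \near (0 : T), {for x, continuous f}.
Proof.
by move=> /an_differentiable; apply: filterS => x /differentiable_continuous.
Qed.

Lemma near_pull u (P : T -> Prop) : (forall i, analytic2 (fun x => u x 0 i)) -> u 0 = 0 ->
  (\forall x \near (0 : T), P x) -> \forall x \near (0 : T), P (u x).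
Proof.
move=> hu u0 /near0P[e e0 hP].
have h i : \forall x \near (0 : T), `|u x 0 i| <= e.
  have /nbhs_singleton c := an_continuous (hu i).
  move/cvgrPdist_le: c => /(_ _ e0); apply: filterS => x.
  by rewrite u0 mxE sub0r normrN.
apply: filterS2 (h 0) (h 1) => x h0 h1; apply: hP => i.
by case: (ord2P i) => ->.
Qed.

Lemma near_neq0 f : analytic2 f -> f 0 != 0 -> \forall x \near (0 : T), f x != 0.
Proof.
move=> /an_continuous/nbhs_singleton c f0.
have c' : f @ (0 : T) --> f 0 := c.
have f0' : 0 < `|f 0| by rewrite normr_gt0.
move/cvgrPdist_lt: c' => /(_ _ f0'); apply: filterS => x.
by apply: contraTneq => ->; rewrite subr0 ltxx.
Qed.

Section PartialRules.
Variable i : 'I_2.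

Lemma an_derivable f v : analytic2 f -> \forall x \near (0 : T), derivable f x v.
Proof. by move=> /an_differentiable; apply: filterS => x; apply: diff_derivable. Qed.

Lemma partialD f g : analytic2 f -> analytic2 g -> \forall x \near (0 : T),
  partial i (fun y => f y + g y) x = partial i f x + partial i g x.
Proof.
move=> /(an_derivable (e_ i)) hf /(an_derivable (e_ i)) hg.
by apply: filterS2 hf hg => x hf hg; rewrite /partial -deriveD.
Qed.

Lemma partialN f : analytic2 f -> \forall x \near (0 : T),
  partial i (fun y => - f y) x = - partial i f x.
Proof. by move=> /(an_derivable (e_ i)); apply: filterS => x hf; rewrite /partial -deriveN. Qed.

Lemma partialB f g : analytic2 f -> analytic2 g -> \forall x \near (0 : T),
  partial i (fun y => f y - g y) x = partial i f x - partial i g x.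
Proof.
move=> /(an_derivable (e_ i)) hf /(an_derivable (e_ i)) hg.
by apply: filterS2 hf hg => x hf hg; rewrite /partial -deriveB.
Qed.

Lemma partialM f g : analytic2 f -> analytic2 g -> \forall x \near (0 : T),
  partial i (fun y => f y * g y) x = partial i f x * g x + f x * partial i g x.
Proof.
move=> /(an_derivable (e_ i)) hf /(an_derivable (e_ i)) hg.
apply: filterS2 hf hg => x hf hg.
by rewrite /partial [LHS](deriveM hf hg) /GRing.scale /= addrC [_ * g x]mulrC.
Qed.

Lemma partialV f : analytic2 f -> f 0 != 0 -> \forall x \near (0 : T),
  partial i (fun y => (f y)^-1) x = - partial i f x / f x ^+ 2.
Proof.
move=> hf f0; apply: filterS2 (an_derivable (e_ i) hf) (near_neq0 hf f0) => x h1 h2.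
by rewrite /partial deriveV // scaleNr mulNr /GRing.scale /= mulrC.
Qed.

Lemma diff_expR (t : R) : 'd expR t = ( *:%R^~ (expR t)) :> (R -> R).
Proof.
apply/funext => h; rewrite deriv1E; last exact: derivable_expR.
by rewrite derive1E; have [_ ->] := is_derive_expR t.
Qed.

Lemma partial_expR f : analytic2 f -> \forall x \near (0 : T),
  partial i (fun y => expR (f y)) x = expR (f x) * partial i f x.
Proof.
move=> /an_differentiable; apply: filterS => x df.
have de : differentiable expR (f x) by apply/derivable1_diffP.
rewrite /partial (_ : (fun y => expR (f y)) = expR \o f) //.
rewrite !deriveE //; last exact: differentiable_comp.
by rewrite diff_comp // /= diff_expR mulrC.
Qed.

End PartialRules.

Lemma row_differentiable u x : (forall i, differentiable (fun y => u y 0 i) x) ->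
  differentiable u x.
Proof.
move=> h.
have -> : u = \sum_(i < 2) (fun y => u y 0 i *: e_ i).
  apply/funext => y; rewrite fct_sumE; exact: row_sum_delta.
by apply: differentiable_sum => i; apply: differentiableZl.
Qed.

Lemma an_row_differentiable u : (forall i, analytic2 (fun x => u x 0 i)) ->
  \forall x \near (0 : T), differentiable u x.
Proof.
move=> h; apply: filterS2 (an_differentiable (h 0)) (an_differentiable (h 1)) => x h0 h1.
by apply: row_differentiable => i; case: (ord2P i) => ->.
Qed.

Lemma partial_row u x i k : differentiable u x -> ('D_(e_ i) u x) 0 k = partial i (fun y => u y 0 k) x.
Proof. by move=> du; rewrite derive_mx ?mxE //; apply: diff_derivable. Qed.

Lemma chain_rule i f u : analytic2 f -> (forall i, analytic2 (fun x => u x 0 i)) -> u 0 = 0 ->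
  \forall x \near (0 : T), partial i (fun y => f (u y)) x =
    partial 0 f (u x) * partial i (fun y => u y 0 0) x
    + partial 1 f (u x) * partial i (fun y => u y 0 1) x.
Proof.
move=> hf hu u0.
apply: filterS2 (near_pull hu u0 (an_differentiable hf)) (an_row_differentiable hu) => x df du.
rewrite -!partial_row // /partial; set w := 'D_(e_ i) u x.
have -> : 'D_(e_ i) (fun y => f (u y)) x = 'd f (u x) w.
  by rewrite /w (deriveE _ du) -[RHS]/(('d f (u x) \o 'd u x) (e_ i)) -diff_comp // -deriveE //; exact: differentiable_comp.
rewrite !(deriveE _ df); have {1}-> : w = w 0 0 *: e_ 0 + w 0 1 *: e_ 1.
  by apply: row2P; rewrite !mxE /= ?mulr1 ?mulr0 ?addr0 ?add0r.
by rewrite linearD !linearZ /= /GRing.scale /= ![_ * w _ _]mulrC.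
Qed.

Lemma jacobianE u x i k : differentiable u x ->
  'J u x i k = partial i (fun y => u y 0 k) x.
Proof.
move=> du; rewrite -partial_row // deriveEjacobian // -rowE !mxE; congr (_ _ _).
Qed.

(** The symmetry is visible on coefficients, where the factors introduced by [d0] and [d1]
    commute. *)
Lemma partial_comm f : analytic2 f -> \forall x \near (0 : T),
  partial 0 (partial 1 f) x = partial 1 (partial 0 f) x.
Proof.
move=> /analytic2_ps[a ha].
apply: ps_fun_unique (ps_partial0 (ps_partial1 ha)) _.
have -> : d0 (d1 a) = d1 (d0 a) by apply/funext => i; apply/funext => j; rewrite /d0 /d1 mulrCA.
exact: ps_partial1 (ps_partial0 ha).
Qed.

Lemma partial_eq0_cst f : analytic2 f -> (forall i, \forall x \near (0 : T), partial i f x = 0) ->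
  \forall x \near (0 : T), f x = f 0.
Proof.
move=> /analytic2_ps[a ha] h.
have h0 := ps_zero (ps_ext (ps_partial0 ha) (h 0)).
have h1 := ps_zero (ps_ext (ps_partial1 ha) (h 1)).
have aE : a = cst_coefs (f 0).
  apply/funext => i; apply/funext => j; rewrite /cst_coefs (ps_at0 ha).
  case: i => [|i] /=; last first.
    by have /eqP := h0 i j; rewrite /d0 mulf_eq0 pnatr_eq0 => /eqP.
  case: j => [|j] //=.
  by have /eqP := h1 0%N j; rewrite /d1 mulf_eq0 pnatr_eq0 => /eqP.
by rewrite aE in ha; apply: ps_fun_unique ha (ps_cst _).
Qed.

(* The logarithm is the power series whose derivative is the geometric one;
   (1 + x) exp(- log(1 + x)) is constant because its derivative vanishes. *)
Lemma log1p_exists : exists L : T -> R, [/\ analytic2 L, L 0 = 0 &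
  \forall x \near (0 : T), expR (L x) = 1 + x 0 0].
Proof.
pose c n : R := if n is n'.+1 then (- 1) ^+ n' / n%:R else 0.
have gc : gbd (xseries c).
  apply: gbd_xseries; exists 1, 1 => -[|n]; rewrite expr1n mulr1 ?normr0 //.
  rewrite normrM normrX normrN1 expr1n mul1r normfV normr_nat invf_le1 ?ltr0n //.
  by rewrite ler1n.
have [L hL] := ps_exists gc; have aL := ps_analytic2 hL; exists L.
have L0 : L 0 = 0 by rewrite (ps_at0 hL).
split => //.
have E0 : d0 (xseries c) = xseries (fun n => (- 1) ^+ n).
  apply/funext => i; apply/funext => j; rewrite /d0 /xseries; case: eqP => _; last by rewrite mulr0.
  by rewrite /c mulrCA divff ?mulr1 // pnatr_eq0.
have E1 : d1 (xseries c) = cst_coefs 0.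
  by apply/funext => i; apply/funext => j; rewrite /d1 /xseries /cst_coefs /= mulr0 if_same.
have p0 : \forall x \near (0 : T), partial 0 L x = (1 + x 0 0)^-1.
  have := ps_partial0 hL; rewrite E0 => /ps_fun_unique /(_ (ps_geometric (- 1))).
  by apply: filterS => x ->; rewrite mulN1r opprK.
have p1 : \forall x \near (0 : T), partial 1 L x = 0.
  by have := ps_partial1 hL; rewrite E1 => /ps_fun_unique; apply; exact: ps_cst.
pose X x : R := 1 + x 0 0; pose H x := X x * expR (- L x).
have aX : analytic2 X by apply: an_add (an_cst 1) (an_coord 0).
have aE : analytic2 (fun x => expR (- L x)) by apply: an_expR (an_opp aL).
have X0 : X 0 != 0 by rewrite /X mxE addr0 oner_neq0.
have dX i x : partial i X x = (i == 0)%:R.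
  rewrite /partial deriveD ?derive_cst ?add0r //; last first.
    by apply: diff_derivable; apply: differentiable_coord.
  rewrite -(_ : ('D_(e_ i) (id : T -> T) x) 0 0 = 'D_(e_ i) (fun y : T => y 0 0) x).
    by rewrite derive_id mxE eqxx eq_sym.
  by rewrite derive_mx ?mxE //; apply: derivable_id.
have dH i : \forall x \near (0 : T), partial i H x = 0.
  have h1 := partialM i aX aE.
  have h2 := partial_expR i (an_opp aL).
  have h3 := partialN i aL.
  have h4 := near_neq0 aX X0.
  have hLi : \forall x \near (0 : T), partial i L x = (i == 0)%:R / X x.
    case: (ord2P i) => ->; first by apply: filterS p0 => x ->; rewrite mul1r.
    by apply: filterS p1 => x ->; rewrite mul0r.
  apply: filterS2 (filterI h1 h2) (filterI h3 (filterI h4 hLi)) => x [k1 k2] [k3 [k4 k5]].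
  rewrite /H k1 k2 k3 k5 dX; by field.
have aH : analytic2 H by apply: an_mul.
have := partial_eq0_cst aH dH; apply: filterS => x.
rewrite /H L0 oppr0 expR0 mulr1 /X mxE addr0 => /(congr1 (fun t => t * expR (L x))).
by rewrite -mulrA -expRD addNr expR0 mulr1 mul1r.
Qed.

(** After division by f(0) only the logarithm near 1 is needed, whatever the sign of f(0). *)
Lemma an_log f : analytic2 f -> f 0 != 0 ->
  exists w : T -> R, [/\ analytic2 w, w 0 = 0 & \forall x \near (0 : T), f x = f 0 * expR (w x)].
Proof.
move=> hf f0; have [L [hL L0 LE]] := log1p_exists.
pose z x := (f 0)^-1 * f x - 1.
have hz : analytic2 z by apply: an_sub (an_mul (an_cst _) hf) (an_cst 1).
have z0 : z 0 = 0 by rewrite /z mulVf // subrr.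
exists (fun x => L (z x *: e_ 0)); split.
- exact: an_comp1.
- by rewrite z0 scale0r.
have hu i : analytic2 (fun x => (z x *: e_ 0) 0 i).
  apply: an_ext (an_mul hz (an_cst ((e_ 0) 0 i))) _.
  by apply: near0W => x; rewrite !mxE.
have := @near_pull (fun x => z x *: e_ 0) _ hu _ LE; rewrite z0 scale0r => /(_ erefl).
apply: filterS => x ->; rewrite !mxE /= mulr1 /z addrC subrK mulrA divff // mul1r.
by [].
Qed.

End AnalyticClosure.

(** * Second order linear equations in a chart *)

Section LinearEquation.
Variable R : realType.
Local Notation T := 'rV[R]_2.
Implicit Types (f g w W P Q : T -> R) (x y : T) (u v : T -> T).
Local Notation e_ i := (delta_mx 0 i : T).

Lemma near1P (P : R -> Prop) : (\forall t \near (0 : R), P t) <->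
  exists2 e, 0 < e & forall t, `|t| <= e -> P t.
Proof.
split.
  move=> /nbhs_ballP[e /= e0 eP]; exists (e / 2); first by rewrite divr_gt0.
  move=> t te; apply: eP; rewrite /ball /= sub0r normrN.
  by apply: le_lt_trans te _; rewrite gtr_pMr // invf_lt1 // ltr1n.
move=> [e e0 eP]; apply/nbhs_ballP; exists e => //= t; rewrite /ball /= sub0r normrN => /ltW.
exact: eP.
Qed.

Lemma near_axis (P : T -> Prop) : (\forall x \near (0 : T), P x) ->
  \forall t \near (0 : R), P (t *: e_ 1).
Proof.
move=> /near0P[e e0 h]; apply/near1P; exists e => // t te; apply: h => i.
rewrite !mxE; case: (ord2P i) => -> /=; rewrite ?mulr1 // mulr0 normr0; exact: ltW.
Qed.

Lemma near_coord (P : R -> Prop) : (\forall t \near (0 : R), P t) ->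
  \forall x \near (0 : T), P ((x : T) 0 1).
Proof. by move=> /near1P[e e0 h]; apply/near0P; exists e => // x xe; apply: h. Qed.

Lemma homp_axis a (t : R) n : homp a (t *: e_ 1) n = a 0%N n * t ^+ n.
Proof.
rewrite /homp big_ord_recl big1 ?addr0 => [|i _].
  by rewrite /monom2 subn0 expr0 mulr1 !mxE /= mulr1.
by rewrite /monom2 !mxE /= mulr0 expr0n /= mulr0 mul0r.
Qed.

(** The restriction to the line x^1 = 0 is made a function of two variables again, so that
    uniqueness of coefficients applies to it; only row 0 of [a] survives. *)
Lemma ps_axis a f : is_ps a f -> is_ps (swap_coefs (xseries (a 0%N))) (fun x => f (x 0 1 *: e_ 1)).
Proof.
move=> [ga h]; split.
  apply: gbd_swap; apply: gbd_xseries; case: ga => M [M1 hM]; exists M, M => n.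
  by rewrite -exprS; apply: hM.
apply: filterS (near_coord (near_axis h)) => x.
rewrite (_ : homp a _ = homp (swap_coefs (xseries (a 0%N))) x) //.
apply/funext => n; rewrite homp_axis -[x in RHS]swapK homp_swap homp_xseries.
by rewrite mxE rev_ord20.
Qed.

Lemma axis_coefs a b f g : is_ps a f -> is_ps b g ->
  (\forall t \near (0 : R), f (t *: e_ 1) = g (t *: e_ 1)) -> forall j, a 0%N j = b 0%N j.
Proof.
move=> /ps_axis ha /ps_axis hb fg j.
exact: (ps_coefs_unique ha hb (near_coord fg) 0%N j).
Qed.

Lemma axis_eq a b f g : is_ps a f -> is_ps b g -> (forall j, a 0%N j = b 0%N j) ->
  \forall t \near (0 : R), f (t *: e_ 1) = g (t *: e_ 1).
Proof.
move=> [_ /near_axis ha] [_ /near_axis hb] ab; apply: filterS2 ha hb => t h1 h2.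
apply: cvg_unique h1 _ => //; rewrite (_ : homp a _ = homp b (t *: e_ 1)) //.
by apply/funext => n; rewrite !homp_axis ab.
Qed.

Lemma analytic1_lift (phi : R -> R) : analytic1 phi -> analytic2 (fun x => phi (x 0 1)).
Proof.
move=> [a /near1P[e e0 h]].
suff : is_ps (swap_coefs (xseries a)) (fun x => phi (x 0 1)) by apply: ps_analytic2.
split.
  apply: gbd_swap; apply: gbd_xseries.
  have : cvgn (pseries a e) by apply/cvg_ex; exists (phi e); apply: h; rewrite gtr0_norm.
  move=> /cvg_series_cvg_0 c0.
  have /cvg_seq_bounded : cvgn (fun n => a n * e ^+ n) by apply/cvg_ex; exists 0.
  move=> [C [Cr hC]]; exists (C + 1), e^-1 => n.
  rewrite exprVn ler_pdivlMr ?exprn_gt0 // -{1}(ger0_norm (exprn_ge0 n (ltW e0))) -normrM.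
  by apply: hC => //; rewrite ltrDl.
apply/near0P; exists e => // x xe.
rewrite (_ : homp _ x = fun n => a n * x 0 1 ^+ n); first exact: h.
by apply/funext => n; rewrite -[x in LHS]swapK homp_swap homp_xseries mxE rev_ord20.
Qed.

Lemma analytic1_axis f : analytic2 f -> analytic1 (fun t : R => f (t *: e_ 1)).
Proof.
move=> /analytic2_ps[a [_ ha]]; exists (a 0%N); apply: filterS (near_axis ha) => t.
rewrite (_ : homp a _ = fun n => a 0%N n * t ^+ n) //.
by apply/funext => n; rewrite homp_axis.
Qed.

(** * Cauchy problem for an equation solved for the second x^1-derivative *)

Section Normal.
Variables al be ga de ka : T -> R.
Hypotheses (hal : analytic2 al) (hbe : analytic2 be) (hga : analytic2 ga)
  (hde : analytic2 de) (hka : analytic2 ka).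

Definition normal_pde W := \forall y \near (0 : T), partial 0 (partial 0 W) y =
  al y * partial 1 (partial 1 W) y + be y * partial 0 (partial 1 W) y
  + ga y * partial 0 W y + de y * partial 1 W y + ka y.

Lemma ck_ps a b c d k s W : is_ps a al -> is_ps b be -> is_ps c ga -> is_ps d de -> is_ps k ka ->
  is_ps s W -> is_ps (ck_rhs a b c d k s) (fun y => al y * partial 1 (partial 1 W) y
    + be y * partial 0 (partial 1 W) y + ga y * partial 0 W y + de y * partial 1 W y + ka y).
Proof.
move=> ha hb hc hd hk hw; rewrite /ck_rhs.
have h1 := ps_partial1 hw; have h0 := ps_partial0 hw.
apply: ps_add hk; apply: ps_add (ps_mul hd h1); apply: ps_add (ps_mul hc h0).
exact: ps_add (ps_mul ha (ps_partial1 h1)) (ps_mul hb (ps_partial0 h1)).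
Qed.

Lemma normal_pde_exists P Q : analytic2 P -> analytic2 Q -> exists W,
  [/\ analytic2 W, normal_pde W,
      \forall t \near (0 : R), W (t *: e_ 1) = P (t *: e_ 1)
    & \forall t \near (0 : R), partial 0 W (t *: e_ 1) = Q (t *: e_ 1)].
Proof.
move=> /analytic2_ps[p hp] /analytic2_ps[q hq].
have [a ha] := analytic2_ps hal; have [b hb] := analytic2_ps hbe.
have [c hc] := analytic2_ps hga; have [d hd] := analytic2_ps hde.
have [k hk] := analytic2_ps hka.
(* The data enter through row 0 of the series of P and Q alone: rows 0 and 1 of the solution are the
   coefficients of W and of its x^1-derivative on the line. *)
pose w := ck_sol a b c d k (p 0%N) (q 0%N).
have gw : gbd w.
  have [M1 [m1 m2]] := gb_common (proj1 ha) (proj1 hb).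
  have [M2 [m3 m4]] := gb_common (proj1 hc) (proj1 hd).
  have [M3 [m5 m6]] := gb_common (proj1 hp) (proj1 hq).
  have [M4 m7] := proj1 hk.
  pose M := Num.max (Num.max M1 M2) (Num.max M3 M4).
  have l1 : M1 <= M by rewrite /M !le_max lexx ?orbT.
  have l2 : M2 <= M by rewrite /M !le_max lexx ?orbT.
  have l3 : M3 <= M by rewrite /M !le_max lexx ?orbT.
  have l4 : M4 <= M by rewrite /M !le_max lexx ?orbT.
  apply: (@ck_sol_gbd _ a b c d k _ _ M); rewrite //.
  - exact: gb_mono l1 m1.
  - exact: gb_mono l1 m2.
  - exact: gb_mono l2 m3.
  - exact: gb_mono l2 m4.
  - exact: gb_mono l4 m7.
  - by move=> j; case: (gb_mono l3 m5) => _; apply.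
  - by move=> j; case: (gb_mono l3 m6) => _; apply.
have [W hW] := ps_exists gw; exists W; split.
- exact: ps_analytic2 hW.
- apply: ps_fun_unique (ps_partial0 (ps_partial0 hW)) _.
  have -> : d0 (d0 w) = ck_rhs a b c d k w.
    by apply/funext => i; apply/funext => j; apply: ck_sol_eq.
  exact: ck_ps.
- by apply: axis_eq hW hp _.
- apply: axis_eq (ps_partial0 hW) hq _ => j.
  by rewrite /d0 mul1r.
Qed.

Lemma normal_pde_unique W W' : analytic2 W -> analytic2 W' -> normal_pde W -> normal_pde W' ->
  (\forall t \near (0 : R), W (t *: e_ 1) = W' (t *: e_ 1)) ->
  (\forall t \near (0 : R), partial 0 W (t *: e_ 1) = partial 0 W' (t *: e_ 1)) ->
  \forall y \near (0 : T), W y = W' y.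
Proof.
move=> /analytic2_ps[w hw] /analytic2_ps[w' hw'] e1 e2 t0 t1.
have [a ha] := analytic2_ps hal; have [b hb] := analytic2_ps hbe.
have [c hc] := analytic2_ps hga; have [d hd] := analytic2_ps hde.
have [k hk] := analytic2_ps hka.
have E1 : ck_eq a b c d k w.
  exact: ps_coefs_unique (ps_partial0 (ps_partial0 hw)) (ck_ps ha hb hc hd hk hw) e1.
have E2 : ck_eq a b c d k w'.
  exact: ps_coefs_unique (ps_partial0 (ps_partial0 hw')) (ck_ps ha hb hc hd hk hw') e2.
have ww : w = w'.
  apply/funext => i; apply/funext => j; apply: (ck_unique E1 E2) => l.
    exact: axis_coefs hw hw' t0 l.
  have := axis_coefs (ps_partial0 hw) (ps_partial0 hw') t1 l.
  by rewrite /d0 !mul1r.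
by rewrite ww in hw; apply: ps_fun_unique hw hw'.
Qed.

End Normal.

Lemma partial2_chain i j W u : analytic2 W -> (forall i, analytic2 (fun x => u x 0 i)) ->
  u 0 = 0 -> \forall x \near (0 : T), partial j (partial i (fun z => W (u z))) x =
    (partial 0 (partial 0 W) (u x) * partial j (fun z => u z 0 0) x
     + partial 0 (partial 1 W) (u x) * partial j (fun z => u z 0 1) x)
      * partial i (fun z => u z 0 0) x
    + partial 0 W (u x) * partial j (partial i (fun z => u z 0 0)) x
    + ((partial 0 (partial 1 W) (u x) * partial j (fun z => u z 0 0) x
        + partial 1 (partial 1 W) (u x) * partial j (fun z => u z 0 1) x)
        * partial i (fun z => u z 0 1) x
       + partial 1 W (u x) * partial j (partial i (fun z => u z 0 1)) x).
Proof.
move=> hW hu u0.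
have hWk k : analytic2 (fun x => partial k W (u x)) by apply: an_comp => //; apply: an_partial.
have hui k : analytic2 (partial i (fun z => u z 0 k)) by apply: an_partial.
have h1 := partial_near j (chain_rule i hW hu u0).
have h2 := partialD j (an_mul (hWk 0) (hui 0)) (an_mul (hWk 1) (hui 1)).
have h3 k := partialM j (hWk k) (hui k).
have h4 k := chain_rule j (an_partial k hW) hu u0.
(* Symmetry of the second derivatives of W allows the statement to contain a single mixed one. *)
have h5 := near_pull hu u0 (partial_comm hW).
apply: filterS2 (filterI h1 (filterI h2 h5)) (filterI (filterI (h3 0) (h3 1)) (filterI (h4 0) (h4 1))).
move=> x [k1 [k2 k5]] [[k3 k3'] [k4 k4']].
by rewrite k1 k2 k3 k3' k4 k4' k5.
Qed.

Definition lin_op (a b c d e : T -> R) w x :=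
  a x * partial 0 (partial 0 w) x + b x * partial 0 (partial 1 w) x
  + c x * partial 1 (partial 1 w) x + d x * partial 0 w x + e x * partial 1 w x.

Lemma leading_coefficient (s k p00 p01 p11 q0 q1 c1 c2 l0 l1 : R) : s != 0 ->
  (p00 = - (c2 / s) * p11 + - (c1 / s) * p01 + - (l0 / s) * q0 + - (l1 / s) * q1 + k / s) <->
  (s * p00 + c1 * p01 + c2 * p11 + l0 * q0 + l1 * q1 = k).
Proof.
move=> s0; split=> [->|<-]; by field.
Qed.

(** * Linear second order operators in a chart *)

Section Chart.
Variables (u v : T -> T) (a b c d e k : T -> R).
Hypothesis uv : analytic_chart u v.
Hypotheses (ha : analytic2 a) (hb : analytic2 b) (hc : analytic2 c) (hd : analytic2 d)
  (he : analytic2 e) (hk : analytic2 k).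

Local Notation du i j := (partial i (fun z => u z 0 j)).

Lemma chart_u0 : u 0 = 0. Proof. by case: uv. Qed.
Lemma chart_anu i : analytic2 (fun x => u x 0 i). Proof. by case: uv. Qed.
Lemma chart_anv i : analytic2 (fun x => v x 0 i). Proof. by case: uv. Qed.
Lemma chart_v0 : v 0 = 0.
Proof. by case: uv => u0 _ _ /nbhs_singleton h _; rewrite -[in v 0]u0. Qed.

(** The principal symbol of the operator at the differential of x^1, that is, the coefficient of the
    second x^1-derivative in the chart. *)
Definition symbol x := a x * du 0 0 x ^+ 2 + b x * (du 0 0 x * du 1 0 x) + c x * du 1 0 x ^+ 2.
Definition chart_cross x := 2 * a x * (du 0 0 x * du 0 1 x)
  + b x * (du 0 0 x * du 1 1 x + du 1 0 x * du 0 1 x) + 2 * c x * (du 1 0 x * du 1 1 x).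
Definition chart_second x := a x * du 0 1 x ^+ 2 + b x * (du 0 1 x * du 1 1 x) + c x * du 1 1 x ^+ 2.
Definition chart_first j := lin_op a b c d e (fun z => u z 0 j).

Lemma lin_op_chart W : analytic2 W -> \forall x \near (0 : T),
  lin_op a b c d e (fun z => W (u z)) x =
    symbol x * partial 0 (partial 0 W) (u x) + chart_cross x * partial 0 (partial 1 W) (u x)
    + chart_second x * partial 1 (partial 1 W) (u x) + chart_first 0 x * partial 0 W (u x)
    + chart_first 1 x * partial 1 W (u x).
Proof.
move=> hW; have hu := chart_anu; have u0 := chart_u0.
have h2 i j := partial2_chain i j hW hu u0.
have h1 i := chain_rule i hW hu u0.
apply: filterS2 (filterI (h2 0 0) (filterI (h2 1 0) (h2 1 1))) (filterI (h1 0) (h1 1)).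
move=> x [k00 [k10 k11]] [k0 k1].
rewrite /lin_op k00 k10 k11 k0 k1 /symbol /chart_cross /chart_second /chart_first /lin_op.
do ?[move: (partial _ _ x) => ?]; do ?[move: (partial _ _ (u x)) => ?].
move: (a x) (b x) (c x) (d x) (e x) => ? ? ? ? ?.
by ring.
Qed.

Lemma an_sqr f : analytic2 f -> analytic2 (fun x => f x ^+ 2).
Proof. by move=> h; apply: an_mul. Qed.

Lemma an_lin_op w : analytic2 w -> analytic2 (lin_op a b c d e w).
Proof.
move=> hw; rewrite /lin_op.
have p i := an_partial i hw; have pp i j := an_partial i (p j).
exact: an_add (an_add (an_add (an_add (an_mul ha (pp 0 0)) (an_mul hb (pp 0 1)))
  (an_mul hc (pp 1 1))) (an_mul hd (p 0))) (an_mul he (p 1)).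
Qed.

Lemma an_du i j : analytic2 (du i j).
Proof. by apply: an_partial; apply: chart_anu. Qed.

Lemma an_symbol : analytic2 symbol.
Proof.
have h := an_du.
exact: an_add (an_add (an_mul ha (an_sqr (h 0 0))) (an_mul hb (an_mul (h 0 0) (h 1 0))))
  (an_mul hc (an_sqr (h 1 0))).
Qed.

Lemma an_chart_cross : analytic2 chart_cross.
Proof.
have h := an_du.
exact: an_add (an_add (an_mul (an_mul (an_cst 2) ha) (an_mul (h 0 0) (h 0 1)))
  (an_mul hb (an_add (an_mul (h 0 0) (h 1 1)) (an_mul (h 1 0) (h 0 1)))))
  (an_mul (an_mul (an_cst 2) hc) (an_mul (h 1 0) (h 1 1))).
Qed.

Lemma an_chart_second : analytic2 chart_second.
Proof.
have h := an_du.
exact: an_add (an_add (an_mul ha (an_sqr (h 0 1))) (an_mul hb (an_mul (h 0 1) (h 1 1))))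
  (an_mul hc (an_sqr (h 1 1))).
Qed.

Hypothesis noncharacteristic : symbol 0 != 0.

Let quot (f : T -> R) y := f (v y) / symbol (v y).

Lemma an_compv f : analytic2 f -> analytic2 (fun y => f (v y)).
Proof. by move=> hf; apply: an_comp => //; [exact: chart_anv|exact: chart_v0]. Qed.

Let an_quot f : analytic2 f -> analytic2 (quot f).
Proof.
move=> hf; apply: an_div; [exact: an_compv|exact: an_compv an_symbol|].
by rewrite chart_v0.
Qed.

Let pde W := normal_pde (fun y => - quot chart_second y) (fun y => - quot chart_cross y)
  (fun y => - quot (chart_first 0) y) (fun y => - quot (chart_first 1) y) (quot k) W.

Let near_symbol : \forall y \near (0 : T), symbol (v y) != 0.
Proof.
apply: near_pull (near_neq0 an_symbol noncharacteristic); [exact: chart_anv|exact: chart_v0].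
Qed.

(** [lin_op_chart] evaluates the coefficients at x and the derivatives of W at u(x). Pulling
    neighborhoods back along [u] or [v] passes between that form and the equation in the variable y
    of the chart. *)
Lemma chart_pde W : analytic2 W -> pde W <->
  \forall x \near (0 : T), lin_op a b c d e (fun z => W (u z)) x = k x.
Proof.
move=> hW; have hL := lin_op_chart hW.
case: (uv) => _ _ _ vu uv'.
have hLv := near_pull chart_anv chart_v0 hL.
split => h.
  move: h; rewrite /pde /normal_pde => h.
  have hu := near_pull chart_anu chart_u0 h.
  have hs := near_pull chart_anu chart_u0 near_symbol.
  apply: filterS2 (filterI vu (filterI hu hs)) hL => x [vux [hx sx]] ->.
  apply/(leading_coefficient _ _ _ _ _ _ _ _ _ _ _); first by rewrite -[x in symbol x]vux.
  by rewrite hx /quot vux.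
have {}h := near_pull chart_anv chart_v0 h.
apply: filterS2 (filterI uv' near_symbol) (filterI h hLv) => y [uvy sy] [hy].
rewrite hy uvy => E; apply/(leading_coefficient _ _ _ _ _ _ _ _ _ _ sy); exact: esym E.
Qed.

Lemma lin_op_exists P Q : analytic2 P -> analytic2 Q -> exists W,
  [/\ analytic2 W, \forall x \near (0 : T), lin_op a b c d e (fun z => W (u z)) x = k x,
      \forall t \near (0 : R), W (t *: e_ 1) = P (t *: e_ 1)
    & \forall t \near (0 : R), partial 0 W (t *: e_ 1) = Q (t *: e_ 1)].
Proof.
move=> hP hQ.
have [W [hW pW t0 t1]] := normal_pde_exists (an_opp (an_quot an_chart_second))
  (an_opp (an_quot an_chart_cross)) (an_opp (an_quot (an_lin_op (chart_anu 0))))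
  (an_opp (an_quot (an_lin_op (chart_anu 1)))) (an_quot hk) hP hQ.
by exists W; split => //; apply/chart_pde.
Qed.

Lemma lin_op_unique w w' : analytic2 w -> analytic2 w' ->
  (\forall x \near (0 : T), lin_op a b c d e w x = k x) ->
  (\forall x \near (0 : T), lin_op a b c d e w' x = k x) ->
  (\forall t \near (0 : R), w (v (t *: e_ 1)) = w' (v (t *: e_ 1))) ->
  (\forall t \near (0 : R), partial 0 (fun y => w (v y)) (t *: e_ 1) =
     partial 0 (fun y => w' (v y)) (t *: e_ 1)) ->
  \forall x \near (0 : T), w x = w' x.
Proof.
move=> hw hw' e1 e2 t0 t1; case: (uv) => _ _ _ vu _.
(* [chart_pde] speaks of functions W(u(x)); here W is z composed with [v], and z(v(u(x))) agrees
   with z near 0 together with its derivatives up to order 2. *)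
have aux z : analytic2 z -> (\forall x \near (0 : T), lin_op a b c d e z x = k x) ->
    pde (fun y => z (v y)).
  move=> hz ez; apply/chart_pde; first exact: an_compv.
  have zz : \forall x \near (0 : T), z (v (u x)) = z x by apply: filterS vu => x ->.
  have p1 i := partial_near i zz.
  have p2 i j := partial_near j (p1 i).
  apply: filterS2 (filterI ez (filterI (p1 0) (p1 1))) (filterI (p2 0 0) (filterI (p2 1 0) (p2 1 1))).
  by move=> x [<- [k0 k1]] [k00 [k10 k11]]; rewrite /lin_op k0 k1 k00 k10 k11.
have := normal_pde_unique (an_opp (an_quot an_chart_second))
  (an_opp (an_quot an_chart_cross)) (an_opp (an_quot (an_lin_op (chart_anu 0))))
  (an_opp (an_quot (an_lin_op (chart_anu 1)))) (an_quot hk) (an_compv hw) (an_compv hw')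
  (aux w hw e1) (aux w' hw' e2) t0 t1.
move=> /(near_pull chart_anu chart_u0) h; apply: filterS2 vu h => x.
by move=> ->.
Qed.

End Chart.
End LinearEquation.

(** * Ricci tensor of a conformal metric *)

Section ConformalRicci.
Variable R : realType.
Local Notation T := 'rV[R]_2.
Implicit Types (f P w : T -> R) (x y : T).
Local Notation e_ i := (delta_mx 0 i : T).

Lemma sum_ord2 (V : nmodType) (f : 'I_2 -> V) : \sum_(i < 2) f i = f 0 + f 1.
Proof. by rewrite big_ord_recl big_ord1; congr (_ + f _); apply/val_inj. Qed.

Lemma near_ord2 (P : 'I_2 -> T -> Prop) : (forall i, \forall x \near (0 : T), P i x) ->
  \forall x \near (0 : T), forall i, P i x.
Proof.
move=> h; apply: filterS2 (h 0) (h 1) => x h0 h1 i.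
by case: (ord2P i) => ->.
Qed.

Lemma invmx2 (A : 'M[R]_2) (d := A 0 0 * A 1 1 - A 0 1 * A 1 0) : d != 0 ->
  invmx A = \matrix_(i, j) (if i == j then A (rev_ord i) (rev_ord i) / d else - A i j / d).
Proof.
move=> d0; set B := \matrix_(_, _) _.
have AB : A *m B = 1%:M.
  apply/matrixP => i j; rewrite !mxE sum_ord2 !mxE.
  by case: (ord2P i) => ->; case: (ord2P j) => ->;
    rewrite /= ?rev_ord20 ?rev_ord21 ?mulr1n ?mulr0n; move: d0; rewrite /d => d0; field.
have [uA _] := mulmx1_unit AB.
by rewrite -[RHS](mulKmx uA) AB mulmx1.
Qed.

Lemma det2 (A : 'M[R]_2) : \det A = A 0 0 * A 1 1 - A 0 1 * A 1 0.
Proof.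
have l0 : lift 0 0 = 1 :> 'I_2 by apply/val_inj.
have l1 : lift 1 0 = 0 :> 'I_2 by apply/val_inj.
rewrite (expand_det_row _ 0) sum_ord2 /cofactor !det_mx11 !mxE !l0 !l1 /=.
by rewrite expr0 expr1 mul1r mulN1r mulrN.
Qed.

Definition sym3 (V : Type) (a b c : V) (i j : 'I_2) : V :=
  if i == 0 then (if j == 0 then a else b) else (if j == 0 then b else c).

(* The curvature of e^(-w) g as a rational function of the 2-jets at a point of
   the components E, F, G of g and of w. *)
Section Jets.
Variables (E F G : R) (E1 F1 G1 : 'I_2 -> R) (E2 F2 G2 : 'I_2 -> 'I_2 -> R).

(** Determinant of the metric. Below, [jco] is the adjugate matrix, [jlower] is twice the
    Christoffel symbols of the first kind up to the conformal factor, [jconn] those of the second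
    kind; a prefix [d] marks the derivative in direction m. *)
Definition jdisc := E * G - F * F.
Definition djdisc m := E1 m * G + E * G1 m - (F1 m * F + F * F1 m).
Definition jco k l := if k == l then sym3 E F G (rev_ord k) (rev_ord k) else - sym3 E F G k l.
Definition djco m k l := if k == l then sym3 (E1 m) (F1 m) (G1 m) (rev_ord k) (rev_ord k)
  else - sym3 (E1 m) (F1 m) (G1 m) k l.

Section Weight.
Variables (w1 : 'I_2 -> R) (w2 : 'I_2 -> 'I_2 -> R).
Definition jtwist i a b := sym3 (E1 i) (F1 i) (G1 i) a b - w1 i * sym3 E F G a b.
Definition djtwist m i a b := sym3 (E2 m i) (F2 m i) (G2 m i) a b
  - (w2 m i * sym3 E F G a b + w1 i * sym3 (E1 m) (F1 m) (G1 m) a b).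
Definition jlower i j l := jtwist i j l + jtwist j i l - jtwist l i j.
Definition djlower m i j l := djtwist m i j l + djtwist m j i l - djtwist m l i j.
Definition jconn k i j := 2^-1 * ((jco k 0 * jlower i j 0 + jco k 1 * jlower i j 1) / jdisc).
Definition djconn m k i j := 2^-1 * (
    ((djco m k 0 * jlower i j 0 + jco k 0 * djlower m i j 0)
     + (djco m k 1 * jlower i j 1 + jco k 1 * djlower m i j 1)) / jdisc
    - (jco k 0 * jlower i j 0 + jco k 1 * jlower i j 1) * (djdisc m / jdisc ^+ 2)).
Definition jricci j k := \sum_i (djconn i i j k - djconn j i i k
  + \sum_p (jconn i i p * jconn p j k - jconn i j p * jconn p i k)).
End Weight.

Let z1 : 'I_2 -> R := fun=> 0.
Let z2 : 'I_2 -> 'I_2 -> R := fun=> fun=> 0.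
(** The contraction - g^(ij) Gamma^k_(ij): first order coefficients of the Laplace-Beltrami
    operator. *)
Definition jlap_coef k := - (G * jconn z1 k 0 0 - 2 * F * jconn z1 k 0 1 + E * jconn z1 k 1 1) / jdisc.
Definition jlap (w1 : 'I_2 -> R) (w2 : 'I_2 -> 'I_2 -> R) := G / jdisc * w2 0 0 + - 2 * F / jdisc * w2 0 1 + E / jdisc * w2 1 1
  + jlap_coef 0 * w1 0 + jlap_coef 1 * w1 1.
(** Half the scalar curvature, which in dimension 2 is the sectional curvature. *)
Definition jgauss := (G * jricci z1 z2 0 0 - F * (jricci z1 z2 0 1 + jricci z1 z2 1 0)
  + E * jricci z1 z2 1 1) / (2 * jdisc).

Hypotheses (D0 : jdisc != 0) (Es : E2 1 0 = E2 0 1) (Fs : F2 1 0 = F2 0 1) (Gs : G2 1 0 = G2 0 1).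

Local Ltac jexpand := rewrite /jricci !sum_ord2 /jlap_coef /djconn /jconn /djco /jco /djlower /jlower
  /djtwist /jtwist /djdisc /= ?rev_ord20 ?rev_ord21 /sym3 /=.

(** In dimension 2 the terms quadratic in [w1] cancel from the conformal change of the Ricci tensor;
    this is why the equation for w is linear. *)
Lemma jricci_weight (w1 : 'I_2 -> R) (w2 : 'I_2 -> 'I_2 -> R) j k : w2 1 0 = w2 0 1 ->
  jricci w1 w2 j k = jricci z1 z2 j k + 2^-1 * jlap w1 w2 * sym3 E F G j k.
Proof.
move=> ws; move: D0; rewrite /jlap /jdisc => D0'.
by case: (ord2P j) => ->; case: (ord2P k) => ->; jexpand; rewrite ?Es ?Fs ?Gs ?ws /z1 /z2 /jdisc; field.
Qed.

(** The curvature tensor of a surface has one independent component; contraction with the inverse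
    metric identifies the factor. *)
Lemma jricci_gauss j k : jricci z1 z2 j k = jgauss * sym3 E F G j k.
Proof.
move: D0; rewrite /jgauss /jdisc => D0'.
by case: (ord2P j) => ->; case: (ord2P k) => ->; jexpand; rewrite ?Es ?Fs ?Gs /z1 /z2 /jdisc; field.
Qed.
End Jets.

Lemma partial2_cst m i (k : R) x : partial m (partial i (fun=> k)) x = 0.
Proof.
have -> : partial i (fun=> k) = (fun=> 0) :> (T -> R) by apply/funext => y; exact: partial_cst.
exact: partial_cst.
Qed.

(** * Ricci tensor of the conformal multiples of a metric with components E, F, G *)

Section Metric.
Variables E F G : T -> R.
Hypotheses (hE : analytic2 E) (hF : analytic2 F) (hG : analytic2 G).

Definition entry (i j : 'I_2) : T -> R := sym3 E F G i j.
Definition sym_mx x : 'M[R]_2 := \matrix_(i, j) entry i j x.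
Definition disc x := E x * G x - F x * F x.
Hypothesis disc0 : disc 0 != 0.

Lemma an_entry i j : analytic2 (entry i j).
Proof. by rewrite /entry /sym3; case: ifP => _; case: ifP. Qed.

Lemma an_disc : analytic2 disc.
Proof. exact: an_sub (an_mul hE hG) (an_mul hF hF). Qed.

Lemma near_disc : \forall x \near (0 : T), disc x != 0.
Proof. exact: near_neq0 an_disc disc0. Qed.

(* Components of the inverse of sym_mx, up to the factor 1 / disc. *)
Definition coentry (i j : 'I_2) x : R :=
  if i == j then entry (rev_ord i) (rev_ord i) x else - entry i j x.

Lemma an_coentry i j : analytic2 (coentry i j).
Proof.
rewrite /coentry; case: (i == j); first exact: an_entry.
exact/an_opp/an_entry.
Qed.

Definition raise (L : 'I_2 -> T -> R) k x : R :=
  2^-1 * ((coentry k 0 x * L 0 x + coentry k 1 x * L 1 x) / disc x).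

Lemma an_raise (L : 'I_2 -> T -> R) k : (forall l, analytic2 (L l)) -> analytic2 (raise L k).
Proof.
move=> hL; apply: an_mul (an_cst _) _; apply: an_div an_disc disc0.
exact: an_add (an_mul (an_coentry k 0) (hL 0)) (an_mul (an_coentry k 1) (hL 1)).
Qed.

Lemma partial_raise (L : 'I_2 -> T -> R) k m : (forall l, analytic2 (L l)) -> \forall x \near (0 : T),
  partial m (raise L k) x = 2^-1 * (
    ((partial m (coentry k 0) x * L 0 x + coentry k 0 x * partial m (L 0) x)
     + (partial m (coentry k 1) x * L 1 x + coentry k 1 x * partial m (L 1) x)) / disc x
    - (coentry k 0 x * L 0 x + coentry k 1 x * L 1 x) *
      ((partial m E x * G x + E x * partial m G x - (partial m F x * F x + F x * partial m F x))
       / disc x ^+ 2)).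
Proof.
move=> hL; have hc l := an_mul (an_coentry k l) (hL l).
have hs := an_add (hc 0) (hc 1); have hi := an_inv an_disc disc0.
have h1 := partialM m (an_cst 2^-1) (an_mul hs hi).
have h2 := partialM m hs hi.
have h3 := partialD m (hc 0) (hc 1).
have h4 l := partialM m (an_coentry k l) (hL l).
have h5 := partialV m an_disc disc0.
have h6 := partialB m (an_mul hE hG) (an_mul hF hF).
have h7 := partialM m hE hG; have h8 := partialM m hF hF.
apply: filterS2 (filterI (filterI h1 h2) (filterI h3 (filterI (h4 0) (h4 1))))
  (filterI (filterI h5 h6) (filterI h7 h8)).
move=> x [[k1 k2] [k3 [k4 k4']]] [[k5 k6] [k7 k8]].
rewrite [LHS]k1 partial_cst mul0r add0r k2 k3 k4 k4' k5.
by rewrite [partial m disc x]k6 k7 k8 mulNr mulrN.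
Qed.

Section Conformal.
(** The hypotheses say that [h] is a nonzero constant times exp(- w) without naming the exponential;
    w = 0, h = 1 is the instance for the metric itself. *)
Variables (w h : T -> R) (g : T -> 'M[R]_2).
Hypotheses (hw : analytic2 w) (hh : analytic2 h) (h0 : \forall x \near (0 : T), h x != 0)
  (dh : forall i, \forall x \near (0 : T), partial i h x = - h x * partial i w x)
  (hg : \forall x \near (0 : T), g x = h x *: sym_mx x).

(* The partial derivatives of h P are h (twist P i), as the ones of h are - h dw. *)
Definition twist P i x : R := partial i P x - partial i w x * P x.

Lemma an_twist P i : analytic2 P -> analytic2 (twist P i).
Proof. by move=> hP; apply: an_sub; [|apply: an_mul => //]; apply: an_partial. Qed.

Definition lower i j l x := twist (entry j l) i x + twist (entry i l) j x - twist (entry i j) l x.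

Lemma an_lower i j l : analytic2 (lower i j l).
Proof. by apply: an_sub; [apply: an_add|]; apply/an_twist/an_entry. Qed.

Definition conn k i j := raise (lower i j) k.

(** The first derivatives of [g] carry the factor [h], its inverse matrix carries 1 / h, and the two
    cancel. *)
Lemma christoffel_conn : \forall x \near (0 : T), forall k i j,
  christoffel g k i j x = conn k i j x.
Proof.
have dg i j l : \forall x \near (0 : T), partial i (fun y => g y j l) x = h x * twist (entry j l) i x.
  have gE : \forall x \near (0 : T), g x j l = h x * entry j l x.
    by apply: filterS hg => x ->; rewrite !mxE.
  apply: filterS2 (filterI (partial_near i gE) (dh i)) (partialM i hh (an_entry j l)).
  by move=> x [-> e2] ->; rewrite e2 /twist; ring.
have {}dg : \forall x \near (0 : T), forall i j l,
    partial i (fun y => g y j l) x = h x * twist (entry j l) i x.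
  by do 3 (apply: near_ord2 => ?); apply: dg.
apply: filterS2 (filterI dg hg) (filterI h0 near_disc) => x [e1 e2] [e3 e4] k i j.
have e5 : h x * E x * (h x * G x) - h x * F x * (h x * F x) != 0.
  rewrite (_ : _ - _ = h x ^+ 2 * disc x); last by rewrite /disc; ring.
  by rewrite mulf_neq0 // sqrf_eq0.
rewrite /christoffel sum_ord2 !e1 e2 invmx2; last first.
  by rewrite !mxE /entry /sym3 /=.
rewrite /conn /raise /lower; move: (twist _ _ _) (twist _ _ _) (twist _ _ _) => t1 t2 t3.
move: (twist _ _ _) (twist _ _ _) (twist _ _ _) => t4 t5 t6.
case: (ord2P k) => ->; rewrite !mxE /coentry /= ?rev_ord20 ?rev_ord21 /entry /sym3 /= /disc;
  field; rewrite ?e3 ?e5 ?(e4 : E x * G x - F x * F x != 0) //.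
Qed.

Lemma an_conn k i j : analytic2 (conn k i j).
Proof. by apply: an_raise => l; apply: an_lower. Qed.

Lemma partial_twist P i m : analytic2 P -> \forall x \near (0 : T), partial m (twist P i) x =
  partial m (partial i P) x - (partial m (partial i w) x * P x + partial i w x * partial m P x).
Proof.
move=> hP; have hPi := an_partial i hP; have hwi := an_partial i hw.
apply: filterS2 (partialB m hPi (an_mul hwi hP)) (partialM m hwi hP) => x e1 e2.
by rewrite [LHS]e1 e2.
Qed.

Lemma partial_lower i j l m : \forall x \near (0 : T), partial m (lower i j l) x =
  partial m (twist (entry j l) i) x + partial m (twist (entry i l) j) x
  - partial m (twist (entry i j) l) x.
Proof.
have t a b c := an_twist c (an_entry a b).
apply: filterS2 (partialB m (an_add (t j l i) (t i l j)) (t i j l))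
  (partialD m (t j l i) (t i l j)) => x e1 e2.
by rewrite [LHS]e1 e2.
Qed.

Definition ricci_conn j k x := \sum_i (partial i (conn i j k) x - partial j (conn i i k) x
  + \sum_p (conn i i p x * conn p j k x - conn i j p x * conn p i k x)).

Lemma ricciE : \forall x \near (0 : T), forall j k, ricci g x j k = ricci_conn j k x.
Proof.
have dc m k i j : \forall x \near (0 : T),
    partial m (christoffel g k i j) x = partial m (conn k i j) x.
  by apply: partial_near; apply: filterS christoffel_conn => x; apply.
have {}dc : \forall x \near (0 : T), forall m k i j,
    partial m (christoffel g k i j) x = partial m (conn k i j) x.
  by do 4 (apply: near_ord2 => ?); apply: dc.
apply: filterS2 dc christoffel_conn => x e1 e2 j k; rewrite mxE.
apply: eq_bigr => i _; rewrite /riemann !e1; congr (_ + _).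
by apply: eq_bigr => p _; rewrite !e2.
Qed.

Lemma an_ricci j k : analytic2 (fun x => ricci g x j k).
Proof.
apply: (@an_ext _ (ricci_conn j k)); last by apply: filterS ricciE => x ->.
apply: an_sum => i; apply: an_add.
  by apply: an_sub; apply: an_partial; apply: an_conn.
by apply: an_sum => p; apply: an_sub; apply: an_mul; apply: an_conn.
Qed.

Lemma partial_coentry k l m : \forall x \near (0 : T), partial m (coentry k l) x =
  if k == l then partial m (entry (rev_ord k) (rev_ord k)) x else - partial m (entry k l) x.
Proof.
rewrite /coentry; case: (k == l); first exact: near0W.
exact: partialN (an_entry _ _).
Qed.

(** Collects all differentiation rules on one neighborhood, so that the passage to jets becomes
    pointwise rewriting. *)
Lemma near_jets : \forall x \near (0 : T), [/\
  (forall k l m, partial m (coentry k l) x =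
    if k == l then partial m (entry (rev_ord k) (rev_ord k)) x else - partial m (entry k l) x),
  (forall k i j m, partial m (conn k i j) x = 2^-1 * (
    ((partial m (coentry k 0) x * lower i j 0 x + coentry k 0 x * partial m (lower i j 0) x)
     + (partial m (coentry k 1) x * lower i j 1 x + coentry k 1 x * partial m (lower i j 1) x)) / disc x
    - (coentry k 0 x * lower i j 0 x + coentry k 1 x * lower i j 1 x) *
      ((partial m E x * G x + E x * partial m G x - (partial m F x * F x + F x * partial m F x))
       / disc x ^+ 2))),
  (forall i j l m, partial m (lower i j l) x =
    partial m (twist (entry j l) i) x + partial m (twist (entry i l) j) x
    - partial m (twist (entry i j) l) x)
  & (forall a b i m, partial m (twist (entry a b) i) x = partial m (partial i (entry a b)) x
    - (partial m (partial i w) x * entry a b x + partial i w x * partial m (entry a b) x))].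
Proof.
have h1 : \forall x \near (0 : T), forall k l m, partial m (coentry k l) x =
    if k == l then partial m (entry (rev_ord k) (rev_ord k)) x else - partial m (entry k l) x.
  by do 3 (apply: near_ord2 => ?); apply: partial_coentry.
have h2 := near_ord2 (fun k => near_ord2 (fun i => near_ord2 (fun j => near_ord2 (fun m =>
  partial_raise k m (an_lower i j))))).
have h3 := near_ord2 (fun i => near_ord2 (fun j => near_ord2 (fun l => near_ord2 (fun m =>
  partial_lower i j l m)))).
have h4 := near_ord2 (fun a => near_ord2 (fun b => near_ord2 (fun i => near_ord2 (fun m =>
  partial_twist i m (an_entry a b))))).
apply: filterS2 (filterI h1 h2) (filterI h3 h4) => x [k1 k2] [k3 k4].
exact: (And4 k1 (fun k i j => k2 k i j) k3 k4).
Qed.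

End Conformal.

Lemma entryE i j x : entry i j x = sym3 (E x) (F x) (G x) i j.
Proof. by rewrite /entry /sym3; case: ifP => _; case: ifP. Qed.

Lemma partial_entryE m i j x :
  partial m (entry i j) x = sym3 (partial m E x) (partial m F x) (partial m G x) i j.
Proof. by rewrite /entry /sym3; case: ifP => _; case: ifP. Qed.

Lemma partial2_entryE m l i j x : partial m (partial l (entry i j)) x =
  sym3 (partial m (partial l E) x) (partial m (partial l F) x) (partial m (partial l G) x) i j.
Proof. by rewrite /entry /sym3; case: ifP => _; case: ifP. Qed.

Lemma coentryE k l x : coentry k l x = jco (E x) (F x) (G x) k l.
Proof. by rewrite /coentry /jco !entryE. Qed.

Lemma lower_jet w i j l x : lower w i j l x = jlower (E x) (F x) (G x)
    (fun m => partial m E x) (fun m => partial m F x) (fun m => partial m G x)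
    (fun m => partial m w x) i j l.
Proof. by rewrite /lower /jlower /twist /jtwist !partial_entryE !entryE. Qed.

Lemma conn_jet w k i j x : conn w k i j x = jconn (E x) (F x) (G x)
    (fun m => partial m E x) (fun m => partial m F x) (fun m => partial m G x)
    (fun m => partial m w x) k i j.
Proof. by rewrite /conn /raise /jconn !lower_jet !coentryE. Qed.

Lemma partial_conn_jet w : analytic2 w -> \forall x \near (0 : T), forall m k i j,
  partial m (conn w k i j) x = djconn (E x) (F x) (G x)
    (fun m => partial m E x) (fun m => partial m F x) (fun m => partial m G x)
    (fun m i => partial m (partial i E) x) (fun m i => partial m (partial i F) x)
    (fun m i => partial m (partial i G) x)
    (fun m => partial m w x) (fun m i => partial m (partial i w) x) m k i j.
Proof.
move=> hw; apply: filterS (near_jets hw) => x [a1 a2 a3 a4] m k i j.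
have dt p b c : partial m (twist w (entry b c) p) x = djtwist (E x) (F x) (G x)
    (fun m => partial m E x) (fun m => partial m F x) (fun m => partial m G x)
    (fun m i => partial m (partial i E) x) (fun m i => partial m (partial i F) x)
    (fun m i => partial m (partial i G) x)
    (fun m => partial m w x) (fun m i => partial m (partial i w) x) m p b c.
  rewrite a4 /djtwist; congr (_ - (_ * _ + _ * _)).
  - exact: partial2_entryE.
  - exact: entryE.
  - exact: partial_entryE.
have dl l : partial m (lower w i j l) x = djlower (E x) (F x) (G x)
    (fun m => partial m E x) (fun m => partial m F x) (fun m => partial m G x)
    (fun m i => partial m (partial i E) x) (fun m i => partial m (partial i F) x)
    (fun m i => partial m (partial i G) x)
    (fun m => partial m w x) (fun m i => partial m (partial i w) x) m i j l.
  rewrite a3 /djlower; congr (_ + _ - _); exact: dt.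
have dc l : partial m (coentry k l) x = djco (fun m => partial m E x) (fun m => partial m F x)
    (fun m => partial m G x) m k l.
  rewrite a1 /djco; case: (k == l); first exact: partial_entryE.
  congr (- _); exact: partial_entryE.
rewrite a2 /djconn.
congr (2^-1 * (((_ * _ + _ * _) + (_ * _ + _ * _)) / _ - (_ * _ + _ * _) * _)).
- exact: dc.
- exact: lower_jet.
- exact: coentryE.
- exact: dl.
- exact: dc.
- exact: lower_jet.
- exact: coentryE.
- exact: dl.
- exact: coentryE.
- exact: lower_jet.
- exact: coentryE.
- exact: lower_jet.
Qed.

Lemma ricci_conn_jet w : analytic2 w -> \forall x \near (0 : T), forall j k,
  ricci_conn w j k x = jricci (E x) (F x) (G x)
    (fun m => partial m E x) (fun m => partial m F x) (fun m => partial m G x)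
    (fun m i => partial m (partial i E) x) (fun m i => partial m (partial i F) x)
    (fun m i => partial m (partial i G) x)
    (fun m => partial m w x) (fun m i => partial m (partial i w) x) j k.
Proof.
move=> hw; apply: filterS (partial_conn_jet hw) => x h j k.
apply: eq_bigr => i _; rewrite !h; congr (_ + _).
by apply: eq_bigr => p _; rewrite !conn_jet.
Qed.

Definition base_conn := conn (fun=> 0).

Definition gauss x := (G x * ricci sym_mx x 0 0 - F x * (ricci sym_mx x 0 1 + ricci sym_mx x 1 0)
  + E x * ricci sym_mx x 1 1) / (2 * disc x).

Definition lap_coef k x := - (G x * base_conn k 0 0 x - 2 * F x * base_conn k 0 1 x
  + E x * base_conn k 1 1 x) / disc x.

Definition laplacian := lin_op (fun x => G x / disc x) (fun x => - 2 * F x / disc x)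
  (fun x => E x / disc x) (lap_coef 0) (lap_coef 1).

(** The Ricci tensor is expressed through jets twice, for (w, h) and for (0, 1). The second
    expression identifies [gauss], and the two jet identities compare the first with it. *)
Lemma ricci_conformal w (h : T -> R) (g : T -> 'M[R]_2) : analytic2 w -> analytic2 h -> (\forall x \near (0 : T), h x != 0) ->
  (forall i, \forall x \near (0 : T), partial i h x = - h x * partial i w x) ->
  (\forall x \near (0 : T), g x = h x *: sym_mx x) ->
  \forall x \near (0 : T), ricci g x = (gauss x + 2^-1 * laplacian w x) *: sym_mx x.
Proof.
move=> hw hh h0 dh hg.
have c0 : analytic2 (fun _ : T => 0 : R) := an_cst 0.
have c1 : analytic2 (fun _ : T => 1 : R) := an_cst 1.
have n1 : \forall x \near (0 : T), (1 : R) != 0 by apply: near0W => x; apply: oner_neq0.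
have d1 i : \forall x \near (0 : T), partial i (fun=> 1) x = - 1 * partial i (fun=> 0 : R) x.
  by apply: near0W => x; rewrite !partial_cst mulr0.
have g1 : \forall x \near (0 : T), sym_mx x = 1 *: sym_mx x.
  by apply: near0W => x; rewrite scale1r.
have q1 := ricciE hh h0 dh hg.
have q2 := ricciE c1 n1 d1 g1.
have q3 := ricci_conn_jet hw.
have q4 := ricci_conn_jet c0.
apply: filterS2 (filterI (filterI q1 q2) (filterI q3 q4)) (filterI (filterI (filterI (partial_comm hE)
  (partial_comm hF)) (filterI (partial_comm hG) (partial_comm hw))) near_disc).
move=> x [[r1 r0] [j1 j0]] [[[sE sF] [sG sw]] D0].
have z2 : (fun m i : 'I_2 => partial m (partial i (fun=> 0 : R)) x) = fun=> fun=> 0.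
  apply/funext => m; apply/funext => i.
  exact: partial2_cst.
have z1 : (fun m : 'I_2 => partial m (fun=> 0 : R) x) = fun=> 0.
  by apply/funext => m; rewrite partial_cst.
have {}j0 j k : ricci_conn (fun=> 0) j k x = jricci (E x) (F x) (G x)
    (fun m => partial m E x) (fun m => partial m F x) (fun m => partial m G x)
    (fun m i => partial m (partial i E) x) (fun m i => partial m (partial i F) x)
    (fun m i => partial m (partial i G) x) (fun=> 0) (fun=> fun=> 0) j k.
  by rewrite j0; congr (jricci _ _ _ _ _ _ _ _ _ _ _ j k).
have D0' : jdisc (E x) (F x) (G x) != 0 := D0.
have JG := @jricci_gauss (E x) (F x) (G x) (fun m => partial m E x) (fun m => partial m F x)
  (fun m => partial m G x) (fun m i => partial m (partial i E) x)
  (fun m i => partial m (partial i F) x) (fun m i => partial m (partial i G) x)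
  D0' (esym sE) (esym sF) (esym sG).
have JW := @jricci_weight (E x) (F x) (G x) (fun m => partial m E x) (fun m => partial m F x)
  (fun m => partial m G x) (fun m i => partial m (partial i E) x)
  (fun m i => partial m (partial i F) x) (fun m i => partial m (partial i G) x)
  D0' (esym sE) (esym sF) (esym sG) (fun m => partial m w x)
  (fun m i => partial m (partial i w) x) _ _ (esym sw).
apply/matrixP => j k.
rewrite (r1 j k) (j1 j k) JW JG mxE mxE entryE -mulrDl.
congr ((_ + _ * _) * _).
  by rewrite /gauss !r0 !j0.
rewrite /jlap /jlap_coef /laplacian /lin_op /lap_coef /base_conn !conn_jet z1.
by [].
Qed.

End Metric.
End ConformalRicci.

(** * Metrics with prescribed Ricci tensor *)

Section Classification.
Variable R : realType.
Local Notation T := 'rV[R]_2.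
Local Notation e_ i := (delta_mx 0 i : T).
Implicit Types (f w : T -> R) (g : T -> 'M[R]_2) (x y : T) (phi psi : R -> R).

Lemma near_entry_sym g : (\forall x \near (0 : T), (g x)^T = g x) ->
  \forall x \near (0 : T), g x = sym_mx (fun x => g x 0 0) (fun x => g x 0 1) (fun x => g x 1 1) x.
Proof.
apply: filterS => x gx; apply/matrixP => i j; rewrite !mxE /entry /sym3.
case: (ord2P i) => ->; case: (ord2P j) => -> //=.
by rewrite -[in LHS]gx mxE.
Qed.

Lemma unitmx2 (A : 'M[R]_2) : (A \in unitmx) = (A 0 0 * A 1 1 - A 0 1 * A 1 0 != 0).
Proof. by rewrite unitmxE det2 unitfE. Qed.

Lemma unitmx_scale_inj (A : 'M[R]_2) (s t : R) : A \in unitmx -> s *: A = t *: A -> s = t.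
Proof.
move=> uA st; apply/eqP; rewrite -subr_eq0.
have : (s - t) *: A == 0 by rewrite scalerBl st subrr.
rewrite scaler_eq0 => /orP[//|/eqP A0].
by move: uA; rewrite A0 unitmx2 !mxE !mul0r subrr eqxx.
Qed.

Lemma disc_unit g : (\forall x \near (0 : T), (g x)^T = g x) -> nondegenerate_tensor g ->
  disc (fun x => g x 0 0) (fun x => g x 0 1) (fun x => g x 1 1) 0 != 0.
Proof.
move=> /nbhs_singleton g0 /nbhs_singleton; rewrite unitmx2 /disc.
by rewrite -[in g 0 1 0]g0 mxE.
Qed.

Section Components.
Variables E F G : T -> R.
Hypotheses (hE : analytic2 E) (hF : analytic2 F) (hG : analytic2 G) (D0 : disc E F G 0 != 0).

Lemma an_gauss : analytic2 (gauss E F G).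
Proof.
have c1 : analytic2 (fun _ : T => 1 : R) := an_cst 1.
have n1 : \forall x \near (0 : T), (1 : R) != 0 by apply: near0W => x; apply: oner_neq0.
have d1 i : \forall x \near (0 : T), partial i (fun=> 1) x = - 1 * partial i (fun=> 0 : R) x.
  by apply: near0W => x; rewrite !partial_cst mulr0.
have g1 : \forall x \near (0 : T), sym_mx E F G x = 1 *: sym_mx E F G x.
  by apply: near0W => x; rewrite scale1r.
have hr := an_ricci hE hF hG D0 (an_cst 0) c1 n1 d1 g1.
apply: an_div; first exact: an_add (an_sub (an_mul hG (hr 0 0))
    (an_mul hF (an_add (hr 0 1) (hr 1 0)))) (an_mul hE (hr 1 1)).
- exact: an_mul (an_cst 2) (an_disc hE hF hG).
- by rewrite mulf_neq0 // pnatr_eq0.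
Qed.

Lemma an_lap_coef k : analytic2 (lap_coef E F G k).
Proof.
have hc i j : analytic2 (base_conn E F G k i j) := an_conn hE hF hG D0 (an_cst 0) k i j.
apply: an_div (an_disc hE hF hG) D0; apply: an_opp.
exact: an_add (an_sub (an_mul hG (hc 0 0)) (an_mul (an_mul (an_cst 2) hF) (hc 0 1)))
  (an_mul hE (hc 1 1)).
Qed.

Lemma laplacian_cst x : laplacian E F G (fun=> 0) x = 0.
Proof. by rewrite /laplacian /lin_op !partial2_cst !partial_cst !mulr0 !addr0. Qed.

End Components.

Lemma ricci_near g g' : (\forall x \near (0 : T), g x = g' x) ->
  \forall x \near (0 : T), ricci g x = ricci g' x.
Proof.
move=> gg.
have dg i j l : \forall x \near (0 : T),
    partial i (fun y => g y j l) x = partial i (fun y => g' y j l) x.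
  by apply: partial_near; apply: filterS gg => x ->.
have {}dg : \forall x \near (0 : T), forall i j l,
    partial i (fun y => g y j l) x = partial i (fun y => g' y j l) x.
  by do 3 (apply: near_ord2 => ?); apply: dg.
have cg : \forall x \near (0 : T), forall k i j, christoffel g k i j x = christoffel g' k i j x.
  apply: filterS2 dg gg => x e1 e2 k i j; rewrite /christoffel e2; congr (_ * _).
  by apply: eq_bigr => l _; rewrite !e1.
have dc m k i j : \forall x \near (0 : T),
    partial m (christoffel g k i j) x = partial m (christoffel g' k i j) x.
  by apply: partial_near; apply: filterS cg => x; apply.
have {}dc : \forall x \near (0 : T), forall m k i j,
    partial m (christoffel g k i j) x = partial m (christoffel g' k i j) x.
  by do 4 (apply: near_ord2 => ?); apply: dc.
apply: filterS2 cg dc => x e1 e2; apply/matrixP => j k; rewrite !mxE.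
apply: eq_bigr => i _; rewrite /riemann !e2; congr (_ + _).
by apply: eq_bigr => p _; rewrite !e1.
Qed.

Lemma analytic_metric_near g g' : (\forall x \near (0 : T), g x = g' x) ->
  analytic_metric g -> analytic_metric g'.
Proof.
move=> gg [ag sg ng]; split.
- by move=> i j; apply: an_ext (ag i j) _; apply: filterS gg => x ->.
- by apply: filterS2 gg sg => x ->.
- by apply: filterS2 gg ng => x ->.
Qed.

(** With f = c exp w, the factor 1 / f meets the hypotheses of [ricci_conformal]. *)
Lemma inv_factor w (c : R) : analytic2 w -> c != 0 ->
  let h x := c^-1 * expR (- w x) in
  [/\ analytic2 h, \forall x \near (0 : T), h x != 0
    & forall i, \forall x \near (0 : T), partial i h x = - h x * partial i w x].
Proof.
move=> hw c0 h; have he := an_expR (an_opp hw); split.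
- exact: an_mul (an_cst _) he.
- by apply: near0W => x; rewrite mulf_neq0 ?invr_eq0 // gt_eqF // expR_gt0.
move=> i; have h1 := partialM i (an_cst c^-1) he.
apply: filterS2 (filterI h1 (partial_expR i (an_opp hw))) (partialN i hw) => x [k1 k2] k3.
rewrite [LHS]k1 partial_cst mul0r add0r k2 k3 /h; ring.
Qed.

Lemma mulmx2E (A B : 'M[R]_2) i j : (A *m B) i j = A i 0 * B 0 j + A i 1 * B 1 j.
Proof. by rewrite mxE sum_ord2. Qed.

Lemma congruence2E (A B : 'M[R]_2) i : (B *m A *m B^T) i i =
  A 0 0 * B i 0 ^+ 2 + (A 0 1 + A 1 0) * (B i 0 * B i 1) + A 1 1 * B i 1 ^+ 2.
Proof. by rewrite !mulmx2E !mxE; ring. Qed.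

(** * Metrics whose Ricci tensor is a given tensor, diagonal in a chart *)

Section Fixed.
Variables (r : T -> 'M[R]_2) (u v : T -> T).
Hypotheses (ar : analytic_tensor r) (nr : nondegenerate_tensor r) (uv : analytic_chart u v)
  (dr : \forall y \near (0 : T), is_diag_mx (matrix_in_chart v r y)).

Local Notation E := (fun x : T => r x 0 0).
Local Notation F := (fun x : T => r x 0 1).
Local Notation G := (fun x : T => r x 1 1).

(** Column j holds the components of the differential of x^j. *)
Definition coframe x : 'M[R]_2 := \matrix_(k, j) partial k (fun z => u z 0 j) x.

Lemma jacobian_coframe : \forall y \near (0 : T), 'J v y *m coframe (v y) = 1%:M.
Proof.
have hu := chart_anu uv; have hv := chart_anv uv; have v0 := chart_v0 uv.
have h i j : \forall y \near (0 : T), ('J v y *m coframe (v y)) i j = (1%:M : 'M[R]_2) i j.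
  case: (uv) => _ _ _ _ uvy.
  have E1 : \forall y \near (0 : T), u (v y) 0 j = y 0 j by apply: filterS uvy => y ->.
  have E2 := partial_near i E1.
  apply: filterS2 (filterI E2 (chain_rule i (hu j) hv v0)) (an_row_differentiable hv).
  move=> y [k1 k2] dv; rewrite mulmx2E !(jacobianE _ _ dv) [coframe _ 0 j]mxE [coframe _ 1 j]mxE.
  rewrite mulrC [X in _ + X]mulrC; apply: etrans (esym k2) (etrans k1 _).
  rewrite /partial -(_ : ('D_(e_ i) (id : T -> T) y) 0 j = 'D_(e_ i) (fun y : T => y 0 j) y).
    by rewrite derive_id !mxE eqxx eq_sym.
  by rewrite derive_mx ?mxE //; apply: derivable_id.
have {}h := near_ord2 (fun i => near_ord2 (fun j => h i j)).
by apply: filterS h => y h; apply/matrixP => i j.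
Qed.

(** A diagonal matrix is symmetric, and congruence by the coframe carries symmetry back to the given
    coordinates. Hence [r] can play the role of a metric. *)
Lemma r_sym : \forall x \near (0 : T), (r x)^T = r x.
Proof.
have h : \forall y \near (0 : T), (r (v y))^T = r (v y).
  apply: filterS2 jacobian_coframe dr => y JU dy.
  have UJ := mulmx1C JU.
  have rE : r (v y) = coframe (v y) *m matrix_in_chart v r y *m (coframe (v y))^T.
    rewrite /matrix_in_chart !mulmxA UJ mul1mx -mulmxA -trmx_mul UJ trmx1 mulmx1.
    by [].
  have dT : (matrix_in_chart v r y)^T = matrix_in_chart v r y.
    move/is_diag_mxP: dy => dy; apply/matrixP => i j; rewrite mxE.
    by case: (eqVneq i j) => [->//|ij]; rewrite !dy // eq_sym.
  by rewrite rE trmx_mul trmxK trmx_mul dT mulmxA.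
case: (uv) => _ _ _ vu _.
by apply: filterS2 vu (near_pull (chart_anu uv) (chart_u0 uv) h) => x ->.
Qed.

Let D0 := disc_unit r_sym nr.

Local Notation a := (fun x => G x / disc E F G x).
Local Notation b := (fun x => - 2 * F x / disc E F G x).
Local Notation c := (fun x => E x / disc E F G x).

(** The symbol at 0 is the inverse metric of [r] on dx^1. It is nonzero because d/dx^2, which spans
    the kernel of dx^1, is not null: its square [L 1 1] is a diagonal entry of an invertible
    diagonal matrix. *)
Lemma noncharacteristic : symbol u a b c 0 != 0.
Proof.
have JU := nbhs_singleton jacobian_coframe; have dy := nbhs_singleton dr.
have ur := nbhs_singleton nr; have sr := nbhs_singleton r_sym.
rewrite (chart_v0 uv) in JU.
move: dy; rewrite /matrix_in_chart (chart_v0 uv).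
set J := 'J v 0 in JU *; set U := coframe 0 in JU.
move=> /is_diag_mxP dL; set L := J *m _ *m _ in dL.
have uJ : J \in unitmx by case/mulmx1_unit: JU.
have uL : L \in unitmx by rewrite /L !unitmx_mul uJ unitmx_tr uJ ur.
have L11 : L 1 1 != 0.
  by move: uL; rewrite unitmx2 (dL 0 1) // mul0r subr0 mulf_eq0 negb_or => /andP[].
have r10 : r 0 1 0 = r 0 0 1 by rewrite -{1}sr mxE.
have L11E : L 1 1 = E 0 * J 1 0 ^+ 2 + 2 * F 0 * (J 1 0 * J 1 1) + G 0 * J 1 1 ^+ 2.
  by rewrite /L congruence2E r10; ring.
have JU10 : J 1 0 * U 0 0 + J 1 1 * U 1 0 = 0.
  by have := congr1 (fun M : 'M[R]_2 => M 1 0) JU; rewrite mulmx2E => ->; rewrite mxE.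
have JU00 : J 0 0 * U 0 0 + J 0 1 * U 1 0 = 1.
  by have := congr1 (fun M : 'M[R]_2 => M 0 0) JU; rewrite mulmx2E => ->; rewrite mxE.
have UE k j : partial k (fun z => u z 0 j) 0 = U k j by rewrite /U mxE.
have sE : symbol u a b c 0 = (E 0 * U 1 0 ^+ 2 - 2 * F 0 * (U 0 0 * U 1 0) + G 0 * U 0 0 ^+ 2)
    / disc E F G 0.
  by rewrite /symbol !UE; field.
rewrite sE mulf_neq0 ?invr_eq0 //; apply/eqP => Q0.
(* By [JU10], column 0 of U is proportional to (J 1 1, - J 1 0), so the quadratic form assumed zero
   equals [L 1 1] up to squares of entries; the product containing the left-hand side of [JU10] is
   the correction that makes this a ring identity. *)
have U0 : L 1 1 * U 0 0 ^+ 2 = 0.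
  have -> : L 1 1 * U 0 0 ^+ 2 = J 1 1 ^+ 2 * (E 0 * U 1 0 ^+ 2 - 2 * F 0 * (U 0 0 * U 1 0)
      + G 0 * U 0 0 ^+ 2) + (J 1 0 * U 0 0 + J 1 1 * U 1 0) *
      (E 0 * (J 1 0 * U 0 0 - J 1 1 * U 1 0) + 2 * F 0 * J 1 1 * U 0 0).
    by rewrite L11E; ring.
  by rewrite Q0 JU10 mulr0 mul0r addr0.
have U1 : L 1 1 * U 1 0 ^+ 2 = 0.
  have -> : L 1 1 * U 1 0 ^+ 2 = J 1 0 ^+ 2 * (E 0 * U 1 0 ^+ 2 - 2 * F 0 * (U 0 0 * U 1 0)
      + G 0 * U 0 0 ^+ 2) + (J 1 0 * U 0 0 + J 1 1 * U 1 0) *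
      (G 0 * (J 1 1 * U 1 0 - J 1 0 * U 0 0) + 2 * F 0 * J 1 0 * U 1 0).
    by rewrite L11E; ring.
  by rewrite Q0 JU10 mulr0 mul0r addr0.
move/eqP: U0; rewrite mulf_eq0 (negPf L11) sqrf_eq0 => /eqP U0.
move/eqP: U1; rewrite mulf_eq0 (negPf L11) sqrf_eq0 => /eqP U1.
by move/eqP: JU00; rewrite U0 U1 !mulr0 addr0 eq_sym oner_eq0.
Qed.

Let rhs x := 2 * (1 - gauss E F G x).

Let aE : analytic2 E. Proof. exact: ar. Qed.
Let aF : analytic2 F. Proof. exact: ar. Qed.
Let aG : analytic2 G. Proof. exact: ar. Qed.
Let aD := an_disc aE aF aG.
Let aa : analytic2 a. Proof. exact: an_div aG aD D0. Qed.
Let ab : analytic2 b. Proof. exact: an_div (an_mul (an_cst _) aF) aD D0. Qed.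
Let ac : analytic2 c. Proof. exact: an_div aE aD D0. Qed.
Let al k := an_lap_coef aE aF aG D0 k.
Let arhs : analytic2 rhs.
Proof. exact: an_mul (an_cst _) (an_sub (an_cst _) (an_gauss aE aF aG D0)). Qed.

Definition weight_eq w := \forall x \near (0 : T), laplacian E F G w x = rhs x.

(** Both sides of Ric g = r are multiples of [r], and nondegeneracy of [r] reduces the tensor
    equation to that of the factors. *)
Lemma ricci_weight w (c0 : R) g : analytic2 w -> c0 != 0 ->
  (\forall x \near (0 : T), r x = (c0 * expR (w x)) *: g x) ->
  weight_eq w <-> \forall x \near (0 : T), ricci g x = r x.
Proof.
move=> hw c00 rg; have [hh h0 dh] := inv_factor hw c00.
have rs := near_entry_sym r_sym.
have gh : \forall x \near (0 : T), g x = (c0^-1 * expR (- w x)) *: sym_mx E F G x.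
  apply: filterS2 rg rs => x rx <-; rewrite rx scalerA expRN -invfM mulVf ?scale1r //.
  by rewrite mulf_neq0 // gt_eqF // expR_gt0.
have ric := ricci_conformal aE aF aG D0 hw hh h0 dh gh.
split=> h; apply: filterS2 (filterI ric rs) (filterI h nr) => x [ricx rx] [hx ux].
  by rewrite ricx hx /rhs mulrA mulVf ?mul1r ?pnatr_eq0 // addrC subrK scale1r -rx.
have : (gauss E F G x + 2^-1 * laplacian E F G w x) *: r x = 1 *: r x.
  by rewrite {1}rx -ricx hx scale1r.
move/(unitmx_scale_inj ux) => s1; rewrite /rhs.
by move: (gauss _ _ _ x) (laplacian _ _ _ w x) s1 => K L; lra.
Qed.

Definition solution phi psi g := [/\ analytic_metric g,
  \forall x \near (0 : T), ricci g x = r x & curvature_data r v g phi psi].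

Lemma curvature_neq0 f g : (\forall x \near (0 : T), r x = f x *: g x) -> f 0 != 0.
Proof.
move=> /nbhs_singleton r0; have := nbhs_singleton nr; apply: contraTneq => f0.
by rewrite r0 f0 scale0r unitmx2 !mxE mul0r subrr eqxx.
Qed.

(** This is [ricci_conformal] with weight 0 and with [g] in the place of [r]. *)
Lemma curvature_exists g : analytic_metric g -> (\forall x \near (0 : T), ricci g x = r x) ->
  exists2 f, analytic2 f & \forall x \near (0 : T), r x = f x *: g x.
Proof.
move=> [ag sg ng] hr; have gD := disc_unit sg ng; have gs := near_entry_sym sg.
exists (gauss (fun x => g x 0 0) (fun x => g x 0 1) (fun x => g x 1 1)).
  exact: (an_gauss (ag 0 0) (ag 0 1) (ag 1 1) gD).
have c1 : analytic2 (fun _ : T => 1 : R) := an_cst 1.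
have n1 : \forall x \near (0 : T), (1 : R) != 0 by apply: near0W => x; apply: oner_neq0.
have d1 i : \forall x \near (0 : T), partial i (fun=> 1) x = - 1 * partial i (fun=> 0 : R) x.
  by apply: near0W => x; rewrite !partial_cst mulr0.
have g1 : \forall x \near (0 : T), g x =
    1 *: sym_mx (fun x => g x 0 0) (fun x => g x 0 1) (fun x => g x 1 1) x.
  by apply: filterS gs => x; rewrite scale1r.
have ric := ricci_conformal (ag 0 0) (ag 0 1) (ag 1 1) gD (an_cst 0) c1 n1 d1 g1.
apply: filterS2 (filterI hr ric) gs => x [<- ->] gx.
by rewrite laplacian_cst mulr0 addr0 -gx.
Qed.

Lemma solution_near phi psi g g' : (\forall x \near (0 : T), g x = g' x) ->
  solution phi psi g -> solution phi psi g'.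
Proof.
move=> gg [mg rg [f [af rf cf]]]; split.
- exact: analytic_metric_near mg.
- by apply: filterS2 (ricci_near gg) rg => x <-.
- by exists f; split => //; apply: filterS2 gg rf => x <-.
Qed.

Lemma solution_data phi psi phi' psi' g : (\forall t \near (0 : R), phi t = phi' t) ->
  (\forall t \near (0 : R), psi t = psi' t) -> solution phi psi g -> solution phi' psi' g.
Proof.
move=> h1 h2 [mg rg [f [af rf cf]]]; split => //; exists f; split => //.
by apply: filterS2 (filterI h1 h2) cf => t [<- <-].
Qed.

(** Where [g] is invertible, r = f g determines f, hence its Cauchy data. *)
Lemma solution_data_unique phi psi phi' psi' g : solution phi psi g -> solution phi' psi' g ->
  (\forall t \near (0 : R), phi t = phi' t) /\ (\forall t \near (0 : R), psi t = psi' t).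
Proof.
move=> [[_ _ ng] rg [f [af rf cf]]] [_ _ [f' [af' rf' cf']]].
have ff : \forall x \near (0 : T), f x = f' x.
  apply: filterS2 (filterI rf rf') ng => x [e1 e2] ug; apply: (unitmx_scale_inj ug).
  by rewrite -e1.
have h1 := near_pull (chart_anv uv) (chart_v0 uv) ff.
have h2 := near_axis (partial_near 0 h1).
have {}h1 := near_axis h1.
have h : \forall t \near (0 : R), phi t = phi' t /\ psi t = psi' t.
  by apply: filterS2 (filterI h1 h2) (filterI cf cf') => t [k1 k2] [[<- <-] [<- <-]].
by split; apply: filterS h => t [].
Qed.

Lemma data_exists g : analytic_metric g -> (\forall x \near (0 : T), ricci g x = r x) ->
  exists phi psi, [/\ analytic1 phi, analytic1 psi, phi 0 != 0 & solution phi psi g].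
Proof.
move=> mg rg; have [f af rf] := curvature_exists mg rg.
have afv := an_compv uv af.
exists (fun t => f (v (t *: e_ 1))), (fun t => partial 0 (f \o v) (t *: e_ 1)); split.
- exact: (@analytic1_axis _ (fun y => f (v y)) afv).
- exact: (@analytic1_axis _ (partial 0 (f \o v)) (an_partial 0 afv)).
- by rewrite scale0r (chart_v0 uv) (curvature_neq0 rf).
- split => //; exists f; split => //; apply/near1P; exists 1 => //.
Qed.

Lemma curvature_weight f w (c0 : R) phi psi : analytic2 w -> c0 != 0 ->
  (\forall x \near (0 : T), f x = c0 * expR (w x)) -> cauchy_data v f phi psi <->
  (\forall t \near (0 : R), phi t = c0 * expR (w (v (t *: e_ 1)))
    /\ psi t = phi t * partial 0 (fun y => w (v y)) (t *: e_ 1)).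
Proof.
move=> hw c00 fw.
have hwv := an_compv uv hw.
have h1 := near_pull (chart_anv uv) (chart_v0 uv) fw.
have h2 := near_axis (partial_near 0 h1).
have h3 := near_axis (partialM 0 (an_cst c0) (an_expR hwv)).
have h4 := near_axis (partial_expR 0 hwv).
have {}h1 := near_axis h1.
split=> h; apply: filterS2 (filterI (filterI h1 h2) (filterI h3 h4)) h => t [[k1 k2] [k3 k4]].
  move=> [<- <-]; rewrite -k1; split => //.
  by rewrite [LHS]k2 k3 partial_cst mul0r add0r k4 k1 mulrA.
move=> [e1 e2]; rewrite k1 e1; split => //.
by rewrite [LHS]k2 k3 partial_cst mul0r add0r k4 e2 e1 mulrA.
Qed.

Lemma solution_exists phi psi : analytic1 phi -> analytic1 psi -> phi 0 != 0 ->
  exists g, solution phi psi g.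
Proof.
move=> /analytic1_lift aphi /analytic1_lift apsi phi0.
have phi0' : phi ((0 : T) 0 1) != 0 by rewrite mxE.
(* Data for w: P = log(phi / phi(0)) on the line, and Q = psi / phi for the x^1-derivative. *)
have [P [aP _ phiP]] := an_log aphi phi0'.
rewrite mxE in phiP.
have aQ := an_div apsi aphi phi0'.
have [W [aW eW W0 W1]] := lin_op_exists uv aa ab ac (al 0) (al 1) arhs noncharacteristic aP aQ.
pose w x := W (u x).
have aw : analytic2 w by apply: an_comp aW (chart_anu uv) (chart_u0 uv).
pose f x := phi 0 * expR (w x); pose g x := (f x)^-1 *: r x.
have f0 x : f x != 0 by rewrite mulf_neq0 // gt_eqF // expR_gt0.
have af : analytic2 f by apply: an_mul (an_cst _) (an_expR aw).
have rf : \forall x \near (0 : T), r x = f x *: g x.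
  by apply: near0W => x; rewrite scalerA divff // scale1r.
exists g; split.
- split.
  + move=> i j; apply: an_ext (an_mul (an_inv af (f0 0)) (ar i j)) _.
    by apply: near0W => x; rewrite mxE.
  + by apply: filterS r_sym => x rx; rewrite linearZ /= rx.
  + by apply: filterS nr => x ux; rewrite unitmxZ // unitfE invr_eq0.
- by apply/(ricci_weight aw phi0 rf).
exists f; split => //.
apply/(curvature_weight _ _ aw phi0 (near0W (fun x => erefl))).
case: (uv) => _ _ _ _ uv'.
have wv : \forall y \near (0 : T), w (v y) = W y by apply: filterS uv' => y; rewrite /w => ->.
have wv1 := near_axis (partial_near 0 wv).
have wv0 := near_axis wv.
have ph := near_axis phiP.
have pn := near_axis (near_neq0 aphi phi0').
apply: filterS2 (filterI (filterI wv0 wv1) (filterI ph pn)) (filterI W0 W1).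
move=> t [[k1 k2] [k3 k4]] [e1 e2].
have tE : (t *: e_ 1) 0 1 = t by rewrite !mxE /= mulr1.
rewrite tE in k3 k4; rewrite k1 k2 e1 e2 tE; split => //.
by rewrite mulrC divfK.
Qed.

(** The constant split off is phi(0), equal to f(0) because v(0) = 0. Two solutions with the same
    data therefore share it, and their weights can be compared directly. *)
Lemma solution_weight phi psi g : phi 0 != 0 -> solution phi psi g ->
  exists w, [/\ analytic2 w, weight_eq w,
    \forall x \near (0 : T), r x = (phi 0 * expR (w x)) *: g x
    & \forall t \near (0 : R), phi t = phi 0 * expR (w (v (t *: e_ 1)))
        /\ psi t = phi t * partial 0 (fun y => w (v y)) (t *: e_ 1)].
Proof.
move=> phi0 [mg rg [f [af rf cf]]].
have f0 : f 0 = phi 0.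
  by have [] := nbhs_singleton cf; rewrite scale0r (chart_v0 uv).
have [w [aw _ fw]] := an_log af (curvature_neq0 rf).
rewrite f0 in fw; exists w.
have rw : \forall x \near (0 : T), r x = (phi 0 * expR (w x)) *: g x.
  by apply: filterS2 fw rf => x <-.
split => //; first exact/(ricci_weight aw phi0 rw).
exact/(curvature_weight _ _ aw phi0 fw).
Qed.

Lemma solution_unique phi psi g g' : phi 0 != 0 -> solution phi psi g -> solution phi psi g' ->
  \forall x \near (0 : T), g x = g' x.
Proof.
move=> phi0 /(solution_weight phi0)[w [aw ew rw dw]] /(solution_weight phi0)[w' [aw' ew' rw' dw']].
have h0 : \forall t \near (0 : R), w (v (t *: e_ 1)) = w' (v (t *: e_ 1)).
  by apply: filterS2 dw dw' => t [-> _] [/(mulfI phi0)/expR_inj].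
have h1 : \forall t \near (0 : R), partial 0 (fun y => w (v y)) (t *: e_ 1) =
    partial 0 (fun y => w' (v y)) (t *: e_ 1).
  (* psi is phi times the x^1-derivative of either weight, and phi does not vanish near 0. *)
  apply: filterS2 dw dw' => t [pt e1] [_ e2]; move: e2; rewrite e1 => /mulfI; apply.
  by rewrite pt mulf_neq0 // gt_eqF // expR_gt0.
have ww := lin_op_unique uv aa ab ac (al 0) (al 1) arhs noncharacteristic aw aw' ew ew' h0 h1.
apply: filterS2 (filterI rw rw') ww => x [k1 k2] wx.
apply: (@scalerI _ _ (phi 0 * expR (w x))); first by rewrite mulf_neq0 // gt_eqF // expR_gt0.
by rewrite -k1 wx -k2.
Qed.

End Fixed.

Lemma germ_self (X : topologicalType) (Y : Type) (p : X) (f : X -> Y) : germ p f f.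
Proof. exact: nearW. Qed.

Lemma germ_eqP (X : topologicalType) (Y : Type) (p : X) (f f' : X -> Y) :
  germ p f = germ p f' <-> \forall x \near p, f x = f' x.
Proof.
split=> [ff|ff]; first by have := germ_self p f; rewrite ff.
by apply/seteqP; split => k kf; apply: filterS2 kf ff => x ->.
Qed.

End Classification.

Theorem theorem3p6 (R : realType) (r : 'rV[R]_2 -> 'M[R]_2)
    (u v : 'rV[R]_2 -> 'rV[R]_2)
    (r_analytic : analytic_tensor r) (r_nondegenerate : nondegenerate_tensor r)
    (uv_chart : analytic_chart u v)
    (r_diagonal : \forall y \near (0 : 'rV[R]_2),
       is_diag_mx (matrix_in_chart v r y)) :
  exists G : set (R -> R) * set (R -> R) -> set ('rV[R]_2 -> 'M[R]_2),
    set_bij (function_pairs R) (metrics_with_ricci r) G /\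
    forall (phi psi : R -> R) (g : 'rV[R]_2 -> 'M[R]_2),
      analytic1 phi -> analytic1 psi -> phi 0 != 0 ->
      G (germ (0 : R) phi, germ (0 : R) psi) = germ (0 : 'rV[R]_2) g ->
      curvature_data r v g phi psi.
Proof.
(* Collecting the solutions for all representatives of [p] avoids a choice of representatives; by
   [Gg] the result is the germ of any one solution. *)
pose G (p : set (R -> R) * set (R -> R)) : set ('rV[R]_2 -> 'M[R]_2) :=
  [set g | exists phi psi : R -> R,
    [/\ phi 0 != 0, p = (germ (0 : R) phi, germ (0 : R) psi) & solution r v phi psi g]].
have Gg (phi psi : R -> R) (g : 'rV[R]_2 -> 'M[R]_2) : phi 0 != 0 -> solution r v phi psi g ->
    G (germ (0 : R) phi, germ (0 : R) psi) = germ (0 : 'rV[R]_2) g.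
  move=> phi0 sg; apply/seteqP; split=> g' /=.
    move=> [phi' [psi' [_ [/germ_eqP h1 /germ_eqP h2] sg']]].
    have sg2 : solution r v phi psi g'.
      by apply: solution_data sg'; [apply: filterS h1|apply: filterS h2] => t ->.
    exact: (solution_unique r_analytic r_nondegenerate uv_chart r_diagonal phi0 sg2 sg).
  move=> gg; exists phi, psi; split => //.
  by apply: solution_near sg; apply: filterS gg => x ->.
have exG phi psi := solution_exists r_analytic r_nondegenerate uv_chart r_diagonal (phi:=phi) (psi:=psi).
exists G; split.
  split.
  - move=> _ [[phi psi] [a1 a2 p0] <-] /=; have [g sg] := exG _ _ a1 a2 p0.
    by rewrite (Gg _ _ _ p0 sg); exists g => //; case: sg.
  (* Equal germs of metrics have the same curvature, hence the same Cauchy data. *)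
  - move=> _ _ /set_mem [[phi psi] [a1 a2 p0] <-] /set_mem [[phi' psi'] [a1' a2' p0'] <-] /=.
    have [g sg] := exG _ _ a1 a2 p0; have [g' sg'] := exG _ _ a1' a2' p0'.
    rewrite (Gg _ _ _ p0 sg) (Gg _ _ _ p0' sg') => /germ_eqP gg.
    have [h1 h2] := solution_data_unique uv_chart (solution_near gg sg) sg'.
    by congr (_, _); apply/germ_eqP.
  (* A preimage is given by the Cauchy data of the curvature of g. *)
  - move=> _ [g [mg rg] <-].
    have [phi [psi [a1 a2 p0 sg]]] := data_exists r_nondegenerate uv_chart mg rg.
    exists (germ (0 : R) phi, germ (0 : R) psi); first by exists (phi, psi).
    exact: Gg sg.
move=> phi psi g a1 a2 p0 Gpg.
(* A germ contains its representative, so [g] itself lies in the value of [G] and solves the problem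
   for some representatives of the given pair. *)
have : germ (0 : 'rV[R]_2) g g by apply: germ_self.
rewrite -Gpg => -[phi' [psi' [_ [/germ_eqP h1 /germ_eqP h2] sg]]].
have [] : solution r v phi psi g; last by [].
by apply: solution_data sg; [apply: filterS h1|apply: filterS h2] => t ->.
Qed.
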